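(* Let $(c_1,c_2)\in\mathbb{R}^2$ and let $$\tau_2(c_1,c_2)= \frac{d^4}{dr^4} + c_1\left(\frac{1}{r^2}\frac{d^2}{dr^2} +\frac{d^2}{dr^2}\frac{1}{r^2}\right) + \frac{c_2}{r^4},\qquad r\in(0,\infty).$$ Then the operator $\tau_2(c_1,c_2)|_{C_0^{\infty}((0,\infty))}$ is essentially self-adjoint in $L^2((0,\infty);dr)$ if and only if $$c_2\geq \begin{cases} 45+12c_1+c_1^2 & \text{for } c_1\geq -11/4,\\[4pt] -(105+152c_1)/16 & \text{for } c_1<-11/4.\end{cases}$$
   Context: The differential expression acts on $f\in C_0^\infty((0,\infty))$ (smooth complex-valued functions with compact support in the open half-line) by $\tau_2(c_1,c_2)f = f'''' + c_1\left(r^{-2}f'' + (r^{-2}f)''\right) + c_2 r^{-4}f$. A densely defined symmetric operator in a Hilbert space is essentially self-adjoint if its closure is self-adjoint. *)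

(* Defs.v *)
From HB Require Import structures.
From mathcomp Require Import all_boot all_order all_algebra.
From mathcomp Require Import complex.
From mathcomp Require Import all_classical all_reals all_analysis.
From mathcomp Require Import measurable_realfun.

Set Implicit Arguments.
Unset Strict Implicit.
Unset Printing Implicit Defensive.

Import Order.TTheory GRing.Theory Num.Theory.
Import numFieldNormedType.Exports.

Local Open Scope classical_set_scope.
Local Open Scope ring_scope.
Local Open Scope complex_scope.

(* An element of L^2(mu; C) is given by the mu-a.e. classes of its real and
   imaginary parts, so Leibniz equality on [L2C mu] is a.e. equality.  The
   coercion to functions picks a representative. *)
Record L2C (d : measure_display) (T : measurableType d) (R : realType)
    (mu : {measure set T -> \bar R}) := MkL2C {
  L2re : LspaceType2 mu;
  L2im : LspaceType2 mu }.

Definition L2C_fun (d : measure_display) (T : measurableType d) (R : realType)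
  (mu : {measure set T -> \bar R}) (f : L2C mu) (x : T) : R[i] :=
  (L2re f : T -> R) x +i* (L2im f : T -> R) x.

Coercion L2C_fun : L2C >-> Funclass.

Section L2C_theory.
Context (d : measure_display) (T : measurableType d) (R : realType).
Variable mu : {measure set T -> \bar R}.
Local Open Scope quotient_scope.

Lemma Lspace2_exists (u : T -> R) : u \in Lfun mu 2%:E ->
  exists f : LspaceType2 mu, {ae mu, forall x, (f : T -> R) x = u x}.
Proof.
move=> hu; have := hu; rewrite inE => /andP[]; rewrite !inE /= => mu_ fu.
have mu' : measurable_fun [set: T] (u : T -> measurableTypeR R) := mu_.
pose u0 : {mfun T >-> measurableTypeR R} :=
  HB.pack_for {mfun T >-> measurableTypeR R} (u : T -> measurableTypeR R)
    (isMeasurableFun.Build d _ T (measurableTypeR R) u mu').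
pose c : {mfun_ mu, T >-> measurableTypeR R} := \pi u0.
have E : {ae mu, forall x, (c : T -> R) x = u x}.
  have /eqmodP /asboolP := reprK c.
  by apply: filterS => x /=; apply.
have fin : finite_norm mu 2%:E (c : T -> R).
  have mc : measurable_fun [set: T] (c : T -> R) := measurable_funPT (repr c).
  have mpow (v : T -> R) : measurable_fun [set: T] v ->
      measurable_fun [set: T] (fun x => (`|v x| `^ 2)%:E).
    move=> mv; apply/measurable_EFinP.
    apply: (@measurableT_comp _ _ _ _ _ _ (@powR R ^~ 2)).
      exact: measurable_powR.
    exact: measurableT_comp.
  rewrite /finite_norm; move: fu; rewrite /finite_norm unlock /=.
  congr (_ < _)%E; congr (_ `^ _)%E; apply: ge0_ae_eq_integral => //.
  - exact: (mpow _ mu_).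
  - exact: (mpow _ mc).
  - have F : {ae mu, forall x, [set: T] x ->
        (`|u x| `^ 2)%:E = (`|(c : T -> R) x| `^ 2)%:E}.
      by apply: filterS E => x ->.
    exact: F.
by exists (HB.pack_for (LspaceType2 mu) c
  (isFinLebesgue.Build _ _ _ _ _ _ c fin)).
Qed.

Lemma Lspace2_ae_eq (f g : LspaceType2 mu) :
  {ae mu, forall x, (f : T -> R) x = g x} -> f = g.
Proof.
move=> h.
pose f' : {mfun_ mu, T >-> measurableTypeR R} := f.
pose g' : {mfun_ mu, T >-> measurableTypeR R} := g.
have E : f' = g'.
  rewrite -[f']reprK -[g']reprK; apply/eqmodP/asboolP.
  by apply: filterS h => x.
rewrite /f' /g' in E.
case: f g E {h f' g'} => f [[pf]] [g [[pg]]] /= E.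
subst g; congr LebesgueSpace.Pack; congr LebesgueSpace.Class.
congr isFinLebesgue.Axioms_.
exact: Prop_irrelevance.
Qed.

Lemma L2C_eqP (f g : L2C mu) : f = g <-> {ae mu, forall x, f x = g x}.
Proof.
split=> [->|fg]; first exact: nearW.
case: f g fg => [f1 f2] [g1 g2] fg; congr MkL2C; apply: Lspace2_ae_eq;
  by apply: filterS fg => x [].
Qed.

Lemma L2C_exists (f : T -> R[i]) :
  (fun x => complex.Re (f x)) \in Lfun mu 2%:E ->
  (fun x => complex.Im (f x)) \in Lfun mu 2%:E ->
  exists g : L2C mu, {ae mu, forall x, g x = f x}.
Proof.
move=> /Lspace2_exists[g1 hg1] /Lspace2_exists[g2 hg2].
exists (MkL2C g1 g2); apply: filterS2 hg1 hg2 => x e1 e2.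
by rewrite /L2C_fun /= e1 e2; case: (f x).
Qed.

End L2C_theory.

Section operators.
Context (d : measure_display) (T : measurableType d) (R : realType).
Variable mu : {measure set T -> \bar R}.

Definition Cintegral (f : T -> R[i]) : R[i] :=
  (\int[mu]_x complex.Re (f x)) +i* (\int[mu]_x complex.Im (f x)).

Definition L2_dot (f g : L2C mu) : R[i] := Cintegral (fun x => f x * conjc (g x)).

Definition L2_dist (f g : L2C mu) : \bar R :=
  Lnorm mu 2%:E (fun x => (complex.Re `|f x - g x|)%:E).

(* An unbounded operator in L^2(mu; C) is given by its graph. *)
Implicit Types A : set (L2C mu * L2C mu).

Definition densely_defined A :=
  forall (f : L2C mu) (e : R), 0 < e ->
    exists p, A p /\ (L2_dist p.1 f < e%:E)%E.

Definition adjoint A : set (L2C mu * L2C mu) :=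
  [set q | forall p, A p -> L2_dot p.2 q.1 = L2_dot p.1 q.2].

Definition symmetric_op A := A `<=` adjoint A.

Definition op_closure A : set (L2C mu * L2C mu) :=
  [set q | forall e : R, 0 < e ->
    exists p, [/\ A p, (L2_dist p.1 q.1 < e%:E)%E & (L2_dist p.2 q.2 < e%:E)%E]].

Definition selfadjoint A := densely_defined A /\ A = adjoint A.

Definition essentially_selfadjoint A :=
  [/\ densely_defined A, symmetric_op A & selfadjoint (op_closure A)].

End operators.

Definition Cderiv (R : realType) (n : nat) (f : R -> R[i]) (r : R) : R[i] :=
  (fun x => complex.Re (f x))^`(n)%classic r
    +i* (fun x => complex.Im (f x))^`(n)%classic r.

Definition Csmooth (R : realType) (f : R -> R[i]) :=
  forall n (r : R), derivable ((fun x => complex.Re (f x))^`(n)%classic) r 1 /\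
                    derivable ((fun x => complex.Im (f x))^`(n)%classic) r 1.

(* C_0^oo((0, oo)); its elements are extended by 0 to the whole line. *)
Definition test_function (R : realType) (f : R -> R[i]) :=
  [/\ Csmooth f,
      compact (closure [set r | f r != 0]) &
      closure [set r | f r != 0] `<=` `]0, +oo[].

Definition tau2 (R : realType) (c1 c2 : R) (f : R -> R[i]) (r : R) : R[i] :=
  Cderiv 4 f r
  + c1%:C * ((r ^- 2)%:C * Cderiv 2 f r
             + Cderiv 2 (fun s => (s ^- 2)%:C * f s) r)
  + c2%:C * (r ^- 4)%:C * f r.

Definition halfline_measure (R : realType) :
    {measure set (measurableTypeR R) -> \bar R} :=
  mrestr lebesgue_measure (measurable_itv `]0%R, +oo[).

Definition tau2_op (R : realType) (c1 c2 : R) :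
    set (L2C (halfline_measure R) * L2C (halfline_measure R)) :=
  [set p : L2C (halfline_measure R) * L2C (halfline_measure R) | exists f : R -> R[i],
    [/\ test_function f,
        {ae halfline_measure R, forall r, p.1 r = f r} &
        {ae halfline_measure R, forall r, p.2 r = tau2 c1 c2 f r}]].

(* Main.v *)
(* Put x = 5/4 - c1 and m = 9/16 + 3/2 c1 + c2.  The substitution
   u(r) = r^(3/2) y(ln r) turns tau u into r^(-5/2) (y'''' - 2 x y'' + m y)(ln r),
   with indicial polynomial s^4 - 2 x s^2 + m, and the condition on (c1, c2) says
   that every root s has |Re s| >= 2, i.e. that r^(3/2 + s) and r^(3/2 - s) are
   never both square integrable at 0.  As the coefficients are real, real and
   imaginary parts can be treated separately.

   Sufficiency.  Projecting an element of the graph of the adjoint orthogonally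
   onto the closed graph leaves a pair (u, v) of square integrable functions with
   tau u = v and tau v = - u weakly, hence classically.  In the variable t = ln r
   the concomitant F of u and v satisfies F' = e^(4t) (u^2 + v^2) >= 0.  At -oo the
   condition on the roots forces F to tend to 0; at +oo a cutoff argument gives
   F <= 0.  So u = v = 0 and the closure equals the adjoint.

   Necessity.  If some root has |Re s| < 2, two solutions of the indicial equation
   with nonzero concomitant, cut off for large t, lie in the domain of the adjoint
   and violate its symmetry. *)
Require Import Defs.
From HB Require Import structures.
From mathcomp Require Import all_boot all_order all_algebra complex.
From mathcomp Require Import ring lra.
From mathcomp Require Import all_classical all_reals all_analysis.
From mathcomp Require Import measurable_realfun.

Set Implicit Arguments.
Unset Strict Implicit.
Unset Printing Implicit Defensive.
Import Order.TTheory GRing.Theory Num.Theory.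
Import numFieldNormedType.Exports.
Local Open Scope classical_set_scope.
Local Open Scope ring_scope.

(** * Real derivatives *)

(** The pair of equations [tau u = v], [tau v = - u] is the deficiency equation tau f = - i f for f
    = u + i v, written without complex numbers. The obstacle at both ends is that only u^2 + v^2 is
    known to be integrable: nothing is known about derivatives. At +oo the weight e^(4t) is bounded
    below, and a polynomial cutoff r of arbitrary length T bounds r^3 F by a total derivative plus a
    multiple of u^2 + v^2, so that F(t0) T / 4 would stay bounded in T. At -oo the equation is split
    into first-order factors, one root at a time: for a root with positive real part the solution
    decays by itself, and for one with negative real part it has a limiting amplitude, which square
    integrability forces to vanish once the real part is at most -2. Double roots need no separate
    theory. The exponent 3/2 is the one that makes the transformed operator even in d/dt. In terms
    of x and m the condition on (c1, c2) reads m >= (8 - x)^2 for x <= 4 and m >= 8 x - 16 for x >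
    4. *)

Section calculus.
Context {R : realType}.
Implicit Types (f g : R -> R) (t a b : R).

Lemma is_derive1_add f g t a b : is_derive t 1 f a -> is_derive t 1 g b ->
  is_derive t 1 (fun s => f s + g s) (a + b).
Proof. by move=> ? ?; exact: is_deriveD. Qed.

Lemma is_derive1_opp f t a : is_derive t 1 f a ->
  is_derive t 1 (fun s => - f s) (- a).
Proof. by move=> ?; exact: is_deriveN. Qed.

Lemma is_derive1_mul f g t a b : is_derive t 1 f a -> is_derive t 1 g b ->
  is_derive t 1 (fun s => f s * g s) (f t * b + g t * a).
Proof. by move=> ? ?; exact: is_deriveM. Qed.

Lemma is_derive1_exp f t a n : is_derive t 1 f a ->
  is_derive t 1 (fun s => f s ^+ n) (n%:R * f t ^+ n.-1 * a).
Proof.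
move=> h; have -> : (fun s => f s ^+ n) = f ^+ n.
  by apply/funext => s; rewrite exprfctE.
exact: is_deriveX.
Qed.

Lemma is_derive1_cst (c t : R) : is_derive t 1 (fun=> c) 0.
Proof. exact: is_derive_cst. Qed.

Lemma is_derive1_id t : is_derive t 1 (fun s : R => s) 1.
Proof. exact: is_derive_id. Qed.

Lemma is_derive1_compose f g t a b : is_derive t 1 g b -> is_derive (g t) 1 f a ->
  is_derive t 1 (fun s => f (g s)) (a * b).
Proof.
by move=> hg hf; exact: is_derive1_comp.
Qed.

Lemma is_derive1_expR f t a : is_derive t 1 f a ->
  is_derive t 1 (fun s => expR (f s)) (expR (f t) * a).
Proof. by move=> h; apply: is_derive1_compose => //; exact: is_derive_expR. Qed.

Lemma is_derive1_sin f t a : is_derive t 1 f a ->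
  is_derive t 1 (fun s => sin (f s)) (cos (f t) * a).
Proof. by move=> h; apply: is_derive1_compose => //; exact: is_derive_sin. Qed.

Lemma is_derive1_cos f t a : is_derive t 1 f a ->
  is_derive t 1 (fun s => cos (f s)) (- sin (f t) * a).
Proof. by move=> h; apply: is_derive1_compose => //; exact: is_derive_cos. Qed.

Lemma is_derive1_inv f t a : is_derive t 1 f a -> f t != 0 ->
  is_derive t 1 (fun s => (f s)^-1) (- (f t) ^- 2 * a).
Proof. by move=> h h0; exact: is_deriveV. Qed.

Lemma is_derive1_derivable f t a : is_derive t 1 f a -> derivable f t 1.
Proof. by case. Qed.

Lemma is_derive1_continuous f t a : is_derive t 1 f a -> {for t, continuous f}.
Proof. by case=> h _; apply: differentiable_continuous; exact/derivable1_diffP. Qed.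

Lemma is_derive1_derive1 f t a : is_derive t 1 f a -> f^`()%classic t = a.
Proof. by move=> [h1 h2]; rewrite derive1E. Qed.

Lemma derivable_is_derive1 f t : derivable f t 1 -> is_derive t 1 f (f^`()%classic t).
Proof. by move=> h; rewrite derive1E; exact: derivableP. Qed.

Lemma is_derive_nondecreasing f g a b :
  (forall t, a <= t <= b -> is_derive t 1 f (g t)) ->
  (forall t, a <= t <= b -> 0 <= g t) -> a <= b -> f a <= f b.
Proof.
move=> d g0; rewrite le_eqVlt => /predU1P[->//|ab].
have [||c cab e] := @MVT R f g a b ab.
- by move=> t; rewrite in_itv/= => /andP[h1 h2]; apply: d; rewrite !ltW.
- apply: derivable_within_continuous => t; rewrite in_itv/= => h.
  by apply: is_derive1_derivable; exact: d.
rewrite -subr_ge0 e mulr_ge0 ?subr_ge0 ?(ltW ab)// g0//.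
by move: cab; rewrite in_itv/= => /andP[h1 h2]; rewrite !ltW.
Qed.

(** Increments are compared through the mean value theorem, so the asymptotic estimates at both ends
    use no integral. *)
Lemma is_derive_le f g p q a b :
  (forall t, a <= t <= b -> is_derive t 1 f (g t)) ->
  (forall t, a <= t <= b -> is_derive t 1 p (q t)) ->
  (forall t, a <= t <= b -> g t <= q t) -> a <= b -> f b - f a <= p b - p a.
Proof.
move=> df dp gq ab.
suff: p a - f a <= p b - f b by lra.
apply: (@is_derive_nondecreasing (fun t => p t - f t) (fun t => q t - g t)) => // t h.
  by apply: is_derive1_add; [exact: dp|apply: is_derive1_opp; exact: df].
by rewrite subr_ge0 gq.
Qed.

Lemma is_derive_abs_le f g p q a b :
  (forall t, a <= t <= b -> is_derive t 1 f (g t)) ->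
  (forall t, a <= t <= b -> is_derive t 1 p (q t)) ->
  (forall t, a <= t <= b -> `|g t| <= q t) -> a <= b -> `|f b - f a| <= p b - p a.
Proof.
move=> df dp gq ab; rewrite ler_norml; apply/andP; split; last first.
  by apply: (is_derive_le df dp) => // t h; rewrite (le_trans (ler_norm _)) ?gq.
rewrite lerNl -[leLHS]/(- (f b + - f a)) opprB addrC -[f a]opprK.
apply: (@is_derive_le (fun t => - f t) (fun t => - g t) p q) => // t h.
  by apply: is_derive1_opp; exact: df.
by rewrite (le_trans (ler_norm _)) ?normrN ?gq.
Qed.

End calculus.

(** The derivative is built up as an existential variable by the structure of the function; what
    remains is its equality with the announced one. *)
Ltac is_derive_step := first
  [ eassumption
  | match goal with H : forall t, is_derive t _ _ _ |- _ => notypeclasses refine (H _) end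
  | notypeclasses refine (is_derive1_cst _ _)
  | notypeclasses refine (is_derive1_id _)
  | notypeclasses refine (is_derive1_add _ _)
  | notypeclasses refine (is_derive1_opp _)
  | notypeclasses refine (is_derive1_exp _ _)
  | notypeclasses refine (is_derive1_mul _ _)
  | notypeclasses refine (is_derive1_expR _)
  | notypeclasses refine (is_derive1_sin _)
  | notypeclasses refine (is_derive1_cos _) ].
Ltac is_derive_tac :=
  notypeclasses refine (is_derive_eq _ _); [repeat is_derive_step | rewrite /= ].

(** * Solutions in the logarithmic variable *)

Section young.
Context {R : realType}.
Implicit Types a b d : R.

Lemma young_le d a b : 0 < d -> `|a * b| <= d * a ^+ 2 + b ^+ 2 / (4 * d).
Proof.
move=> d0; rewrite normrM -(real_normK (num_real a)) -(real_normK (num_real b)).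
rewrite -subr_ge0.
have -> : d * `|a| ^+ 2 + `|b| ^+ 2 / (4 * d) - `|a| * `|b| =
    (2 * d * `|a| - `|b|) ^+ 2 / (4 * d) by field; rewrite gt_eqF.
by rewrite divr_ge0 ?sqr_ge0 ?mulr_ge0 ?ltW.
Qed.

Lemma ler_pair (a b c d e : R) : `|a| <= c -> `|b| <= d -> c + d <= e -> `|a + b| <= e.
Proof. by move=> h1 h2 h3; rewrite (le_trans (ler_normD _ _))// (le_trans (lerD h1 h2)). Qed.

(* Differential inequality behind the estimate at +oo: [r] is the cutoff
   1 - h (t - t0), and z1, z2, z3 are the derivatives of r^3 (v u'' - u v''),
   r^2 (u u' + v v') + h r (u^2 + v^2) and
   - r^4 (u u''' - u' u'' - 2 x u u' + idem v) - 4 h r^3 (u u'' + v v''). *)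
Lemma cutoff_inequality (x m : R) : exists al be ga : R, [/\ 0 <= al, 0 <= be, 0 <= ga &
  forall r h u0 u1 u2 u3 v0 v1 v2 v3 : R, 0 <= r <= 1 -> 0 <= h <= 1 ->
  let N := u0 ^+ 2 + v0 ^+ 2 in let M := u1 ^+ 2 + v1 ^+ 2 in
  let S := u2 ^+ 2 + v2 ^+ 2 in let P := u0 * u2 + v0 * v2 in
  let z1 := - 3 * h * r ^+ 2 * (v0 * u2 - u0 * v2) +
    r ^+ 3 * (v1 * u2 + v0 * u3 - u1 * v2 - u0 * v3) in
  let z2 := r ^+ 2 * (M + P) - h ^+ 2 * N in
  let z3 := - 8 * h * r ^+ 3 * (u1 * u2 + v1 * v2)
    - 8 * x * h * r ^+ 3 * (u0 * u1 + v0 * v1)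
    + r ^+ 4 * (S + 2 * x * M + m * N) + 12 * h ^+ 2 * r ^+ 2 * P in
  (r ^+ 3 * (v0 * u3 - v1 * u2 + v2 * u1 - v3 * u0 - 2 * x * (v0 * u1 - v1 * u0)) <=
  z1 + al * z2 + be * z3 + ga * N : Prop)].
Proof.
(* With s = r^4 S and mu = r^2 M: [c] bounds the left-hand side against N + s + mu, [k] is the
   coefficient of mu in the bound of s by z3, and [e] that of N once mu has been eliminated. *)
set c : R := 5 + 2 * `|x|; set k : R := 160 + 20 * `|x|.
have x0 : 0 <= `|x| by []. have m0 : 0 <= `|m| by [].
have c0 : 0 < c by rewrite /c; lra. have k0 : 0 < k by rewrite /k; lra.
pose e : R := 480 + 32 * `|x| + 4 * `|m| + 2 * k + k ^+ 2.
have e0 : 0 <= e by rewrite /e; have := sqr_ge0 k; lra.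
exists (c + 2 * c * (2 * k)), (2 * c * 4), (c * 3 + 2 * c * e).
have ck : 0 < c * k by rewrite mulr_gt0.
have ce : 0 <= c * e by rewrite mulr_ge0// ltW.
split; [by lra|by lra|by lra|].
(* Each derivative carries a factor r, and differentiating a power of r costs one such factor and
   yields h <= 1. This keeps all constants independent of the length 1 / h of the cutoff. *)
move=> r h u0 u1 u2 u3 v0 v1 v2 v3 /andP[r0 r1] /andP[h0 h1] N M S P z1 z2 z3.
set s := r ^+ 4 * S; set mu := r ^+ 2 * M.
have N0 : 0 <= N by rewrite addr_ge0// sqr_ge0.
have M0 : 0 <= M by rewrite addr_ge0// sqr_ge0.
have S0 : 0 <= S by rewrite addr_ge0// sqr_ge0.
have s0 : 0 <= s by rewrite mulr_ge0// exprn_ge0.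
have mu0 : 0 <= mu by rewrite mulr_ge0// exprn_ge0.
have rle n : r ^+ n <= 1 by rewrite exprn_ile1.
have rge n : 0 <= r ^+ n by rewrite exprn_ge0.
have rP d : 0 < d -> `|r ^+ 2 * P| <= d * s + N / (4 * d).
  move=> d0; have -> : r ^+ 2 * P = (r ^+ 2 * u2) * u0 + (r ^+ 2 * v2) * v0 by rewrite /P; ring.
  apply: (ler_pair (young_le _ _ d0) (young_le _ _ d0)).
  by rewrite le_eqVlt; apply/orP; left; apply/eqP; rewrite /s /S /N; field; rewrite gt_eqF.
have rB : `|r ^+ 2 * (v0 * u2 - u0 * v2)| <= s + N.
  have -> : r ^+ 2 * (v0 * u2 - u0 * v2) = (r ^+ 2 * u2) * v0 + (r ^+ 2 * v2) * (- u0) by ring.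
  apply: (ler_pair (young_le _ _ ltr01) (young_le _ _ ltr01)).
  have -> : s = r ^+ 4 * u2 ^+ 2 + r ^+ 4 * v2 ^+ 2 by rewrite /s /S; ring.
  have -> : (r ^+ 2 * u2) ^+ 2 = r ^+ 4 * u2 ^+ 2 by ring.
  have -> : (r ^+ 2 * v2) ^+ 2 = r ^+ 4 * v2 ^+ 2 by ring.
  by rewrite /N sqrrN; have := sqr_ge0 u0; have := sqr_ge0 v0; lra.
have rR d : 0 < d -> `|r ^+ 3 * (u1 * u2 + v1 * v2)| <= d * s + mu / (4 * d).
  move=> d0; have -> : r ^+ 3 * (u1 * u2 + v1 * v2) =
    (r ^+ 2 * u2) * (r * u1) + (r ^+ 2 * v2) * (r * v1) by ring.
  apply: (ler_pair (young_le _ _ d0) (young_le _ _ d0)).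
  by rewrite le_eqVlt; apply/orP; left; apply/eqP; rewrite /s /S /mu /M; field; rewrite gt_eqF.
have rC : `|r ^+ 3 * (u1 * v2 - v1 * u2)| <= s + mu.
  have -> : r ^+ 3 * (u1 * v2 - v1 * u2) =
    (r ^+ 2 * v2) * (r * u1) + (r ^+ 2 * u2) * (r * - v1) by ring.
  apply: (ler_pair (young_le _ _ ltr01) (young_le _ _ ltr01)).
  have -> : s = (r ^+ 2 * u2) ^+ 2 + (r ^+ 2 * v2) ^+ 2 by rewrite /s /S; ring.
  have -> : mu = (r * u1) ^+ 2 + (r * - v1) ^+ 2 by rewrite /mu /M; ring.
  by have := sqr_ge0 (r * u1); have := sqr_ge0 (r * - v1); lra.
have rQ1 : `|r * (u0 * u1 + v0 * v1)| <= mu + N.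
  have -> : r * (u0 * u1 + v0 * v1) = (r * u1) * u0 + (r * v1) * v0 by ring.
  apply: (ler_pair (young_le _ _ ltr01) (young_le _ _ ltr01)).
  have -> : mu = (r * u1) ^+ 2 + (r * v1) ^+ 2 by rewrite /mu /M; ring.
  by rewrite /N; have := sqr_ge0 u0; have := sqr_ge0 v0; lra.
have rE1 : `|r * (v0 * u1 - v1 * u0)| <= mu + N.
  have -> : r * (v0 * u1 - v1 * u0) = (r * u1) * v0 + (r * v1) * (- u0) by ring.
  apply: (ler_pair (young_le _ _ ltr01) (young_le _ _ ltr01)).
  have -> : mu = (r * u1) ^+ 2 + (r * v1) ^+ 2 by rewrite /mu /M; ring.
  by rewrite /N sqrrN; have := sqr_ge0 u0; have := sqr_ge0 v0; lra.
have shrink a b y : 0 <= a <= 1 -> `|b| <= y -> `|a * b| <= y.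
  move=> /andP[a0 a1] by_; rewrite normrM (ger0_norm a0).
  by rewrite (le_trans _ by_)// ler_piMl.
have rQ : `|r ^+ 3 * (u0 * u1 + v0 * v1)| <= mu + N.
  have -> : r ^+ 3 * (u0 * u1 + v0 * v1) = r ^+ 2 * (r * (u0 * u1 + v0 * v1)) by ring.
  by apply: shrink; rewrite ?rle ?rge.
have rE : `|r ^+ 3 * (v0 * u1 - v1 * u0)| <= mu + N.
  have -> : r ^+ 3 * (v0 * u1 - v1 * u0) = r ^+ 2 * (r * (v0 * u1 - v1 * u0)) by ring.
  by apply: shrink; rewrite ?rle ?rge.
have h01 : 0 <= h <= 1 by rewrite h0 h1.
have h201 : 0 <= h ^+ 2 <= 1 by rewrite exprn_ge0//= exprn_ile1.
have xM y b : `|b| <= y -> x * b <= `|x| * y.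
  by move=> hb; rewrite (le_trans (ler_norm _))// normrM ler_wpM2l.
have up b y : `|b| <= y -> b <= y by move=> hb; rewrite (le_trans (ler_norm _)).
have dn b y : `|b| <= y -> - b <= y by move=> hb; rewrite (le_trans (ler_norm _))// normrN.
(* The terms with factors 12 and 8 in z3 each cost that multiple of s / 40, together exactly s /
   2. *)
have d40 : (0 < 40^-1 :> R) by rewrite invr_gt0.
have hk : 0 < (2 * k)^-1 by rewrite invr_gt0 mulr_gt0.
have E3 : s <= 2 * z3 + (240 + 16 * `|x| + 2 * `|m|) * N + k * mu.
  have e1 := dn _ _ (shrink _ _ _ h201 (rP _ d40)).
  have e2 := up _ _ (shrink _ _ _ h01 (rR _ d40)).
  have e3 := xM _ _ (shrink _ _ _ h01 rQ).
  have e4 : - x * (r ^+ 4 * M) <= `|x| * mu.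
    rewrite (le_trans (ler_norm _))// normrM normrN ler_wpM2l// ger0_norm ?mulr_ge0//.
    by rewrite /mu ler_wpM2r// -[4%N]/(2 + 2)%N exprD ler_piMr.
  have e5 : - m * (r ^+ 4 * N) <= `|m| * N.
    rewrite (le_trans (ler_norm _))// normrM normrN ler_wpM2l// ger0_norm ?mulr_ge0//.
    by rewrite ler_piMl.
  have ez : z3 = - 8 * (h * (r ^+ 3 * (u1 * u2 + v1 * v2))) -
    8 * (x * (h * (r ^+ 3 * (u0 * u1 + v0 * v1)))) + s - 2 * (- x * (r ^+ 4 * M)) -
    (- m * (r ^+ 4 * N)) + 12 * (h ^+ 2 * (r ^+ 2 * P)) by rewrite /z3 /s; ring.
  have f1 : N / (4 * 40^-1) = 10 * N by field.
  have f2 : mu / (4 * 40^-1) = 10 * mu by field.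
  rewrite f1 in e1; rewrite f2 in e2; rewrite (mulrDr `|x|) in e3.
  have -> : (240 + 16 * `|x| + 2 * `|m|) * N =
    240 * N + 16 * (`|x| * N) + 2 * (`|m| * N) by ring.
  have -> : k * mu = 160 * mu + 20 * (`|x| * mu) by rewrite /k; ring.
  move: e1 e2 e3 e4 e5; rewrite ez.
  move: (h ^+ 2 * _) (h * (r ^+ 3 * (u1 * _ + _))) (x * (h * _)) (- x * _) (- m * _).
  move: (`|x| * N) (`|m| * N) (`|x| * mu) => t1 t2 t3 t4 t5 t6 t7 t8.
  move: (s) (N) (mu) (z3); clear; intros; lra.
have E2 : mu <= z2 + 2 * N + s.
  have e1 := dn _ _ (rP _ ltr01).
  have e2 : h ^+ 2 * N <= N by rewrite ler_piMl//; case/andP: h201.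
  have -> : z2 = mu + r ^+ 2 * P - h ^+ 2 * N by rewrite /z2 /mu; ring.
  lra.
(* Young's inequality with parameter 1 / (2 k) leaves s / 2 on the right, which closes the circle
   between the bound of s by mu and that of mu by s. *)
have E2k : k * mu <= k * z2 + k * N + s / 2 + k ^+ 2 / 2 * N.
  have e1 := dn _ _ (rP _ hk).
  have e2 : h ^+ 2 * N <= N by rewrite ler_piMl//; case/andP: h201.
  have -> : z2 = mu + r ^+ 2 * P - h ^+ 2 * N by rewrite /z2 /mu; ring.
  have e3 : - (k * (r ^+ 2 * P)) <= s / 2 + k ^+ 2 / 2 * N.
    rewrite -mulrN (le_trans (ler_wpM2l (ltW k0) e1))//.
    rewrite le_eqVlt; apply/orP; left; apply/eqP; field.
    by rewrite gt_eqF.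
  have e4 : k * (h ^+ 2 * N) <= k * N by rewrite ler_wpM2l// ltW.
  lra.
have E4 : s <= 4 * z3 + 2 * k * z2 + e * N.
  have -> : e * N = (480 + 32 * `|x| + 4 * `|m|) * N + 2 * (k * N) + k ^+ 2 * N by rewrite /e; ring.
  have -> : (480 + 32 * `|x| + 4 * `|m|) * N = 2 * ((240 + 16 * `|x| + 2 * `|m|) * N) by ring.
  have -> : 2 * k * z2 = 2 * (k * z2) by ring.
  rewrite [k ^+ 2 / 2 * N]mulrAC in E2k.
  move: E3 E2k; move: (_ * N) (k * mu) (k * z2) (k * N) (k ^+ 2 * N).
  move: (s) (z3); clear; intros; lra.
have E1 : r ^+ 3 * (v0 * u3 - v1 * u2 + v2 * u1 - v3 * u0 - 2 * x * (v0 * u1 - v1 * u0)) <=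
    z1 + c * (N + s + mu).
  have e1 := up _ _ (shrink _ _ _ h01 rB).
  have e2 := up _ _ rC.
  have e3 : - x * (r ^+ 3 * (v0 * u1 - v1 * u0)) <= `|x| * (mu + N).
    by rewrite (le_trans (ler_norm _))// normrM normrN ler_wpM2l.
  have -> : r ^+ 3 * (v0 * u3 - v1 * u2 + v2 * u1 - v3 * u0 - 2 * x * (v0 * u1 - v1 * u0)) =
    z1 + 3 * (h * (r ^+ 2 * (v0 * u2 - u0 * v2))) + 2 * (r ^+ 3 * (u1 * v2 - v1 * u2))
    + 2 * (- x * (r ^+ 3 * (v0 * u1 - v1 * u0))) by rewrite /z1; ring.
  have e4 : 0 <= `|x| * s by rewrite mulr_ge0.
  have -> : c * (N + s + mu) = 5 * (N + s + mu) + 2 * (`|x| * (mu + N)) + 2 * (`|x| * s).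
    by rewrite /c; ring.
  move: e1 e2 e3 e4 s0 mu0 N0; rewrite (mulrDr `|x|).
  move: (h * _) (r ^+ 3 * (u1 * _ - _)) (- x * _) (`|x| * _) (`|x| * _) (`|x| * _).
  move: (z1) (s) (N) (mu); clear; intros; lra.
rewrite (le_trans E1)//.
have E5 : c * (N + s + mu) <= c * (3 * N + z2 + 2 * (4 * z3 + 2 * k * z2 + e * N)).
  by rewrite ler_wpM2l ?(ltW c0)//; lra.
rewrite (le_trans (lerD (lexx _) E5))// le_eqVlt; apply/orP; left; apply/eqP; ring.
Qed.

End young.

Lemma absurd_chain (R : realType) (k g1 g2 f z c : R) :
  - (c - 2 * k) <= z - g2 -> g1 <= k -> - g2 <= k -> 0 < f -> f + c <= g1 - z -> False.
Proof. lra. Qed.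

(** * Behaviour at +oo *)

Section at_infinity.
Context {R : realType}.
Variables (x m : R) (W u0 u1 u2 u3 v0 v1 v2 v3 G : R -> R) (K : R).
Hypothesis du0 : forall t : R, is_derive t 1 u0 (u1 t).
Hypothesis du1 : forall t : R, is_derive t 1 u1 (u2 t).
Hypothesis du2 : forall t : R, is_derive t 1 u2 (u3 t).
Hypothesis du3 : forall t : R, is_derive t 1 u3 (2 * x * u2 t - m * u0 t + W t * v0 t).
Hypothesis dv0 : forall t : R, is_derive t 1 v0 (v1 t).
Hypothesis dv1 : forall t : R, is_derive t 1 v1 (v2 t).
Hypothesis dv2 : forall t : R, is_derive t 1 v2 (v3 t).
Hypothesis dv3 : forall t : R, is_derive t 1 v3 (2 * x * v2 t - m * v0 t - W t * u0 t).
Hypothesis dG : forall t : R, is_derive t 1 G (W t * (u0 t ^+ 2 + v0 t ^+ 2)).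
Hypothesis GK : forall t, `|G t| <= K.

Let F t := v0 t * u3 t - v1 t * u2 t + v2 t * u1 t - v3 t * u0 t
  - 2 * x * (v0 t * u1 t - v1 t * u0 t).

Lemma concomitant_derive (t : R) : is_derive t 1 F (W t * (u0 t ^+ 2 + v0 t ^+ 2)).
Proof. by rewrite /F; is_derive_tac; ring. Qed.

(** If F(t0) > 0, then F >= F(t0) afterwards, and the integral of F(t0) r^3 over [t0, t0 + T] with r
    = 1 - (t - t0) / T is F(t0) T / 4. By [cutoff_inequality] it is bounded independently of T: the
    cutoff removes the boundary terms with derivatives at the right end, and [G] is bounded. *)
Lemma concomitant_le0 (t0 W0 : R) : 0 < W0 -> (forall t, t0 <= t -> W0 <= W t) ->
  F t0 <= 0.
Proof.
move=> W00 W0W; rewrite leNgt; apply/negP => F0.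
have [al [be [ga [al0 be0 ga0 cut]]]] := cutoff_inequality x m.
pose B0 := `|v0 t0 * u2 t0 - u0 t0 * v2 t0|.
pose Q0 := `|u0 t0 * u1 t0 + v0 t0 * v1 t0|.
pose N0 := u0 t0 ^+ 2 + v0 t0 ^+ 2.
pose Ph0 := `|u0 t0 * u3 t0 + v0 t0 * v3 t0 - (u1 t0 * u2 t0 + v1 t0 * v2 t0)
   - 2 * x * (u0 t0 * u1 t0 + v0 t0 * v1 t0)|.
pose P0 := `|u0 t0 * u2 t0 + v0 t0 * v2 t0|.
pose C := B0 + al * (Q0 + N0) + be * (Ph0 + 4 * P0) + ga / W0 * (2 * K).
have N00 : 0 <= N0 by rewrite addr_ge0 ?sqr_ge0.
have K0 : 0 <= K by rewrite (le_trans _ (GK t0)).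
have gW : 0 <= ga / W0 by rewrite divr_ge0// ltW.
have C0 : 0 <= C by rewrite /C; do ?[exact: normr_ge0|assumption|apply: addr_ge0|apply: mulr_ge0].
(* Chosen so that F(t0) T / 4 = F(t0) / 4 + C; the summand 1 ensures h <= 1. *)
pose T := 1 + 4 * C / F t0.
have T1 : 1 <= T by rewrite lerDl divr_ge0 ?mulr_ge0// ltW.
have T0 : 0 < T by rewrite (lt_le_trans _ T1).
pose h := T^-1.
have h0 : 0 < h by rewrite invr_gt0.
have h1 : h <= 1 by rewrite invf_le1.
pose r t := 1 - h * (t - t0).
(* [Z] is a primitive of the right-hand side of [cutoff_inequality], except that N, which has no
   known primitive, is first enlarged to W N / W0 by means of W0 <= W. *)
pose Z t := r t ^+ 3 * (v0 t * u2 t - u0 t * v2 t)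
  + al * (r t ^+ 2 * (u0 t * u1 t + v0 t * v1 t) + h * r t * (u0 t ^+ 2 + v0 t ^+ 2))
  + be * (- r t ^+ 4 * (u0 t * u3 t + v0 t * v3 t - (u1 t * u2 t + v1 t * v2 t)
         - 2 * x * (u0 t * u1 t + v0 t * v1 t))
          - 4 * h * r t ^+ 3 * (u0 t * u2 t + v0 t * v2 t))
  + ga / W0 * G t.
pose z t :=
  - 3 * h * r t ^+ 2 * (v0 t * u2 t - u0 t * v2 t) +
    r t ^+ 3 * (v1 t * u2 t + v0 t * u3 t - u1 t * v2 t - u0 t * v3 t)
  + al * (r t ^+ 2 * (u1 t ^+ 2 + v1 t ^+ 2 + (u0 t * u2 t + v0 t * v2 t))
          - h ^+ 2 * (u0 t ^+ 2 + v0 t ^+ 2))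
  + be * (- 8 * h * r t ^+ 3 * (u1 t * u2 t + v1 t * v2 t)
    - 8 * x * h * r t ^+ 3 * (u0 t * u1 t + v0 t * v1 t)
    + r t ^+ 4 * (u2 t ^+ 2 + v2 t ^+ 2 + 2 * x * (u1 t ^+ 2 + v1 t ^+ 2)
        + m * (u0 t ^+ 2 + v0 t ^+ 2))
    + 12 * h ^+ 2 * r t ^+ 2 * (u0 t * u2 t + v0 t * v2 t))
  + ga / W0 * (W t * (u0 t ^+ 2 + v0 t ^+ 2)).
have dZ (t : R) : is_derive t 1 Z (z t).
  have dr (s : R) : is_derive s 1 r (- h) by rewrite /r; is_derive_tac; ring.
  by rewrite /Z; is_derive_tac; rewrite /z; ring.
have dE (t : R) : is_derive t 1 (fun t => - (F t0 * T / 4) * r t ^+ 4) (F t0 * r t ^+ 3).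
  rewrite /r; is_derive_tac; rewrite /h; field.
  by rewrite gt_eqF.
have t0T : t0 <= t0 + T by rewrite lerDl ltW.
have hT : h * T = 1 by rewrite /h mulVf// gt_eqF.
have rT : r (t0 + T) = 0 by rewrite /r addrAC subrr add0r hT subrr.
have r0 : r t0 = 1 by rewrite /r subrr mulr0 subr0.
have Fnd t : t0 <= t -> F t0 <= F t.
  move=> tt; apply: (is_derive_nondecreasing (fun s _ => concomitant_derive s)) => // s /andP[ts _].
  by rewrite mulr_ge0 ?addr_ge0 ?sqr_ge0// (le_trans (ltW W00))// W0W.
have main t : t0 <= t <= t0 + T -> F t0 * r t ^+ 3 <= z t.
  move=> /andP[tt tT].
  have r01 : 0 <= r t <= 1.
    apply/andP; split; last by rewrite /r gerBl mulr_ge0 ?subr_ge0// ltW.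
    by rewrite /r subr_ge0 -hT ler_pM2l// lerBlDl.
  have h01 : 0 <= h <= 1 by rewrite (ltW h0).
  have := cut (r t) h (u0 t) (u1 t) (u2 t) (u3 t) (v0 t) (v1 t) (v2 t) (v3 t) r01 h01.
  rewrite -/(F t) => c1.
  have : F t0 * r t ^+ 3 <= r t ^+ 3 * F t.
    by rewrite mulrC ler_wpM2l ?Fnd// exprn_ge0//; case/andP: r01.
  move=> /le_trans; apply; apply: (le_trans c1); rewrite lerD2l.
  rewrite mulrAC ler_pdivlMr//.
  rewrite -mulrA ler_wpM2l// mulrC ler_wpM2r ?W0W//.
  by rewrite addr_ge0 ?sqr_ge0.
have := is_derive_le (fun t _ => dE t) (fun t _ => dZ t) main t0T.
rewrite rT r0 expr0n/= expr1n mulr0 mulr1 opprK add0r.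
have -> : Z (t0 + T) = ga / W0 * G (t0 + T) by rewrite /Z rT; ring.
have ZC : `|Z t0 - ga / W0 * G t0| <= C - ga / W0 * (2 * K).
  have -> : Z t0 - ga / W0 * G t0 = (v0 t0 * u2 t0 - u0 t0 * v2 t0) +
    al * (u0 t0 * u1 t0 + v0 t0 * v1 t0 + h * N0)
    + be * (- (u0 t0 * u3 t0 + v0 t0 * v3 t0 - (u1 t0 * u2 t0 + v1 t0 * v2 t0)
         - 2 * x * (u0 t0 * u1 t0 + v0 t0 * v1 t0)) +
         (- 4 * h) * (u0 t0 * u2 t0 + v0 t0 * v2 t0)).
    by rewrite /Z r0 /N0; ring.
  rewrite /C addrK.
  apply: ler_pair (lexx _); last first.
    rewrite normrM ger0_norm// ler_wpM2l// (ler_pair (lexx _) (lexx _))//.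
    rewrite normrN lerD2l normrM ler_wpM2r// normrM normrN !ger0_norm ?(ltW h0)//.
    by rewrite -[leRHS]mulr1 ler_wpM2l.
  apply: ler_pair (lexx _) => //.
  rewrite normrM ger0_norm// ler_wpM2l// (ler_pair (lexx _) (lexx _))//.
  rewrite lerD2l ger0_norm ?mulr_ge0 ?(ltW h0)//.
  by rewrite -[leRHS]mul1r ler_wpM2r.
have TC : F t0 * T / 4 = F t0 / 4 + C.
  by rewrite /T; field; rewrite gt_eqF.
have F40 : 0 < F t0 / 4 by rewrite divr_gt0.
have GT : ga / W0 * G (t0 + T) <= ga / W0 * K.
  by rewrite ler_wpM2l// (le_trans (ler_norm _)).
have Gt : - (ga / W0 * G t0) <= ga / W0 * K.
  by rewrite -mulrN ler_wpM2l// (le_trans (ler_norm _))// normrN.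
move: ZC; rewrite ler_norml => /andP[ZC _].
rewrite TC; move: ZC GT Gt F40.
have -> : ga / W0 * (2 * K) = 2 * (ga / W0 * K) by ring.
move: (ga / W0 * K) (ga / W0 * G _) (ga / W0 * G _) (F t0 / 4) (Z t0) (C).
exact: absurd_chain.
Qed.
End at_infinity.

(** * First-order equations at -oo *)

Section at_minus_infinity.
Context {R : realType}.
Implicit Types (s e k C K M c : R).

Lemma cos_abs_le1 t : `|@cos R t| <= 1.
Proof. by rewrite ler_norml cos_geN1 cos_le1. Qed.

Lemma sin_abs_le1 t : `|@sin R t| <= 1.
Proof. by rewrite ler_norml sin_geN1 sin_le1. Qed.

Lemma rotation_le (c s a b : R) : `|c| <= 1 -> `|s| <= 1 ->
  `|c * a + s * b| <= `|a| + `|b|.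
Proof.
move=> c1 s1; apply: (@ler_pair _ _ _ `|a| `|b|) => //;
by rewrite normrM -[leRHS]mul1r ler_wpM2r.
Qed.

(** In complex form a = a1 + i a2 solves a' = (s + i e) a + f, and b1 + i b2 is exp(- (s + i e) t)
    a. For t <= 0 the homogeneous solution exp(s t) is below exp(k t), and so is the contribution of
    f because [ph] has a bounded primitive. *)
Lemma first_order_growth s e k K (a1 a2 f1 f2 Ph ph : R -> R) :
  (forall t : R, is_derive t 1 a1 (s * a1 t - e * a2 t + f1 t)) ->
  (forall t : R, is_derive t 1 a2 (e * a1 t + s * a2 t + f2 t)) ->
  (forall t : R, is_derive t 1 Ph (ph t)) ->
  (forall t, t <= 0 -> `|Ph t| <= K) ->
  (forall t, t <= 0 -> `|f1 t| + `|f2 t| <= expR (k * t) * ph t) -> k <= s ->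
  exists C, forall t, t <= 0 -> `|a1 t| <= C * expR (k * t) /\ `|a2 t| <= C * expR (k * t).
Proof.
move=> da1 da2 dPh PhK fph ks.
pose b1 t := expR (- s * t) * (cos (e * t) * a1 t + sin (e * t) * a2 t).
pose b2 t := expR (- s * t) * (cos (e * t) * a2 t + sin (e * t) * - a1 t).
have db1 (t : R) : is_derive t 1 b1 (expR (- s * t) * (cos (e * t) * f1 t + sin (e * t) * f2 t)).
  by rewrite /b1; is_derive_tac; ring.
have db2 (t : R) : is_derive t 1 b2 (expR (- s * t) * (cos (e * t) * f2 t + sin (e * t) * - f1 t)).
  by rewrite /b2; is_derive_tac; ring.
have K0 : 0 <= K by rewrite (le_trans _ (PhK 0 (lexx _))).
have key b (g1 g2 : R -> R) :
    (forall t : R, is_derive t 1 b (expR (- s * t) * (cos (e * t) * g1 t + sin (e * t) * g2 t))) ->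
    (forall t, `|g1 t| + `|g2 t| = `|f1 t| + `|f2 t|) ->
    forall t, t <= 0 -> `|b t| <= (`|b 0| + 2 * K) * expR ((k - s) * t).
  move=> db gf t t0.
  have H : `|b 0 - b t| <= expR ((k - s) * t) * Ph 0 - expR ((k - s) * t) * Ph t.
    have dp (r : R) : is_derive r 1 (fun r => expR ((k - s) * t) * Ph r) (expR ((k - s) * t) * ph r).
      by is_derive_tac; ring.
    apply: (is_derive_abs_le (fun r _ => db r) (fun r _ => dp r)) => // r /andP[tr r0].
    rewrite normrM ger0_norm ?expR_ge0//.
    have := rotation_le (g1 r) (g2 r) (cos_abs_le1 (e * r)) (sin_abs_le1 (e * r)).
    rewrite gf => h1; have h2 := le_trans h1 (fph r r0).
    have h3 := le_trans (ler_wpM2l (expR_ge0 _) h2) _; apply: (h3 (- s * r)).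
    have ph0 : 0 <= ph r.
      have := fph r r0; rewrite -(pmulr_rge0 (ph r) (expR_gt0 (k * r))).
      by apply: le_trans; rewrite addr_ge0.
    rewrite mulrA -expRD ler_wpM2r// ler_expR.
    have -> : - s * r + k * r = (k - s) * r by ring.
    by rewrite ler_wnM2l// subr_le0.
  have e1 : 1 <= expR ((k - s) * t).
    by rewrite -[leLHS](@expR0 R) ler_expR mulr_le0// subr_le0.
  have -> : b t = b 0 - (b 0 - b t) by ring.
  rewrite (le_trans (ler_normB _ _))// mulrDl lerD//.
    by rewrite -[leLHS]mulr1 ler_wpM2l.
  rewrite (le_trans H)// -mulrBr mulrC ler_wpM2r ?expR_ge0//.
  have := PhK 0 (lexx _); have := PhK t t0.
  rewrite !ler_norml => /andP[? ?] /andP[? ?]; lra.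
have k1 := key _ _ _ db1 (fun=> erefl).
have k2 := key _ _ _ db2.
pose C1 := `|b1 0| + 2 * K; pose C2 := `|b2 0| + 2 * K.
exists (C1 + C2) => t t0.
have {}k1 := k1 t t0; rewrite -/C1 in k1.
have {}k2 : `|b2 t| <= C2 * expR ((k - s) * t).
  by apply: k2 => // r; rewrite normrN addrC.
have ee : expR (s * t) * expR (- s * t) = 1 by rewrite -expRD mulNr subrr expR0.
have cs := cos2Dsin2 (e * t).
have ek : expR (s * t) * expR ((k - s) * t) = expR (k * t).
  by rewrite -expRD; congr expR; ring.
have fin y : `|y| <= `|b1 t| + `|b2 t| -> `|expR (s * t) * y| <= (C1 + C2) * expR (k * t).
  move=> hy; rewrite normrM ger0_norm ?expR_ge0// -ek mulrCA ler_wpM2l ?expR_ge0//.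
  by rewrite (le_trans hy)// mulrDl lerD.
have E1 : a1 t = expR (s * t) * (cos (e * t) * b1 t + sin (e * t) * - b2 t).
  have -> : expR (s * t) * (cos (e * t) * b1 t + sin (e * t) * - b2 t) =
    (expR (s * t) * expR (- s * t)) * ((cos (e * t) ^+ 2 + sin (e * t) ^+ 2) * a1 t).
    by rewrite /b1 /b2; ring.
  by rewrite ee cs !mul1r.
have E2 : a2 t = expR (s * t) * (cos (e * t) * b2 t + sin (e * t) * b1 t).
  have -> : expR (s * t) * (cos (e * t) * b2 t + sin (e * t) * b1 t) =
    (expR (s * t) * expR (- s * t)) * ((cos (e * t) ^+ 2 + sin (e * t) ^+ 2) * a2 t).
    by rewrite /b1 /b2; ring.
  by rewrite ee cs !mul1r.
split; [rewrite E1|rewrite E2]; apply: fin.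
  by rewrite (le_trans (rotation_le _ _ (cos_abs_le1 _) (sin_abs_le1 _)))// normrN.
by rewrite (le_trans (rotation_le _ _ (cos_abs_le1 _) (sin_abs_le1 _)))// addrC.
Qed.

Lemma limit_minus_infinity c M (b g : R -> R) : 0 < c ->
  (forall t : R, is_derive t 1 b (g t)) ->
  (forall t, t <= 0 -> `|g t| <= M * c * expR (c * t)) ->
  exists L, forall t, t <= 0 -> `|b t - L| <= M * expR (c * t).
Proof.
move=> c0 db gM.
have M0 : 0 <= M.
  have := gM 0 (lexx _); rewrite mulr0 expR0 mulr1 => /(le_trans (normr_ge0 _)).
  by rewrite pmulr_lge0.
have mono t r : t <= r -> r <= 0 -> `|b r - b t| <= M * expR (c * r) - M * expR (c * t).
  move=> tr r0.
  have dp (y : R) : is_derive y 1 (fun t => M * expR (c * t)) (M * c * expR (c * y)).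
    by is_derive_tac; ring.
  apply: (is_derive_abs_le (fun t _ => db t) (fun t _ => dp t)) => // y.
  by move=> /andP[_ yr]; apply: gM; rewrite (le_trans yr).
(* By [mono] the intervals with centre [b t] and radius [M * expR (c * t)] shrink to each other as t
   decreases; the infimum of their upper ends lies in all of them. *)
pose E := [set b t + M * expR (c * t) | t in [set t | t <= 0]].
have lb t : t <= 0 -> lbound E (b t - M * expR (c * t)).
  move=> t0 _ [r /= r0 <-].
  have p y : 0 <= M * expR (c * y) by rewrite mulr_ge0 ?expR_ge0.
  have := p t; have := p r.
  case: (leP t r) => [tr|/ltW rt].
    by have := mono _ _ tr r0; rewrite ler_norml => /andP[? ?]; lra.
  by have := mono _ _ rt t0; rewrite ler_norml => /andP[? ?]; lra.
have En : E !=set0 by exists (b 0 + M * expR (c * 0)); exists 0 => /=.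
exists (inf E) => t t0.
have l1 : b t - M * expR (c * t) <= inf E by apply: lb_le_inf => //; exact: lb.
have l2 : inf E <= b t + M * expR (c * t).
  apply: ge_inf; first by exists (b t - M * expR (c * t)); exact: lb.
  by exists t.
rewrite ler_norml; apply/andP; split; lra.
Qed.

(** Here a = a1 + i a2 solves a' = - (s + i e) a + f. The function exp((s + i e) t) a has a
    derivative of order exp((s + k) t), hence a limit L1 + i L2 at -oo, the amplitude of the growing
    homogeneous solution. *)
Lemma first_order_limit s e k C (a1 a2 f1 f2 : R -> R) :
  (forall t : R, is_derive t 1 a1 (- s * a1 t + e * a2 t + f1 t)) ->
  (forall t : R, is_derive t 1 a2 (- e * a1 t - s * a2 t + f2 t)) ->
  (forall t, t <= 0 -> `|f1 t| <= C * expR (k * t)) ->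
  (forall t, t <= 0 -> `|f2 t| <= C * expR (k * t)) -> 0 < s + k ->
  exists L1 L2 M, forall t, t <= 0 ->
    `|a1 t - expR (- s * t) * (cos (e * t) * L1 + sin (e * t) * L2)| <= M * expR (k * t) /\
    `|a2 t - expR (- s * t) * (cos (e * t) * L2 - sin (e * t) * L1)| <= M * expR (k * t).
Proof.
move=> da1 da2 f1C f2C sk.
pose b1 t := expR (s * t) * (cos (e * t) * a1 t + sin (e * t) * - a2 t).
pose b2 t := expR (s * t) * (cos (e * t) * a2 t + sin (e * t) * a1 t).
have db1 (t : R) : is_derive t 1 b1 (expR (s * t) * (cos (e * t) * f1 t + sin (e * t) * - f2 t)).
  by rewrite /b1; is_derive_tac; ring.
have db2 (t : R) : is_derive t 1 b2 (expR (s * t) * (cos (e * t) * f2 t + sin (e * t) * f1 t)).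
  by rewrite /b2; is_derive_tac; ring.
pose M := 2 * C / (s + k).
have bnd g1 g2 t : t <= 0 -> `|g1| + `|g2| <= 2 * C * expR (k * t) ->
    `|expR (s * t) * (cos (e * t) * g1 + sin (e * t) * g2)| <= M * (s + k) * expR ((s + k) * t).
  move=> t0 h; rewrite normrM ger0_norm ?expR_ge0// mulrDl expRD.
  rewrite /M mulfVK ?gt_eqF// mulrCA ler_wpM2l ?expR_ge0//.
  by rewrite (le_trans (rotation_le _ _ (cos_abs_le1 _) (sin_abs_le1 _))).
have [|L1 hL1] := @limit_minus_infinity (s + k) M _ _ sk db1.
  by move=> t t0; apply: bnd => //; rewrite normrN; have := f1C t t0; have := f2C t t0; lra.
have [|L2 hL2] := @limit_minus_infinity (s + k) M _ _ sk db2.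
  by move=> t t0; apply: bnd => //; have := f1C t t0; have := f2C t t0; lra.
exists L1, L2, (M + M) => t t0.
have {}hL1 := hL1 t t0; have {}hL2 := hL2 t t0.
have ee : expR (- s * t) * expR (s * t) = 1 by rewrite -expRD mulNr addNr expR0.
have cs := cos2Dsin2 (e * t).
have ek : expR (- s * t) * expR ((s + k) * t) = expR (k * t).
  by rewrite -expRD; congr expR; ring.
have fin y : `|y| <= `|b1 t - L1| + `|b2 t - L2| -> `|expR (- s * t) * y| <= (M + M) * expR (k * t).
  move=> hy; rewrite normrM ger0_norm ?expR_ge0// -ek mulrCA ler_wpM2l ?expR_ge0//.
  by rewrite (le_trans hy)// mulrDl lerD.
have E1 : a1 t = expR (- s * t) * (cos (e * t) * b1 t + sin (e * t) * b2 t).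
  have -> : expR (- s * t) * (cos (e * t) * b1 t + sin (e * t) * b2 t) =
    (expR (- s * t) * expR (s * t)) * ((cos (e * t) ^+ 2 + sin (e * t) ^+ 2) * a1 t).
    by rewrite /b1 /b2; ring.
  by rewrite ee cs !mul1r.
have E2 : a2 t = expR (- s * t) * (cos (e * t) * b2 t - sin (e * t) * b1 t).
  have -> : expR (- s * t) * (cos (e * t) * b2 t - sin (e * t) * b1 t) =
    (expR (- s * t) * expR (s * t)) * ((cos (e * t) ^+ 2 + sin (e * t) ^+ 2) * a2 t).
    by rewrite /b1 /b2; ring.
  by rewrite ee cs !mul1r.
split.
  rewrite E1 -mulrBr; apply: fin.
  have -> : cos (e * t) * b1 t + sin (e * t) * b2 t -
    (cos (e * t) * L1 + sin (e * t) * L2) =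
    cos (e * t) * (b1 t - L1) + sin (e * t) * (b2 t - L2) by ring.
  by rewrite (le_trans (rotation_le _ _ (cos_abs_le1 _) (sin_abs_le1 _))).
rewrite E2 -mulrBr; apply: fin.
have -> : cos (e * t) * b2 t - sin (e * t) * b1 t -
    (cos (e * t) * L2 - sin (e * t) * L1) =
    cos (e * t) * (b2 t - L2) + sin (e * t) * (- (b1 t - L1)) by ring.
by rewrite (le_trans (rotation_le _ _ (cos_abs_le1 _) (sin_abs_le1 _)))// normrN addrC.
Qed.

Lemma unbounded_primitive K e t1 (G g : R -> R) : 0 < e ->
  (forall t : R, is_derive t 1 G (g t)) -> (forall t, `|G t| <= K) ->
  (forall t, t <= t1 -> e <= g t) -> False.
Proof.
move=> e0 dG GK ge.
have K0 : 0 <= K by rewrite (le_trans _ (GK 0)).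
pose t := t1 - (2 * K + 1) / e.
have tt1 : t <= t1 by rewrite gerBl divr_ge0 ?ltW//; lra.
have de (r : R) : is_derive r 1 (fun r => e * r) e by is_derive_tac; ring.
have := is_derive_le (a := t) (b := t1) (fun r _ => de r) (fun r _ => dG r).
move=> /(_ (fun r h => ge r (andP h).2) tt1).
have -> : e * t1 - e * t = 2 * K + 1 by rewrite /t; field; rewrite gt_eqF.
have := GK t1; have := GK t; rewrite !ler_norml => /andP[? ?] /andP[? ?]; lra.
Qed.

End at_minus_infinity.

(** * Decay of square integrable solutions at -oo *)

Section decay.
Context {R : realType}.

Lemma expR_near_minus_infinity (c e : R) : 0 < c -> 0 < e ->
  exists2 t1, t1 <= 0 & forall t : R, t <= t1 -> expR (c * t) <= e.
Proof.
move=> c0 e0; exists (Order.min 0 (ln e / c)); first by rewrite ge_min lexx.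
move=> t; rewrite le_min => /andP[_]; rewrite ler_pdivlMr// mulrC => h.
by rewrite -[leRHS](@lnK R) ?posrE// ler_expR.
Qed.

Variables (x m K : R) (u0 u1 u2 u3 f Ph ph G g : R -> R).
Hypothesis du0 : forall t : R, is_derive t 1 u0 (u1 t).
Hypothesis du1 : forall t : R, is_derive t 1 u1 (u2 t).
Hypothesis du2 : forall t : R, is_derive t 1 u2 (u3 t).
Hypothesis du3 : forall t : R, is_derive t 1 u3 (2 * x * u2 t - m * u0 t + f t).
Hypothesis dPh : forall t : R, is_derive t 1 Ph (ph t).
Hypothesis PhK : forall t, t <= 0 -> `|Ph t| <= K.
Hypothesis fph : forall t, t <= 0 -> `|f t| <= expR (1 * t) * ph t.
Hypothesis dG : forall t : R, is_derive t 1 G (g t).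
Hypothesis GK : forall t, `|G t| <= K.
Hypothesis gu : forall t, expR (4 * t) * u0 t ^+ 2 <= g t.

(** The forcing term allows the rate 1, but half of it is spent when a bound passes through the next
    first-order factor: in exp(t) = exp(t / 2) exp(t / 2) one factor serves as the [ph] with bounded
    primitive. *)
Let small (y : R -> R) := exists C, forall t, t <= 0 -> `|y t| <= C * expR (2^-1 * t).

Let smallD y z : small y -> small z -> small (fun t => y t + z t).
Proof.
move=> [C hC] [D hD]; exists (C + D) => t t0; rewrite mulrDl.
by apply: (ler_pair (hC t t0) (hD t t0)).
Qed.

Let smallZ c y : small y -> small (fun t => c * y t).
Proof.
by move=> [C hC]; exists (`|c| * C) => t t0; rewrite normrM -mulrA ler_wpM2l ?hC.
Qed.

Let smallW y C : (forall t, t <= 0 -> `|y t| <= C * expR (1 * t)) -> small y.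
Proof.
move=> hC; exists C => t t0; rewrite (le_trans (hC t t0))// ler_wpM2l//.
  have := hC 0 (lexx _); rewrite mulr0 expR0 mulr1; exact: le_trans.
by rewrite ler_expR; lra.
Qed.

Let small_ext y z : y =1 z -> small y -> small z.
Proof. by move=> yz [C hC]; exists C => t t0; rewrite -yz hC. Qed.

(** This is where the threshold 2 enters: for t <= 0 and 2 <= s one has e^(4t) >= e^(2 s t), so a
    lower bound for e^(s t) |u0| makes the primitive [G] unbounded. *)
Let gu_lower s e t1 : 0 < e -> 2 <= s -> t1 <= 0 ->
  (forall t, t <= t1 -> e <= `|expR (s * t) * u0 t|) -> False.
Proof.
move=> e0 s2 t10 h.
apply: (@unbounded_primitive R K (e ^+ 2) t1 G g _ dG GK); first by rewrite exprn_gt0.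
move=> t tt1; apply: le_trans (gu t).
apply: (@le_trans _ _ (`|expR (s * t) * u0 t| ^+ 2)).
  by rewrite lerXn2r ?nnegrE ?(ltW e0) ?h.
rewrite real_normK ?num_real// exprMn ler_wpM2r ?sqr_ge0// -expRM_natl.
by rewrite ler_expR mulrA; have := le_trans tt1 t10 => t0; nra.
Qed.

(** The operator factors as (D - s1)(D - s2)(D + s1)(D + s2). With b = (D + s1)(D + s2) u0, c = (D -
    s2) b and a = (D + s2) u0, the functions c, b, a, u0 solve first-order equations for the roots
    s1, s2, - s1, - s2. The first two decay; the amplitudes of the last two are shown to vanish. *)
Lemma decay_real_roots s1 s2 : 2 <= s2 -> s2 <= s1 ->
  2 * x = s1 ^+ 2 + s2 ^+ 2 -> m = s1 ^+ 2 * s2 ^+ 2 ->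
  [/\ small u0, small u1, small u2 & small u3].
Proof.
move=> s22 s21 xE mE.
pose p := s1 + s2; pose q := s1 * s2.
pose b t := u2 t + p * u1 t + q * u0 t.
pose c t := u3 t + p * u2 t + q * u1 t - s2 * b t.
pose a t := u1 t + s2 * u0 t.
have dz (t : R) : is_derive t 1 (fun=> 0 : R) (0 * c t + s1 * 0 + 0).
  by rewrite !mul0r mulr0 !addr0; exact: is_derive1_cst.
have dc (t : R) : is_derive t 1 c (s1 * c t - 0 * 0 + f t).
  by rewrite /c /b; is_derive_tac; rewrite xE mE /p /q; ring.
have [| |C hC] := @first_order_growth R s1 0 1 K c (fun=> 0) f (fun=> 0) Ph ph dc dz dPh PhK _ _.
- by move=> t t0; rewrite normr0 addr0; exact: fph.
- by lra.
have {}hC t (t0 : t <= 0) := (hC t t0).1.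
have C0 : 0 <= C.
  by have := hC 0 (lexx _); rewrite mulr0 expR0 mulr1; exact: le_trans.
have db (t : R) : is_derive t 1 b (s2 * b t - 0 * 0 + c t).
  by rewrite /b; is_derive_tac; rewrite /c /b; ring.
have dz2 (t : R) : is_derive t 1 (fun=> 0 : R) (0 * b t + s2 * 0 + 0).
  by rewrite !mul0r mulr0 !addr0; exact: is_derive1_cst.
have dP (t : R) : is_derive t 1 (fun t => 2 * C * expR (2^-1 * t)) (C * expR (2^-1 * t)).
  by is_derive_tac; field.
have [| | |D hD] := @first_order_growth R s2 0 2^-1 (2 * C) b (fun=> 0) c (fun=> 0) _ _ db dz2 dP _ _ _.
- move=> t t0; rewrite normrM !ger0_norm ?expR_ge0 ?mulr_ge0// -[leRHS]mulr1.
  rewrite ler_wpM2l ?mulr_ge0// -[leRHS](@expR0 R) ler_expR; lra.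
- move=> t t0; rewrite normr0 addr0 mulrCA -expRD (le_trans (hC t t0))//.
  by rewrite ler_wpM2l// ler_expR; lra.
- by lra.
have {}hD t (t0 : t <= 0) := (hD t t0).1.
have D0 : 0 <= D.
  by have := hD 0 (lexx _); rewrite mulr0 expR0 mulr1; exact: le_trans.
have da (t : R) : is_derive t 1 a (- s1 * a t + 0 * 0 + b t).
  by rewrite /a; is_derive_tac; rewrite /b /p /q; ring.
have dz3 (t : R) : is_derive t 1 (fun=> 0 : R) (- 0 * a t - s1 * 0 + 0).
  by rewrite !oppr0 !mul0r mulr0 subr0 addr0; exact: is_derive1_cst.
have [| |L [L' [M hM]]] := @first_order_limit R s1 0 2^-1 D a (fun=> 0) b (fun=> 0) da dz3 hD _ _.
- by move=> t t0; rewrite normr0 mulr_ge0 ?expR_ge0.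
- by lra.
have {L'}hM t : t <= 0 -> `|a t - expR (- s1 * t) * L| <= M * expR (2^-1 * t).
  by move=> t0; have := (hM t t0).1; rewrite mul0r cos0 sin0 mul1r mul0r addr0.
have M0 : 0 <= M.
  by have := hM 0 (lexx _); rewrite !mulr0 expR0 mulr1; exact: le_trans.
have L0 : L = 0.
  apply/eqP/negPn/negP => L0.
  have nL : 0 < `|L| by rewrite normr_gt0.
  have e0 : 0 < `|L| / 2 / (M + 1) by rewrite !divr_gt0//; lra.
  have [|t1 t10 ht1] := @expR_near_minus_infinity (s2 + 2^-1) (`|L| / 2 / (M + 1)) _ e0.
    by lra.
  (* The derivative of e^(s2 t) u0 is e^(s2 t) a, of size at least |L| / 2 near -oo, so that e^(s2
     t) u0 grows at least linearly. This includes the resonance s1 = s2. *)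
  pose y t := Num.sg L * (expR (s2 * t) * u0 t).
  have dy (t : R) : is_derive t 1 y (Num.sg L * (expR (s2 * t) * a t)).
    by rewrite /y; is_derive_tac; rewrite /a; ring.
  have yl t : t <= t1 -> `|L| / 2 <= Num.sg L * (expR (s2 * t) * a t).
    move=> tt1; have t0 := le_trans tt1 t10.
    have -> : expR (s2 * t) * a t = expR ((s2 - s1) * t) * L +
        expR (s2 * t) * (a t - expR (- s1 * t) * L).
      by rewrite mulrDl expRD; ring.
    have E1 : 1 <= expR ((s2 - s1) * t).
      by rewrite -[leLHS](@expR0 R) ler_expR; nra.
    have E2 : `|Num.sg L * (expR (s2 * t) * (a t - expR (- s1 * t) * L))| <= `|L| / 2.
      rewrite normrM normr_sg L0 mul1r normrM ger0_norm ?expR_ge0//.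
      rewrite (le_trans (ler_wpM2l (expR_ge0 _) (hM t t0)))// mulrCA -expRD -mulrDl.
      rewrite (le_trans (ler_wpM2l M0 (ht1 t tt1)))// mulrCA ler_piMr ?divr_ge0//.
      by rewrite ler_pdivrMr; lra.
    have -> k z : Num.sg L * (k * L + z) = k * `|L| + Num.sg L * z by rewrite (normrEsg L); ring.
    move: E2; rewrite ler_norml => /andP[E2 _].
    have : `|L| <= expR ((s2 - s1) * t) * `|L| by rewrite ler_peMl.
    lra.
  (* To the left of [t2] the linear growth has brought y below -1. *)
  pose t2 := t1 - (1 + `|y t1|) / (`|L| / 2).
  have t21 : t2 <= t1 by rewrite gerBl divr_ge0 ?addr_ge0 ?divr_ge0.
  apply: (@gu_lower s2 1 t2) => //; first exact: le_trans t21 t10.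
  move=> t tt2; have tt1 := le_trans tt2 t21.
  have -> : `|expR (s2 * t) * u0 t| = `|y t| by rewrite /y [RHS]normrM normr_sg L0 mul1r.
  have dl (r : R) : is_derive r 1 (fun r => `|L| / 2 * r) (`|L| / 2) by is_derive_tac; ring.
  have := is_derive_le (fun r _ => dl r) (fun r _ => dy r) (fun r h => yl r (andP h).2) tt1.
  have : 1 + `|y t1| <= `|L| / 2 * t1 - `|L| / 2 * t.
    rewrite -mulrBr mulrC -ler_pdivrMr ?divr_gt0//.
    by move: tt2; rewrite /t2 => h; lra.
  have := ler_norm (y t1); have := ler_norm (- y t); rewrite normrN; lra.
have {}hM t : t <= 0 -> `|a t| <= M * expR (2^-1 * t).
  by move=> t0; have := hM t t0; rewrite L0 mulr0 subr0.
have du (t : R) : is_derive t 1 u0 (- s2 * u0 t + 0 * 0 + a t).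
  by apply: is_derive_eq (du0 t) _; rewrite /a; ring.
have dz4 (t : R) : is_derive t 1 (fun=> 0 : R) (- 0 * u0 t - s2 * 0 + 0).
  by rewrite !oppr0 !mul0r mulr0 subr0 addr0; exact: is_derive1_cst.
have [| |L' [L'' [N hN]]] := @first_order_limit R s2 0 2^-1 M u0 (fun=> 0) a (fun=> 0) du dz4 hM _ _.
- by move=> t t0; rewrite normr0 mulr_ge0 ?expR_ge0.
- by lra.
have {L''}hN t : t <= 0 -> `|u0 t - expR (- s2 * t) * L'| <= N * expR (2^-1 * t).
  by move=> t0; have := (hN t t0).1; rewrite mul0r cos0 sin0 mul1r mul0r addr0.
have N0 : 0 <= N.
  by have := hN 0 (lexx _); rewrite !mulr0 expR0 mulr1; exact: le_trans.
have L'0 : L' = 0.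
  apply/eqP/negPn/negP => L'0.
  have nL : 0 < `|L'| by rewrite normr_gt0.
  have e0 : 0 < `|L'| / 2 / (N + 1) by rewrite !divr_gt0//; lra.
  have [|t1 t10 ht1] := @expR_near_minus_infinity (s2 + 2^-1) (`|L'| / 2 / (N + 1)) _ e0.
    by lra.
  apply: (@gu_lower s2 (`|L'| / 2) t1) => //; first by rewrite divr_gt0.
  move=> t tt1; have t0 := le_trans tt1 t10.
  have E2 : `|expR (s2 * t) * (u0 t - expR (- s2 * t) * L')| <= `|L'| / 2.
    rewrite normrM ger0_norm ?expR_ge0//.
    rewrite (le_trans (ler_wpM2l (expR_ge0 _) (hN t t0)))// mulrCA -expRD -mulrDl.
    rewrite (le_trans (ler_wpM2l N0 (ht1 t tt1)))// mulrCA ler_piMr ?divr_ge0//.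
    by rewrite ler_pdivrMr; lra.
  move: E2; rewrite mulrBr mulrA -expRD mulNr subrr expR0 mul1r => E2.
  have := ler_normB (expR (s2 * t) * u0 t) (expR (s2 * t) * u0 t - L').
  by rewrite opprB addrCA subrr addr0; lra.
have s0 : small u0.
  by exists N => t t0; have := hN t t0; rewrite L'0 mulr0 subr0.
have sa : small a by exists M.
have sb : small b by exists D.
have sc : small c by apply: smallW hC.
have s1' : small u1.
  apply: small_ext (smallD sa (smallZ (- s2) s0)) => t; rewrite /a; ring.
have s2' : small u2.
  apply: small_ext (smallD sb (smallD (smallZ (- p) s1') (smallZ (- q) s0))) => t; rewrite /b; ring.
split=> //.
apply: small_ext (smallD sc (smallD (smallZ (- p) s2') (smallD (smallZ (- q) s1') (smallZ s2 sb)))).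
by move=> t; rewrite /c; ring.
Qed.

(** The roots are s + i e, s - i e and their negatives. With b = (D^2 + 2 s D + s^2 + e^2) u0, the
    pair c1 + i c2 = (D - s + i e) b belongs to the root s + i e, and a1 + i a2 = (D + s - i e) u0
    to - (s + i e). As u0 is real, it is recovered from a2, and no fourth integration is needed. *)
Lemma decay_complex_roots s e : 2 <= s -> e != 0 ->
  x = s ^+ 2 - e ^+ 2 -> m = (s ^+ 2 + e ^+ 2) ^+ 2 ->
  [/\ small u0, small u1, small u2 & small u3].
Proof.
move=> ss2 e0 xE mE.
pose p := 2 * s; pose q := s ^+ 2 + e ^+ 2.
pose b t := u2 t + p * u1 t + q * u0 t.
pose b' t := u3 t + p * u2 t + q * u1 t.
pose c1 t := b' t - s * b t.
pose c2 t := e * b t.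
pose a1 t := u1 t + s * u0 t.
pose a2 t := - e * u0 t.
have dc1 (t : R) : is_derive t 1 c1 (s * c1 t - e * c2 t + f t).
  by rewrite /c1 /b' /b /c2; is_derive_tac; rewrite xE mE /b /p /q; ring.
have dc2 (t : R) : is_derive t 1 c2 (e * c1 t + s * c2 t + 0).
  by rewrite /c2 /b; is_derive_tac; rewrite /c1 /b' /b /p /q; ring.
have [| |C hC] := @first_order_growth R s e 1 K c1 c2 f (fun=> 0) Ph ph dc1 dc2 dPh PhK _ _.
- by move=> t t0; rewrite normr0 addr0; exact: fph.
- by lra.
have sc1 : small c1 by apply: (@smallW _ C) => t t0; case: (hC t t0).
have sc2 : small c2 by apply: (@smallW _ C) => t t0; case: (hC t t0).
have sb : small b by apply: small_ext (smallZ e^-1 sc2) => t; rewrite /c2; field.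
have sb' : small b' by apply: small_ext (smallD sc1 (smallZ s sb)) => t; rewrite /c1; ring.
have [D hD] := sb.
have D0 : 0 <= D.
  by have := hD 0 (lexx _); rewrite mulr0 expR0 mulr1; exact: le_trans.
have da1 (t : R) : is_derive t 1 a1 (- s * a1 t + e * a2 t + b t).
  by rewrite /a1; is_derive_tac; rewrite /a2 /b /p /q; ring.
have da2 (t : R) : is_derive t 1 a2 (- e * a1 t - s * a2 t + 0).
  by rewrite /a2; is_derive_tac; rewrite /a1; ring.
have [| |L1 [L2 [M hM]]] := @first_order_limit R s e 2^-1 D a1 a2 b (fun=> 0) da1 da2 hD _ _.
- by move=> t t0; rewrite normr0 mulr_ge0 ?expR_ge0.
- by lra.
have M0 : 0 <= M.
  by have := (hM 0 (lexx _)).1; rewrite !mulr0 expR0 mulr1; exact: le_trans.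
(* If the amplitude is nonzero, e^(s t) a2 is asymptotic to X, which has zeros. Hence there is no
   pointwise lower bound as for real roots; the mean value of X^2 is used instead. *)
pose X t := cos (e * t) * L2 - sin (e * t) * L1.
pose Y t := cos (e * t) * L1 + sin (e * t) * L2.
have L0 : L1 ^+ 2 + L2 ^+ 2 = 0.
  apply/eqP/negPn/negP => L0.
  have nL : 0 < L1 ^+ 2 + L2 ^+ 2 by rewrite lt_neqAle eq_sym L0 addr_ge0 ?sqr_ge0.
  pose A := L1 ^+ 2 + L2 ^+ 2.
  have XY t : X t ^+ 2 + Y t ^+ 2 = A.
    transitivity ((cos (e * t) ^+ 2 + sin (e * t) ^+ 2) * A); first by rewrite /X /Y /A; ring.
    by rewrite cos2Dsin2 mul1r.
  have e20 : 0 < e ^+ 2 by rewrite exprn_even_gt0.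
  (* X^2 = A / 2 + (X Y)' / (2 e) *)
  pose H t := e ^- 2 * (A / 4 * t + X t * Y t / (4 * e) - M ^+ 2 * expR t).
  pose h t := e ^- 2 * (X t ^+ 2 / 2 - M ^+ 2 * expR t).
  have dH (t : R) : is_derive t 1 H (h t).
    have dX (r : R) : is_derive r 1 X (- e * Y r) by rewrite /X /Y; is_derive_tac; ring.
    have dY (r : R) : is_derive r 1 Y (e * X r) by rewrite /X /Y; is_derive_tac; ring.
    by rewrite /H; is_derive_tac; rewrite /h -(XY t); field.
  have hg t : t <= 0 -> h t <= g t.
    move=> t0; apply: le_trans (gu t).
    apply: (@le_trans _ _ ((expR (s * t) * u0 t) ^+ 2)); last first.
      rewrite exprMn ler_wpM2r ?sqr_ge0// -expRM_natl.
      by rewrite ler_expR mulrA; nra.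
    pose E := expR (s * t) * (a2 t - expR (- s * t) * X t).
    have EM : E ^+ 2 <= M ^+ 2 * expR t.
      have : `|E| <= M * expR (2^-1 * t).
        rewrite /E normrM ger0_norm ?expR_ge0// (le_trans _ (hM t t0).2)//.
        by rewrite ler_piMl// -[leRHS](@expR0 R) ler_expR; nra.
      move=> EM; rewrite -(real_normK (num_real E)).
      have -> : M ^+ 2 * expR t = (M * expR (2^-1 * t)) ^+ 2.
        by rewrite exprMn -expRM_natl; congr (_ * expR _); field.
      by rewrite lerXn2r ?nnegrE// mulr_ge0 ?expR_ge0.
    have -> : expR (s * t) * u0 t = - e^-1 * (X t + E).
      have ee : expR (s * t) * expR (- s * t) = 1 by rewrite -expRD mulNr subrr expR0.
      have -> : - e^-1 * (X t + E) =
          - e^-1 * (X t * (1 - expR (s * t) * expR (- s * t))) + expR (s * t) * u0 t.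
        by rewrite /E /a2; field.
      by rewrite ee subrr !mulr0 add0r.
    rewrite exprMn sqrrN exprVn /h ler_wpM2l ?invr_ge0 ?(ltW e20)//.
    (* (X + E)^2 - X^2 / 2 + E^2 = (X + 2 E)^2 / 2. *)
    have := sqr_ge0 (X t + 2 * E); nra.
  pose B := `|X 0 * Y 0 / (4 * e)| + A / `|4 * e| + M ^+ 2.
  have A0 : 0 <= A by exact: ltW.
  have B0 : 0 <= B by do ?[exact: normr_ge0|exact: sqr_ge0|assumption|apply: addr_ge0|apply: divr_ge0].
  have K0 : 0 <= K by rewrite (le_trans _ (GK 0)).
  (* The linear part of H 0 - H t, up to the factor e^-2, becomes 2 K e^2 + B + 1: one more than the
     bound on G 0 - G t and the bounded terms of [H] can absorb. *)
  pose t := - ((2 * K * e ^+ 2 + B + 1) / (A / 4)).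
  have t0 : t <= 0.
    rewrite oppr_le0; apply: divr_ge0; last exact: divr_ge0.
    by do ?[exact: sqr_ge0|assumption|apply: addr_ge0|apply: mulr_ge0|exact: ler01].
  have := is_derive_le (fun r _ => dH r) (fun r _ => dG r) (fun r hr => hg r (andP hr).2) t0.
  have XYB : `|X t * Y t / (4 * e)| <= A / `|4 * e|.
    rewrite normrM normfV ler_wpM2r ?invr_ge0//.
    have := sqr_ge0 (`|X t| - `|Y t|); rewrite sqrrB !real_normK ?num_real// normrM.
    have := XY t; have := mulr_ge0 (normr_ge0 (X t)) (normr_ge0 (Y t)); lra.
  have -> : H 0 - H t = e ^- 2 * (A / 4 * - t + (X 0 * Y 0 / (4 * e) - X t * Y t / (4 * e))
      - M ^+ 2 * (1 - expR t)).
    by rewrite /H expR0; ring.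
  have -> : A / 4 * - t = 2 * K * e ^+ 2 + B + 1.
    by rewrite /t; field; rewrite gt_eqF.
  rewrite mulrC ler_pdivrMr//.
  have : (G 0 - G t) * e ^+ 2 <= 2 * K * e ^+ 2.
    rewrite ler_wpM2r ?(ltW e20)//.
    by have := GK 0; have := GK t; rewrite !ler_norml => /andP[? ?] /andP[? ?]; lra.
  have : M ^+ 2 * (1 - expR t) <= M ^+ 2.
    by rewrite ler_piMr ?sqr_ge0//; have := expR_ge0 t; lra.
  have := ler_norm (- (X 0 * Y 0 / (4 * e))); rewrite normrN.
  move: XYB => /ler_normlP[]; rewrite /B; lra.
have [L10 L20] : L1 = 0 /\ L2 = 0.
  by move/eqP: L0; rewrite paddr_eq0 ?sqr_ge0// !sqrf_eq0 => /andP[/eqP-> /eqP->].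
have sa1 : small a1.
  exists M => t t0; have := (hM t t0).1.
  by rewrite L10 L20 !mulr0 addr0 mulr0 subr0.
have sa2 : small a2.
  exists M => t t0; have := (hM t t0).2.
  by rewrite L10 L20 !mulr0 subr0 mulr0 subr0.
have s0 : small u0 by apply: small_ext (smallZ (- e^-1) sa2) => t; rewrite /a2; field.
have s1 : small u1 by apply: small_ext (smallD sa1 (smallZ (- s) s0)) => t; rewrite /a1; ring.
have s2 : small u2.
  apply: small_ext (smallD sb (smallD (smallZ (- p) s1) (smallZ (- q) s0))) => t.
  by rewrite /b; ring.
split=> //.
apply: small_ext (smallD sb' (smallD (smallZ (- p) s2) (smallZ (- q) s1))) => t.
by rewrite /b'; ring.
Qed.

End decay.

(** The roots of s^4 - 2 x s^2 + m are two real pairs or a complex quadruple. The condition [e != 0]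
    leaves double real roots to the first case; purely imaginary roots are excluded by the bound
    2. *)
Definition stable_roots (R : realType) (x m : R) :=
  (exists s1 s2, [/\ 2 <= s2, s2 <= s1, 2 * x = s1 ^+ 2 + s2 ^+ 2 & m = s1 ^+ 2 * s2 ^+ 2]) \/
  (exists s e, [/\ 2 <= s, e != 0, x = s ^+ 2 - e ^+ 2 & m = (s ^+ 2 + e ^+ 2) ^+ 2]).

(** The squares of the roots are x + d and x - d with d^2 = x^2 - m. If d is real, x - d >= 4 is
    needed, that is x >= 4 and m >= 8 x - 16. Otherwise the square of the real part is (sqrt m + x)
    / 2, and the requirement is sqrt m >= 8 - x. The break c1 = - 11 / 4 is x = 4. *)
Lemma esa_condition_stable_roots (R : realType) (c1 c2 : R) :
  (if c1 >= - (11 / 4) then 45 + 12 * c1 + c1 ^+ 2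
   else - (105 + 152 * c1) / 16) <= c2 ->
  stable_roots (5 / 4 - c1) (9 / 16 + 3 / 2 * c1 + c2).
Proof.
set x := 5 / 4 - c1; set m := 9 / 16 + 3 / 2 * c1 + c2 => hc.
have le_sqrt (a b : R) : 0 <= a -> a ^+ 2 <= b -> a <= Num.sqrt b.
  by move=> a0 ab; rewrite -[leLHS](ger0_norm a0) -sqrtr_sqr ler_wsqrtr.
case: (leP 0 (x ^+ 2 - m)) => D0.
- left; pose d := Num.sqrt (x ^+ 2 - m).
  have d0 : 0 <= d by exact: sqrtr_ge0.
  have dE : d ^+ 2 = x ^+ 2 - m by rewrite sqr_sqrtr.
  have w4 : 4 <= x - d.
    move: hc; case: ifP => [hc1|/negbT]; last rewrite -ltNge => hc1.
      have -> : 45 + 12 * c1 + c1 ^+ 2 = (8 - x) ^+ 2 - 9 / 16 - 3 / 2 * c1 by rewrite /x; field.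
      (* The two regimes meet in a single point: for x <= 4 and d real the condition leaves only x =
         4, d = 0. *)
      move=> h; have x4 : x <= 4 by rewrite /x; lra.
      have : d ^+ 2 <= 16 * x - 64.
        have -> : 16 * x - 64 = x ^+ 2 - (8 - x) ^+ 2 by ring.
        by rewrite dE /m; lra.
      have := sqr_ge0 d => h1 h2.
      have /eqP : d ^+ 2 = 0 by lra.
      by rewrite sqrf_eq0 => /eqP ->; lra.
    have -> : - (105 + 152 * c1) / 16 = 8 * x - 16 - 9 / 16 - 3 / 2 * c1 by rewrite /x; field.
    move=> hc; have x4 : 4 < x by rewrite /x; lra.
    have : d ^+ 2 <= (x - 4) ^+ 2 by rewrite dE /m; nra.
    by rewrite ler_pXn2r ?nnegrE//; lra.
  exists (Num.sqrt (x + d)), (Num.sqrt (x - d)); split.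
  + by apply: le_sqrt => //; lra.
  + by rewrite ler_wsqrtr//; lra.
  + by rewrite !sqr_sqrtr; lra.
  + rewrite !sqr_sqrtr; [|lra..].
    have -> : (x + d) * (x - d) = x ^+ 2 - d ^+ 2 by ring.
    by rewrite dE; ring.
- right; pose r := Num.sqrt m.
  have m0 : 0 <= m by have := sqr_ge0 x; lra.
  have r0 : 0 <= r by exact: sqrtr_ge0.
  have rE : r ^+ 2 = m by rewrite sqr_sqrtr.
  have xr : `|x| < r.
    by rewrite -(ltr_pXn2r (n := 2))// ?nnegrE// real_normK ?num_real//; lra.
  have [xr1 xr2] : - x < r /\ x < r.
    by split; apply: le_lt_trans xr; rewrite ?ler_norm// -normrN ler_norm.
  exists (Num.sqrt ((r + x) / 2)), (Num.sqrt ((r - x) / 2)); split.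
  + apply: le_sqrt => //.
    suff : 8 - x <= r by lra.
    move: hc; case: ifP => [hc1|/negbT]; last first.
      by rewrite -ltNge => hc1 _; have : 4 < x; [rewrite /x|]; lra.
    have -> : 45 + 12 * c1 + c1 ^+ 2 = (8 - x) ^+ 2 - 9 / 16 - 3 / 2 * c1 by rewrite /x; field.
    move=> hc; rewrite -(ler_pXn2r (n := 2))// ?nnegrE//; last by rewrite /x; lra.
    by rewrite rE /m; lra.
  + by rewrite gt_eqF// sqrtr_gt0; lra.
  + by rewrite !sqr_sqrtr; lra.
  + rewrite !sqr_sqrtr; [|lra..].
    by rewrite -rE; field.
Qed.

(** * Vanishing of the deficiency solutions in the logarithmic variable *)

Section core.
Context {R : realType}.
Variables (x m : R) (u0 u1 u2 u3 v0 v1 v2 v3 G : R -> R) (K : R).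
Hypothesis stable : stable_roots x m.
Let W (t : R) := expR (4 * t).
Hypothesis du0 : forall t : R, is_derive t 1 u0 (u1 t).
Hypothesis du1 : forall t : R, is_derive t 1 u1 (u2 t).
Hypothesis du2 : forall t : R, is_derive t 1 u2 (u3 t).
Hypothesis du3 : forall t : R, is_derive t 1 u3 (2 * x * u2 t - m * u0 t + W t * v0 t).
Hypothesis dv0 : forall t : R, is_derive t 1 v0 (v1 t).
Hypothesis dv1 : forall t : R, is_derive t 1 v1 (v2 t).
Hypothesis dv2 : forall t : R, is_derive t 1 v2 (v3 t).
Hypothesis dv3 : forall t : R, is_derive t 1 v3 (2 * x * v2 t - m * v0 t - W t * u0 t).
Hypothesis dG : forall t : R, is_derive t 1 G (W t * (u0 t ^+ 2 + v0 t ^+ 2)).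
Hypothesis GK : forall t, `|G t| <= K.

Let F t := v0 t * u3 t - v1 t * u2 t + v2 t * u1 t - v3 t * u0 t
  - 2 * x * (v0 t * u1 t - v1 t * u0 t).

Let dF (t : R) : is_derive t 1 F (W t * (u0 t ^+ 2 + v0 t ^+ 2)).
Proof. by rewrite /F; is_derive_tac; ring. Qed.

Let F_nondecreasing a b : a <= b -> F a <= F b.
Proof.
apply: (is_derive_nondecreasing (fun t _ => dF t)) => t _.
by rewrite mulr_ge0 ?expR_ge0// addr_ge0 ?sqr_ge0.
Qed.

Let decay (y0 y1 y2 y3 z0 : R -> R) :
  (forall t : R, is_derive t 1 y0 (y1 t)) ->
  (forall t : R, is_derive t 1 y1 (y2 t)) ->
  (forall t : R, is_derive t 1 y2 (y3 t)) ->
  (forall t : R, is_derive t 1 y3 (2 * x * y2 t - m * y0 t + W t * z0 t)) ->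
  (forall t, y0 t ^+ 2 + z0 t ^+ 2 = u0 t ^+ 2 + v0 t ^+ 2) ->
  exists C, forall t, t <= 0 -> [/\ `|y0 t| <= C * expR (2^-1 * t),
    `|y1 t| <= C * expR (2^-1 * t), `|y2 t| <= C * expR (2^-1 * t) &
    `|y3 t| <= C * expR (2^-1 * t)].
Proof.
move=> dy0 dy1 dy2 dy3 yz.
have K0 : 0 <= K by rewrite (le_trans _ (GK 0)).
(* After a factor e^t is split off, the forcing term is e^t (e^(2t) |z0|) <= (e^(2t) + e^(4t) z0^2)
   / 2, and both halves have primitives bounded on t <= 0. *)
pose Ph t := 4^-1 * expR (2 * t) + 2^-1 * G t.
pose ph t := 2^-1 * expR (2 * t) + 2^-1 * (W t * (u0 t ^+ 2 + v0 t ^+ 2)).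
have dPh (t : R) : is_derive t 1 Ph (ph t) by rewrite /Ph; is_derive_tac; rewrite /ph; field.
have PhK t : t <= 0 -> `|Ph t| <= K + 1.
  move=> t0; apply: (@ler_pair _ _ _ 1 K); last by rewrite addrC.
    rewrite ger0_norm ?mulr_ge0 ?expR_ge0//.
    have : expR (2 * t) <= 1 by rewrite -[leRHS](@expR0 R) ler_expR; lra.
    have := expR_ge0 (2 * t); lra.
  by rewrite normrM ger0_norm//; have := GK t; lra.
have fph t : t <= 0 -> `|W t * z0 t| <= expR (1 * t) * ph t.
  move=> _; rewrite normrM ger0_norm ?expR_ge0//.
  have -> : W t = expR (1 * t) * (expR t * expR (2 * t)).
    by rewrite -!expRD /W; congr expR; ring.
  rewrite -mulrA ler_wpM2l ?expR_ge0// /ph.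
  have -> : expR (2 * t) = expR t ^+ 2 by rewrite -expRM_natl.
  have -> : W t = (expR t ^+ 2) ^+ 2 by rewrite -!expRM_natl /W; congr expR; ring.
  rewrite -yz -(real_normK (num_real (z0 t))); move: (`|z0 t|) (y0 t) => z y.
  have e0 := expR_ge0 t.
  have := sqr_ge0 (expR t - expR t ^+ 2 * z).
  have := sqr_ge0 (expR t ^+ 2 * y); nra.
have gu t : expR (4 * t) * y0 t ^+ 2 <= W t * (u0 t ^+ 2 + v0 t ^+ 2).
  by rewrite ler_wpM2l ?expR_ge0// -yz lerDl sqr_ge0.
have GK1 t : `|G t| <= K + 1 by rewrite (le_trans (GK t))// lerDl.
have [[C0 h0] [C1 h1] [C2 h2] [C3 h3]] :
  [/\ exists C, forall t, t <= 0 -> `|y0 t| <= C * expR (2^-1 * t),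
   exists C, forall t, t <= 0 -> `|y1 t| <= C * expR (2^-1 * t),
   exists C, forall t, t <= 0 -> `|y2 t| <= C * expR (2^-1 * t) &
   exists C, forall t, t <= 0 -> `|y3 t| <= C * expR (2^-1 * t)].
  case: stable => [[s1 [s2 [a1 a2 a3 a4]]]|[s [e [a1 a2 a3 a4]]]].
    exact: (decay_real_roots dy0 dy1 dy2 dy3 dPh PhK fph dG GK1 gu a1 a2 a3 a4).
  exact: (decay_complex_roots dy0 dy1 dy2 dy3 dPh PhK fph dG GK1 gu a1 a2 a3 a4).
exists (`|C0| + `|C1| + `|C2| + `|C3|) => t t0.
have n0 := normr_ge0 C0; have n1 := normr_ge0 C1.
have n2 := normr_ge0 C2; have n3 := normr_ge0 C3.
have := (ler_norm C0, ler_norm C1, ler_norm C2, ler_norm C3) => -[[[l0 l1] l2] l3].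
split; [apply: le_trans (h0 t t0) _|apply: le_trans (h1 t t0) _|
  apply: le_trans (h2 t t0) _|apply: le_trans (h3 t t0) _];
  by rewrite ler_wpM2r ?expR_ge0//; lra.
Qed.

Let F_ge0 t0 : 0 <= F t0.
Proof.
rewrite leNgt; apply/negP => Ft0.
have [C hC] := decay du0 du1 du2 du3 (fun=> erefl).
have dv3' (t : R) : is_derive t 1 v3 (2 * x * v2 t - m * v0 t + W t * - u0 t).
  by rewrite mulrN.
have [D hD] := decay dv0 dv1 dv2 dv3' (fun t => etrans (congr1 _ (sqrrN _)) (addrC _ _)).
have C0 : 0 <= C.
  by have [+ _ _ _] := hC 0 (lexx _); rewrite mulr0 expR0 mulr1; exact: le_trans.
have D0 : 0 <= D.
  by have [+ _ _ _] := hD 0 (lexx _); rewrite mulr0 expR0 mulr1; exact: le_trans.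
pose E := (4 + 4 * `|x|) * (C * D).
have E0 : 0 <= E by rewrite !mulr_ge0// addr_ge0// mulr_ge0.
have FE t : t <= 0 -> `|F t| <= E * expR (1 * t).
  move=> t0'.
  have [a0 a1 a2 a3] := hC t t0'; have [b0 b1 b2 b3] := hD t t0'.
  have pr a b : `|a| <= C * expR (2^-1 * t) -> `|b| <= D * expR (2^-1 * t) ->
      `|b * a| <= C * D * expR (1 * t).
    move=> ha hb; rewrite normrM mulrC.
    have -> : C * D * expR (1 * t) = (C * expR (2^-1 * t)) * (D * expR (2^-1 * t)).
      by rewrite mulrACA -expRD; congr (_ * expR _); field.
    exact: ler_pM.
  have -> : E * expR (1 * t) = 4 * (C * D * expR (1 * t)) + 4 * (`|x| * (C * D * expR (1 * t))).
    by rewrite /E; ring.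
  move: (pr _ _ a3 b0) (pr _ _ a2 b1) (pr _ _ a1 b2) (pr _ _ a0 b3).
  move: (pr _ _ a1 b0) (pr _ _ a0 b1).
  set y := C * D * expR (1 * t); rewrite /F => q1 q2 q3 q4 q5 q6.
  have qq : `|2 * x * (v0 t * u1 t - v1 t * u0 t)| <= 4 * (`|x| * y).
    have -> : 4 * (`|x| * y) = 2 * `|x| * (y + y) by ring.
    rewrite normrM normrM ger0_norm// ler_wpM2l ?mulr_ge0//.
    by rewrite (le_trans (ler_normB _ _))// lerD.
  rewrite (le_trans (ler_normB _ _))// lerD//.
  rewrite (le_trans (ler_normB _ _))//.
  have -> : 4 * y = y + y + y + y by ring.
  rewrite lerD// (le_trans (ler_normD _ _))// lerD//.
  by rewrite (le_trans (ler_normB _ _))// lerD.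
have e0 : 0 < - F t0 / (E + 1) / 2 by rewrite !divr_gt0// ?oppr_gt0//; lra.
have [t1 t10 ht1] := expR_near_minus_infinity ltr01 e0.
pose t := Order.min t0 t1.
have tt0 : t <= t0 by rewrite ge_min lexx.
have tt1 : t <= t1 by rewrite ge_min lexx orbT.
have := FE t (le_trans tt1 t10); have := F_nondecreasing tt0.
have h1 : E * expR (1 * t) <= E * (- F t0 / (E + 1) / 2) by rewrite ler_wpM2l// ht1.
have h2 : E * (- F t0 / (E + 1) / 2) <= - F t0 / 2.
  have -> : E * (- F t0 / (E + 1) / 2) = (E / (E + 1)) * (- F t0 / 2) by field; lra.
  rewrite ler_piMl ?divr_ge0// ?oppr_ge0 ?ltW// ltr_pdivrMr; lra.
rewrite ler_norml => h3 /andP[h4 _]; lra.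
Qed.

Theorem deficiency_trivial t : u0 t = 0 /\ v0 t = 0.
Proof.
have F0 s : F s = 0.
  apply/eqP; rewrite eq_le F_ge0 andbT.
  apply: (concomitant_le0 du0 du1 du2 du3 dv0 dv1 dv2 dv3 dG GK (expR_gt0 (4 * s))) => r sr.
  by rewrite ler_expR ler_pM2l.
have := is_derive1_derive1 (dF t).
have -> : F = fun=> 0 by apply/funext => s; rewrite F0.
rewrite (is_derive1_derive1 (is_derive1_cst 0 t)) => /esym/eqP.
rewrite mulf_eq0 gt_eqF ?expR_gt0//= paddr_eq0 ?sqr_ge0// !sqrf_eq0.
by move=> /andP[/eqP-> /eqP->].
Qed.

End core.

(** * Passage between the half-line and the logarithmic variable *)

Section transform.
Context {R : realType}.
Variables (c1 c2 : R).

(** Leibniz expansion of c1 (r^-2 u'' + (r^-2 u)'') + c2 r^-4 u, with u, u', u'' as separate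
    arguments. *)
Definition lower_order (u0 u1 u2 : R -> R) (r : R) : R :=
  2 * c1 * r^-1 ^+ 2 * u2 r - 4 * c1 * r^-1 ^+ 3 * u1 r + (6 * c1 + c2) * r^-1 ^+ 4 * u0 r.

Lemma is_derive1_invr (r : R) : r != 0 -> is_derive r 1 (fun s => s^-1) (- r^-1 ^+ 2).
Proof.
by move=> r0; apply: is_derive_eq (is_derive1_inv (is_derive1_id r) r0) _; rewrite exprVn mulr1.
Qed.

(** Square integrability is expressed by the bounded primitive [H]. Composed with exp it is at once
    the bounded primitive needed in the variable t, as u^2 dr = e^(4t) y^2 dt; no integral has to be
    transformed. *)
Lemma classical_deficiency_trivial (u0 u1 u2 u3 v0 v1 v2 v3 H : R -> R) (K : R) :
  stable_roots (5 / 4 - c1) (9 / 16 + 3 / 2 * c1 + c2) ->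
  (forall r : R, 0 < r -> is_derive r 1 u0 (u1 r)) ->
  (forall r : R, 0 < r -> is_derive r 1 u1 (u2 r)) ->
  (forall r : R, 0 < r -> is_derive r 1 u2 (u3 r)) ->
  (forall r : R, 0 < r -> is_derive r 1 u3 (v0 r - lower_order u0 u1 u2 r)) ->
  (forall r : R, 0 < r -> is_derive r 1 v0 (v1 r)) ->
  (forall r : R, 0 < r -> is_derive r 1 v1 (v2 r)) ->
  (forall r : R, 0 < r -> is_derive r 1 v2 (v3 r)) ->
  (forall r : R, 0 < r -> is_derive r 1 v3 (- u0 r - lower_order v0 v1 v2 r)) ->
  (forall r : R, 0 < r -> is_derive r 1 H (u0 r ^+ 2 + v0 r ^+ 2)) ->
  (forall r, 0 < r -> `|H r| <= K) ->
  forall r, 0 < r -> u0 r = 0 /\ v0 r = 0.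
Proof.
move=> st du0 du1 du2 du3 dv0 dv1 dv2 dv3 dH HK r r0.
have dexp (y y' : R -> R) : (forall r : R, 0 < r -> is_derive r 1 y (y' r)) ->
    forall t : R, is_derive t 1 (fun t => y (expR t)) (y' (expR t) * expR t).
  move=> dy t; apply: (@is_derive1_compose _ y expR _ _ _ (is_derive_expR t)).
  exact/dy/expR_gt0.
pose e t : R := expR (- (3 / 2) * t).
pose y0 (u0 : R -> R) t := e t * u0 (expR t).
pose y1 (u0 u1 : R -> R) t := e t * (u1 (expR t) * expR t - 3 / 2 * u0 (expR t)).
pose y2 (u0 u1 u2 : R -> R) t := e t * (u2 (expR t) * expR t ^+ 2
   - 2 * (u1 (expR t) * expR t) + 9 / 4 * u0 (expR t)).
pose y3 (u0 u1 u2 u3 : R -> R) t := e t * (u3 (expR t) * expR t ^+ 3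
   - 3 / 2 * (u2 (expR t) * expR t ^+ 2)
   + 13 / 4 * (u1 (expR t) * expR t) - 27 / 8 * u0 (expR t)).
have dE (t : R) : is_derive t 1 expR (expR t) by exact: is_derive_expR.
have main (w0 w1 w2 w3 w4 : R -> R) :
  (forall r : R, 0 < r -> is_derive r 1 w0 (w1 r)) ->
  (forall r : R, 0 < r -> is_derive r 1 w1 (w2 r)) ->
  (forall r : R, 0 < r -> is_derive r 1 w2 (w3 r)) ->
  (forall r : R, 0 < r -> is_derive r 1 w3 (w4 r - lower_order w0 w1 w2 r)) ->
  [/\ forall t : R, is_derive t 1 (y0 w0) (y1 w0 w1 t),
   forall t : R, is_derive t 1 (y1 w0 w1) (y2 w0 w1 w2 t),
   forall t : R, is_derive t 1 (y2 w0 w1 w2) (y3 w0 w1 w2 w3 t) &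
   forall t : R, is_derive t 1 (y3 w0 w1 w2 w3) (2 * (5 / 4 - c1) * y2 w0 w1 w2 t
     - (9 / 16 + 3 / 2 * c1 + c2) * y0 w0 t + expR (4 * t) * y0 w4 t)].
  move=> dw0 dw1 dw2 dw3.
  have d0 := dexp _ _ dw0; have d1 := dexp _ _ dw1.
  have d2 := dexp _ _ dw2; have d3 := dexp _ _ dw3.
  split=> t.
  - by rewrite /y0 /e; is_derive_tac; rewrite /y1 /e; field.
  - by rewrite /y1 /e; is_derive_tac; rewrite /y2 /e; field.
  - by rewrite /y2 /e; is_derive_tac; rewrite /y3 /e; field.
  - have -> : expR (4 * t) = expR t ^+ 4 by rewrite -expRM_natl.
    rewrite /y3 /e; is_derive_tac; rewrite /y2 /y0 /e /lower_order.
    by field; rewrite gt_eqF ?expR_gt0.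
have [a0 a1 a2 a3] := main _ _ _ _ _ du0 du1 du2 du3.
have [b0 b1 b2 b3] := main _ _ _ _ _ dv0 dv1 dv2 dv3.
have dG (t : R) : is_derive t 1 (fun t => H (expR t))
    (expR (4 * t) * (y0 u0 t ^+ 2 + y0 v0 t ^+ 2)).
  apply: is_derive_eq (dexp _ _ dH t) _.
  have -> : expR (4 * t) * (y0 u0 t ^+ 2 + y0 v0 t ^+ 2) =
    expR (4 * t) * e t ^+ 2 * (u0 (expR t) ^+ 2 + v0 (expR t) ^+ 2) by rewrite /y0; ring.
  rewrite mulrC; congr (_ * _).
  by rewrite /e -expRM_natl -expRD; congr expR; field.
have GK t : `|H (expR t)| <= K by exact/HK/expR_gt0.
have b3' (t : R) : is_derive t 1 (y3 v0 v1 v2 v3) (2 * (5 / 4 - c1) * y2 v0 v1 v2 t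
     - (9 / 16 + 3 / 2 * c1 + c2) * y0 v0 t - expR (4 * t) * y0 u0 t).
  by apply: is_derive_eq (b3 t) _; rewrite /y0; ring.
have := deficiency_trivial st a0 a1 a2 a3 b0 b1 b2 b3' dG GK (ln r).
rewrite /y0 lnK ?posrE// => -[/eqP + /eqP].
by rewrite !mulf_eq0 (gt_eqF (expR_gt0 _))/= => /eqP-> /eqP->.
Qed.

(** The reverse direction of the substitution, which carries solutions in t to classical solutions
    on the half-line for the necessity part. *)
Lemma halfline_transform (y0 y1 y2 y3 y4 : R -> R) :
  (forall t : R, is_derive t 1 y0 (y1 t)) ->
  (forall t : R, is_derive t 1 y1 (y2 t)) ->
  (forall t : R, is_derive t 1 y2 (y3 t)) ->
  (forall t : R, is_derive t 1 y3 (y4 t)) ->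
  let E r := expR (3 / 2 * ln r) in
  let u0 r := E r * y0 (ln r) in
  let u1 r := E r * r^-1 * (y1 (ln r) + 3 / 2 * y0 (ln r)) in
  let u2 r := E r * r^-1 ^+ 2 * (y2 (ln r) + 2 * y1 (ln r) + 3 / 4 * y0 (ln r)) in
  let u3 r := E r * r^-1 ^+ 3 * (y3 (ln r) + 3 / 2 * y2 (ln r) - 1 / 4 * y1 (ln r)
    - 3 / 8 * y0 (ln r)) in
  let v r := E r * r^-1 ^+ 4 * (y4 (ln r) - 2 * (5 / 4 - c1) * y2 (ln r)
    + (9 / 16 + 3 / 2 * c1 + c2) * y0 (ln r)) in
  [/\ forall r : R, 0 < r -> is_derive r 1 u0 (u1 r),
   forall r : R, 0 < r -> is_derive r 1 u1 (u2 r),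
   forall r : R, 0 < r -> is_derive r 1 u2 (u3 r) &
   forall r : R, 0 < r -> is_derive r 1 u3 (v r - lower_order u0 u1 u2 r)].
Proof.
move=> dy0 dy1 dy2 dy3 E u0 u1 u2 u3 v.
have dln (y y' : R -> R) : (forall t : R, is_derive t 1 y (y' t)) ->
    forall r : R, 0 < r -> is_derive r 1 (fun r => y (ln r)) (y' (ln r) * r^-1).
  by move=> dy r r0; refine (@is_derive1_compose _ y (@ln R) r _ _ (is_derive1_ln r0) (dy _)).
have dexp (t : R) : is_derive t 1 (fun t => expR (3 / 2 * t)) (3 / 2 * expR (3 / 2 * t)).
  by is_derive_tac; ring.
split=> r r0; have d0 := dln _ _ dy0 r r0; have d1 := dln _ _ dy1 r r0;
  have d2 := dln _ _ dy2 r r0; have d3 := dln _ _ dy3 r r0;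
  have dE := dln _ _ dexp r r0;
  have di := is_derive1_invr (lt0r_neq0 r0).
- by rewrite /u0; is_derive_tac; rewrite /u1 /E; field; rewrite gt_eqF.
- by rewrite /u1; is_derive_tac; rewrite /u2 /E; field; rewrite gt_eqF.
- by rewrite /u2; is_derive_tac; rewrite /u3 /E; field; rewrite gt_eqF.
- rewrite /u3; is_derive_tac; rewrite /v /lower_order /u0 /u1 /u2 /E.
  by field; rewrite gt_eqF.
Qed.

End transform.

(** * Smooth functions and test functions *)

Section smooth.
Context {R : realType}.
Implicit Types (f g : R -> R) (c x a b : R) (n k : nat).

Lemma is_derive1_unique_near f g x a : (\near x, f x = g x) -> is_derive x 1 g a -> is_derive x 1 f a.
Proof.
move=> fg; apply: near_eq_is_derive.
by apply: filterS fg => y ->.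
Qed.

Lemma lt_near f g x a : a < x -> (forall y, a < y -> f y = g y) -> \near x, f x = g x.
Proof. by move=> ax fg; near=> y; apply: fg; near: y; exact: lt_nbhsr. Unshelve. all: by end_near. Qed.

Lemma gt_near f g x b : x < b -> (forall y, y < b -> f y = g y) -> \near x, f x = g x.
Proof. by move=> ax fg; near=> y; apply: fg; near: y; exact: lt_nbhsl. Unshelve. all: by end_near. Qed.

(** Gives the derivative of [flat] at the junction point 0. *)
Lemma is_derive1_quadratic f C : (forall x, `|f x| <= C * x ^+ 2) -> is_derive (0 : R) 1 f 0.
Proof.
move=> fC.
have f0 : f 0 = 0.
  by apply/eqP; rewrite -normr_le0 (le_trans (fC 0))// expr0n/= mulr0.
(* At z = 0 the quotient is 0 by the convention for the inverse, which is the value a Carathéodory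
   slope must take there. *)
apply/is_derive1_caratheodory; exists (fun z => f z / z); split.
- move=> z; rewrite f0 !subr0; have [->|z0] := eqVneq z 0; first by rewrite f0 mulr0.
  by rewrite divfK.
- have bnd z : `|f z / z| <= C * `|z|.
    have [->|z0] := eqVneq z 0; first by rewrite invr0 mulr0 normr0 mulr0.
    rewrite normrM normfV ler_pdivrMr ?normr_gt0//.
    by rewrite -mulrA -expr2 real_normK ?num_real.
  have C0 : 0 <= C.
    by have := fC 1; rewrite expr1n mulr1; exact: le_trans.
  apply/cvgrPdist_le => e e0.
  have ec : 0 < e / (C + 1) by rewrite divr_gt0//; lra.
  have := @nbhs0_le R R^o _ ec; apply: filterS => z h.
  rewrite invr0 mulr0 sub0r normrN (le_trans (bnd z))//.
  rewrite (le_trans (ler_wpM2l C0 h))// mulrCA ler_piMr ?(ltW e0)//.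
  by rewrite ler_pdivrMr; lra.
- by rewrite invr0 mulr0.
Qed.

(** The recursion peels the innermost derivative, so closure under sums, products and affine changes
    follows by induction on n for all functions at once. *)
Fixpoint differentiable_n n f : Prop :=
  if n is n'.+1 then (forall x, derivable f x 1) /\ differentiable_n n' (f^`()%classic) else True.

Definition smooth f := forall n, differentiable_n n f.

Lemma smoothP f : smooth f <-> (forall n x, derivable (f^`(n)%classic) x 1).
Proof.
split=> [sf n|].
  elim: n f sf => [|n IH] f sf x; first by have [+ _] := sf 1%N; exact.
  by rewrite derive1Sn; apply: IH => k; have [] := sf k.+1.
move=> h n; elim: n f h => [|n IH] f h //=; split; first exact: (h 0%N).
by apply: IH => k x; have := h k.+1 x; rewrite derive1Sn.
Qed.

Lemma smooth_derive1 f : smooth f -> smooth (f^`()%classic).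
Proof. by move=> sf n; have [] := sf n.+1. Qed.

Lemma smooth_is_derive f x : smooth f -> is_derive x 1 f (f^`()%classic x).
Proof. by move=> sf; apply: derivable_is_derive1; have [] := sf 1%N. Qed.

Lemma derive1_ext f g : (forall x : R, is_derive x 1 f (g x)) -> f^`()%classic = g.
Proof. by move=> h; apply/funext => x; exact: is_derive1_derive1. Qed.

Lemma differentiable_nS n f g : (forall x : R, is_derive x 1 f (g x)) ->
  differentiable_n n g -> differentiable_n n.+1 f.
Proof.
by move=> h dg; split=> [x|]; [exact: is_derive1_derivable (h x)|rewrite (derive1_ext h)].
Qed.

Lemma smoothS f g : (forall x : R, is_derive x 1 f (g x)) -> smooth g -> smooth f.
Proof. by move=> fg sg [//|n]; exact: differentiable_nS fg (sg n). Qed.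

Lemma differentiable_nW n f : differentiable_n n.+1 f -> differentiable_n n f.
Proof. by elim: n f => [//|n IH] f [h1 h2]; split=> //; exact: IH. Qed.

Lemma differentiable_nSP n f : differentiable_n n.+1 f ->
  (forall x : R, is_derive x 1 f (f^`()%classic x)) /\ differentiable_n n (f^`()%classic).
Proof. by move=> [h1 h2]; split=> // x; exact: derivable_is_derive1. Qed.

Lemma differentiable_n_cst n c : differentiable_n n (fun=> c).
Proof.
elim: n c => [//|n IH] c; exact: (differentiable_nS (fun x => is_derive1_cst c x) (IH 0)).
Qed.

Lemma differentiable_nD n f g : differentiable_n n f -> differentiable_n n g ->
  differentiable_n n (fun x => f x + g x).
Proof.
elim: n f g => [//|n IH] f g /differentiable_nSP[df df'] /differentiable_nSP[dg dg'].
exact: (differentiable_nS (fun x => is_derive1_add (df x) (dg x)) (IH _ _ df' dg')).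
Qed.

Lemma differentiable_nM n f g : differentiable_n n f -> differentiable_n n g ->
  differentiable_n n (fun x => f x * g x).
Proof.
elim: n f g => [//|n IH] f g hf hg.
have /differentiable_nSP[df df'] := hf; have /differentiable_nSP[dg dg'] := hg.
apply: (differentiable_nS (fun x => is_derive1_mul (df x) (dg x))).
by apply: differentiable_nD; apply: IH => //; exact: differentiable_nW.
Qed.

Lemma differentiable_n_affine n f a b : differentiable_n n f ->
  differentiable_n n (fun x => f (a * x + b)).
Proof.
elim: n f => [//|n IH] f /differentiable_nSP[df df'].
have d (x : R) : is_derive x 1 (fun x => f (a * x + b)) (f^`()%classic (a * x + b) * a).
  have da : is_derive x 1 (fun x => a * x + b) a by is_derive_tac; ring.
  exact: (@is_derive1_compose _ f (fun x => a * x + b) _ _ _ da (df _)).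
apply: (differentiable_nS d).
by apply: differentiable_nM (differentiable_n_cst _ _); exact: IH.
Qed.

Lemma smoothD f g : smooth f -> smooth g -> smooth (fun x => f x + g x).
Proof. by move=> sf sg n; exact: differentiable_nD. Qed.

Lemma smoothM f g : smooth f -> smooth g -> smooth (fun x => f x * g x).
Proof. by move=> sf sg n; exact: differentiable_nM. Qed.

Lemma smooth_cst c : smooth (fun=> c).
Proof. by move=> n; exact: differentiable_n_cst. Qed.

Lemma smooth_id : smooth (fun x => x).
Proof. exact: (smoothS (fun x => is_derive1_id x) (smooth_cst 1)). Qed.

(* x^-k exp (- 1 / x); for k = 0 the standard flat function *)
Definition flat k x : R := if 0 < x then x^-1 ^+ k * expR (- x^-1) else 0.

(** The exponential of 1 / x exceeds its Taylor term x^-(k+2) / (k+2)!, which leaves x^2 after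
    multiplication by x^-k. *)
Lemma flat_quadratic k : exists C, forall x, `|flat k x| <= C * x ^+ 2.
Proof.
exists (k.+2)`!%:R => x; rewrite /flat; case: ifP => [x0|_]; last first.
  by rewrite normr0 mulr_ge0 ?sqr_ge0.
have xi0 : 0 <= x^-1 by rewrite invr_ge0 ltW.
rewrite ger0_norm ?mulr_ge0 ?expR_ge0 ?exprn_ge0// expRN ler_pdivrMr ?expR_gt0//.
have -> : x^-1 ^+ k = x ^+ 2 * x^-1 ^+ k.+2.
  by rewrite !exprS expr0; field; rewrite gt_eqF.
have -> : (k.+2)`!%:R * x ^+ 2 * expR x^-1 = x ^+ 2 * ((k.+2)`!%:R * expR x^-1) by ring.
rewrite ler_wpM2l ?sqr_ge0// -ler_pdivrMl ?ltr0n ?fact_gt0// mulrC.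
by apply: le_trans (expR_ge1Dxn k.+1 xi0); rewrite lerDr.
Qed.

(** The family of all [flat k] is closed under differentiation up to linear combinations; this is
    the purpose of the index and yields smoothness by induction. *)
Lemma flat_derive k x : is_derive x 1 (flat k) (- k%:R * flat k.+1 x + flat k.+2 x).
Proof.
have [x0|x0|->] := ltgtP x 0.
- have e : \near x, flat k x = (fun=> 0) x.
    by apply: (gt_near x0) => y y0; rewrite /flat ltNge ltW.
  apply: (is_derive1_unique_near e).
  by rewrite /flat ltNge ltW//= mulr0 addr0; exact: is_derive1_cst.
- pose h y : R := y^-1 ^+ k * expR (- y^-1).
  have e : \near x, flat k x = h x.
    by apply: (lt_near x0) => y y0; rewrite /flat y0.
  apply: (is_derive1_unique_near e).
  have di : is_derive x 1 (fun y : R => y^-1) (- x^-1 ^+ 2).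
    apply: is_derive_eq (is_derive1_inv (is_derive1_id x) (lt0r_neq0 x0)) _.
    by rewrite exprVn mulr1.
  rewrite /h; is_derive_tac; rewrite /flat x0.
  by case: k {e h} => [|k] /=; [ring|rewrite !exprS; ring].
- have [C hC] := flat_quadratic k.
  by rewrite /flat ltxx mulr0 addr0; exact: is_derive1_quadratic hC.
Qed.

Lemma smooth_flat k : smooth (flat k).
Proof.
move=> n; elim: n k => [//|n IH] k.
apply: (differentiable_nS (flat_derive k)).
by apply: differentiable_nD => //; apply: differentiable_nM => //; exact: differentiable_n_cst.
Qed.

Definition vanishes_outside a b f := forall x, (x <= a) || (b <= x) -> f x = 0.

Definition test f := smooth f /\ exists a b, [/\ 0 < a, a < b & vanishes_outside a b f].

Lemma vanishes_outsideW a b a' b' f : a' <= a -> b <= b' ->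
  vanishes_outside a b f -> vanishes_outside a' b' f.
Proof.
move=> aa bb h x /orP[xa|xb]; apply: h; first by rewrite (le_trans xa).
by rewrite (le_trans bb) ?orbT.
Qed.

Lemma test2 f g : test f -> test g -> exists a b,
  [/\ 0 < a, a < b, vanishes_outside a b f & vanishes_outside a b g].
Proof.
move=> [_ [a [b [a0 ab fab]]]] [_ [c [d [c0 cd gcd]]]].
exists (Order.min a c), (Order.max b d); split.
- by rewrite lt_min a0.
- by rewrite gt_min lt_max ab.
- by apply: vanishes_outsideW fab; rewrite ?ge_min ?le_max ?lexx.
- by apply: vanishes_outsideW gcd; rewrite ?ge_min ?le_max ?lexx ?orbT.
Qed.

Lemma testD f g : test f -> test g -> test (fun x => f x + g x).
Proof.
move=> tf tg; split; first by apply: smoothD; [case: tf|case: tg].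
have [a [b [a0 ab hf hg]]] := test2 tf tg; exists a, b; split=> // x h.
by rewrite hf// hg// addr0.
Qed.

Lemma testMl f g : smooth f -> test g -> test (fun x => f x * g x).
Proof.
move=> sf [sg [a [b [a0 ab h]]]]; split; first exact: smoothM.
by exists a, b; split=> // x hx; rewrite h// mulr0.
Qed.

Lemma testZ c f : test f -> test (fun x => c * f x).
Proof. exact/testMl/smooth_cst. Qed.

Lemma testN f : test f -> test (fun x => - f x).
Proof. by move=> /(testZ (-1)); under eq_fun do rewrite mulN1r. Qed.

Lemma test0 : test (fun=> 0).
Proof.
split; first exact: smooth_cst.
by exists 1, 2; split=> //; rewrite ltr1n.
Qed.

Lemma test_near0 f x a b : vanishes_outside a b f -> x < a -> \near x, f x = (fun=> 0) x.
Proof. by move=> h xa; apply: (gt_near xa) => y /ltW ya; rewrite h// ya. Qed.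

Lemma test_derive1 f : test f -> test (f^`()%classic).
Proof.
move=> [sf [a [b [a0 ab h]]]]; split; first exact: smooth_derive1.
exists (a / 2), (b + 1); split; [lra|lra|] => x /orP[xa|xb]; apply: is_derive1_derive1.
  by apply: is_derive1_unique_near (test_near0 h _) (is_derive1_cst 0 x); lra.
apply: is_derive1_unique_near (is_derive1_cst 0 x).
by apply: (@lt_near _ _ _ b); [lra|] => y /ltW yb; rewrite h// yb orbT.
Qed.

(** To the left of the support the product is locally zero, so the singularity of x^-k at 0 and its
    conventional value there do no harm. *)
Lemma test_invX_derive k f x : test f -> is_derive x 1 (fun s => s^-1 ^+ k * f s)
  (x^-1 ^+ k * f^`()%classic x + (- k%:R) * (x^-1 ^+ k.+1 * f x)).
Proof.
move=> [sf [a [b [a0 ab h]]]]; have [x0|x0] := ltP 0 x.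
  have di : is_derive x 1 (fun y : R => y^-1) (- x^-1 ^+ 2).
    apply: is_derive_eq (is_derive1_inv (is_derive1_id x) (lt0r_neq0 x0)) _.
    by rewrite exprVn mulr1.
  have df := smooth_is_derive x sf.
  by is_derive_tac; case: k => [|k] /=; [ring|rewrite !exprS; ring].
have xa := le_lt_trans x0 a0.
have -> : f^`()%classic x = 0.
  apply: is_derive1_derive1.
  exact: is_derive1_unique_near (test_near0 h xa) (is_derive1_cst 0 x).
rewrite h ?(ltW xa)// !mulr0 addr0.
apply: is_derive1_unique_near (is_derive1_cst 0 x).
by apply: (gt_near xa) => y /ltW ya; rewrite h ?ya// mulr0.
Qed.

Lemma test_invX k f : test f -> test (fun s => s^-1 ^+ k * f s).
Proof.
move=> tf; split; last first.
  have [_ [a [b [a0 ab h]]]] := tf.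
  by exists a, b; split=> // x hx; rewrite h// mulr0.
move=> n; elim: n k f tf => [//|n IH] k f tf.
apply: (differentiable_nS (fun x => test_invX_derive k x tf)).
apply: differentiable_nD; first exact/IH/test_derive1.
by apply: differentiable_nM; [exact: differentiable_n_cst|exact: IH].
Qed.

(* converges to the indicator of ]a, b[ as n tends to infinity *)
Definition bump a b n x : R := flat 0 (n.+1%:R * (x - a)) * flat 0 (n.+1%:R * (b - x)).

Lemma bump_vanishes a b n : vanishes_outside a b (bump a b n).
Proof.
move=> x; rewrite /bump /flat => /orP[xa|bx].
  by rewrite pmulr_rgt0// subr_gt0 ltNge xa mul0r.
by rewrite (@pmulr_rgt0 _ _ (b - x))// subr_gt0 [x < b]ltNge bx mulr0.
Qed.

Lemma bump_test a b n : 0 < a -> a < b -> test (bump a b n).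
Proof.
move=> a0 ab; split.
  apply: smoothM.
    have -> : (fun x => flat 0 (n.+1%:R * (x - a))) = (fun x => flat 0 (n.+1%:R * x + (- (n.+1%:R * a)))).
      by apply/funext => x; rewrite mulrBr.
    by move=> k; apply: differentiable_n_affine; exact: smooth_flat.
  have -> : (fun x => flat 0 (n.+1%:R * (b - x))) = (fun x => flat 0 (- n.+1%:R * x + n.+1%:R * b)).
    by apply/funext => x; rewrite mulrBr addrC mulNr.
  by move=> k; apply: differentiable_n_affine; exact: smooth_flat.
by exists a, b; split=> //; exact: bump_vanishes.
Qed.

Lemma flat_ge0 k x : 0 <= flat k x.
Proof.
by rewrite /flat; case: ifP => // x0; rewrite mulr_ge0 ?expR_ge0 ?exprn_ge0 ?invr_ge0 ?ltW.
Qed.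

Lemma flat_le1 x : flat 0 x <= 1.
Proof.
rewrite /flat; case: ifP => // x0; rewrite mul1r -[leRHS](@expR0 R) ler_expR.
by rewrite oppr_le0 invr_ge0 ltW.
Qed.

Lemma bump_ge0 a b n x : 0 <= bump a b n x.
Proof. by rewrite mulr_ge0 ?flat_ge0. Qed.

Lemma bump_le1 a b n x : bump a b n x <= 1.
Proof. by rewrite mulr_ile1 ?flat_ge0 ?flat_le1. Qed.

Lemma bump_gt0 a b n x : a < x -> x < b -> 0 < bump a b n x.
Proof.
move=> ax xb; rewrite mulr_gt0// /flat pmulr_rgt0// subr_gt0 ?ax ?xb mul1r expR_gt0//.
Qed.

Lemma bump_cvg a b x : a < x -> x < b -> bump a b n x @[n --> \oo] --> (1 : R).
Proof.
move=> ax xb.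
have key y : 0 < y -> flat 0 (n.+1%:R * y) @[n --> \oo] --> (1 : R).
  move=> y0.
  have -> : (fun n => flat 0 (n.+1%:R * y)) = (fun n => expR (- (y^-1 * (n.+1%:R)^-1))).
    by apply/funext => n; rewrite /flat pmulr_rgt0// y0 mul1r invfM mulrC.
  rewrite -[X in _ --> X](@expR0 R); apply: continuous_cvg; first exact: continuous_expR.
  rewrite -oppr0; apply: cvgN; rewrite -[X in _ --> X](mulr0 y^-1).
  by apply: cvgM; [exact: cvg_cst|exact: cvg_harmonic].
by rewrite -[X in _ --> X](mulr1 1); apply: cvgM; apply: key; rewrite subr_gt0.
Qed.

End smooth.

(** * Square integrable functions and orthogonal projection *)

Section projection.
Context {R : realType} (V : lmodType R) (E : set V) (B : V -> V -> R).
Hypothesis ED : forall x y, E x -> E y -> E (x + y).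
Hypothesis EZ : forall c x, E x -> E (c *: x).
Hypothesis BC : forall x y, B x y = B y x.
Hypothesis BD : forall x y z, E x -> E y -> E z -> B (x + y) z = B x z + B y z.
Hypothesis BZ : forall c x y, E x -> E y -> B (c *: x) y = c * B x y.
Hypothesis B0 : forall x, E x -> 0 <= B x x.
Hypothesis complete : forall u : nat -> V, (forall n, E (u n)) ->
  (forall e, 0 < e -> exists N, forall m n, (N <= m)%N -> (N <= n)%N ->
     B (u m - u n) (u m - u n) < e) ->
  exists2 y, E y & forall e, 0 < e -> exists N, forall n, (N <= n)%N ->
     B (u n - y) (u n - y) < e.

Let EN x : E x -> E (- x).
Proof. by move=> Ex; rewrite -scaleN1r; exact: EZ. Qed.

Let EB x y : E x -> E y -> E (x - y).
Proof. by move=> Ex Ey; exact: ED (EN Ey). Qed.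

Let BDr x y z : E x -> E y -> E z -> B z (x + y) = B z x + B z y.
Proof. by move=> Ex Ey Ez; rewrite BC BD// !(BC z). Qed.

Let BZr c x y : E x -> E y -> B y (c *: x) = c * B y x.
Proof. by move=> Ex Ey; rewrite BC BZ// BC. Qed.

Let B_expand c x y : E x -> E y ->
  B (x + c *: y) (x + c *: y) = B x x + 2 * c * B x y + c ^+ 2 * B y y.
Proof.
move=> Ex Ey; have Ec := EZ c Ey.
by rewrite BD// ?BDr// ?BZ// ?BZr//; [rewrite (BC y x); ring|exact: ED].
Qed.

(** The form is only semi-definite and completeness only a property of sequences, so the lemma
    applies to functions rather than almost-everywhere classes. The projection y belongs to the
    closure of W. *)
Lemma orthogonal_projection (W : set V) (x : V) :
  W `<=` E -> W 0 -> (forall u v, W u -> W v -> W (u + v)) ->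
  (forall c u, W u -> W (c *: u)) -> E x ->
  exists y, [/\ E y, (forall e, 0 < e -> exists2 w, W w & B (w - y) (w - y) < e) &
    forall w, W w -> B (x - y) w = 0].
Proof.
move=> WE W0 WD WZ Ex.
pose S := [set B (x - w) (x - w) | w in W].
have S0 : S !=set0 by exists (B (x - 0) (x - 0)), 0.
have Slb : has_lbound S by exists 0 => _ [w Ww <-]; apply/B0/EB => //; exact: WE.
pose d := inf S.
have dle w : W w -> d <= B (x - w) (x - w) by move=> Ww; apply: ge_inf => //; exists w.
have [w hw] : {w : nat -> V & forall n, W (w n) /\ B (x - w n) (x - w n) < d + n.+1%:R^-1}.
  apply: (@choice _ _ (fun n w => W w /\ B (x - w) (x - w) < d + n.+1%:R^-1)) => n.
  have [|_ [w Ww <-] h] := @inf_adherent _ S n.+1%:R^-1 _ (conj S0 Slb).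
    by rewrite invr_gt0.
  by exists w.
have Ew n : E (w n) by apply: WE; have [] := hw n.
have small (e : R) : 0 < e -> exists N, forall n, (N <= n)%N -> n.+1%:R^-1 < e.
  move=> e0; exists (Num.truncn e^-1) => n Nn.
  rewrite invf_plt ?posrE// (lt_le_trans (truncnS_gt _))//.
  by rewrite ler_nat ltnS.
(* Parallelogram identity, with the midpoint of [w m] and [w n] as competitor for the infimum
   [d]. *)
have par m n : B (w m - w n) (w m - w n) < 2 * n.+1%:R^-1 + 2 * m.+1%:R^-1.
  have Em := EB Ex (Ew m); have En := EB Ex (Ew n).
  have Wmid : W (2^-1 *: (w m + w n)).
    by apply: WZ; apply: WD; [have [] := hw m|have [] := hw n].
  have := dle _ Wmid.
  have -> : x - 2^-1 *: (w m + w n) = (2^-1 *: (x - w m)) + 2^-1 *: (x - w n).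
    have xx : x = 2^-1 *: (x + x).
      by rewrite -[x + x]mulr2n -(scaler_nat 2 x) scalerA mulVf ?scale1r.
    by rewrite -scalerDr addrACA -opprD scalerBr -xx.
  have -> : w m - w n = (x - w n) + (-1) *: (x - w m).
    by rewrite scaleN1r opprB [RHS]addrC addrA subrK.
  rewrite !B_expand ?BZ ?BZr//; [|exact: EZ..].
  rewrite (BC (x - w n) (x - w m)).
  have [_ h1] := hw m; have [_ h2] := hw n.
  move: (B (x - w m) (x - w m)) (B (x - w n) (x - w n)) (B (x - w m) (x - w n)) h1 h2 => p q r h1 h2 h3.
  move: (m.+1%:R^-1) (n.+1%:R^-1) h1 h2 h3 => i j h1 h2 h3; lra.
have [|y Ey hy] := complete Ew.
  move=> e e0; have [|N hN] := small (e / 4); first by rewrite divr_gt0.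
  exists N => m n Nm Nn; rewrite (lt_trans (par m n))//.
  have := hN _ Nm; have := hN _ Nn; move: (m.+1%:R^-1) (n.+1%:R^-1) => i j; lra.
exists y; split=> //.
  move=> e e0; have [N hN] := hy _ e0; exists (w N); [by have [] := hw N|exact: hN].
move=> v Wv; have Ev := WE _ Wv.
(* As y need not lie in W, minimality is applied to [w n + t v], and the error e pays for replacing
   [w n] by y; the second term t^2 B v v comes from B (w n - y - t v) (w n - y - t v) >= 0. *)
have key (t e : R) : 0 < e -> 2 * t * B (x - y) v <= e + 2 * t ^+ 2 * B v v.
  move=> e0; have [|N1 hN1] := hy (e / 2); first by rewrite divr_gt0.
  have [|N2 hN2] := small (e / 2); first by rewrite divr_gt0.
  pose n := maxn N1 N2.
  have {}hN1 := hN1 n (leq_maxl _ _); have {}hN2 := hN2 n (leq_maxr _ _).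
  have Wn : W (w n) by have [] := hw n.
  have E1 := EB Ex (Ew n); have E2 := EB (Ew n) Ey.
  have -> : x - y = (x - w n) + (w n - y) by rewrite addrA subrK.
  rewrite BD//.
  have := dle (w n + t *: v) (WD _ _ Wn (WZ t _ Wv)).
  have -> : x - (w n + t *: v) = (x - w n) + (- t) *: v by rewrite opprD addrA scaleNr.
  have := B0 (ED E2 (EZ (- t) Ev)).
  rewrite !B_expand// sqrrN.
  have [_ h2] := hw n.
  move: (B v v) (B (x - w n) v) (B (w n - y) v) h2 hN1 hN2 => p q r.
  move: (B (x - w n) _) (B (w n - y) _) (n.+1%:R^-1) => s z i.
  lra.
(* The choice e = 2 t^2, for t and - t, followed by division by 2 t. *)
have bnd t : 0 < t -> `|B (x - y) v| <= t * B v v + t.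
  move=> t0; have t20 : 0 < 2 * t ^+ 2 by rewrite mulr_gt0 ?exprn_gt0.
  rewrite ler_norml; apply/andP; split.
    have := key (- t) _ t20; rewrite sqrrN => h.
    rewrite -(ler_pM2l (x := 2 * t)) ?mulr_gt0//; move: h; nra.
  have := key t _ t20 => h.
  by rewrite -(ler_pM2l (x := 2 * t)) ?mulr_gt0//; move: h; nra.
apply/eqP; rewrite -normr_eq0 eq_le normr_ge0 andbT leNgt; apply/negP => h.
have b1 : 0 < B v v + 1 by have := B0 Ev; lra.
have := bnd (`|B (x - y) v| / 2 / (B v v + 1)).
rewrite !divr_gt0// => /(_ isT).
have -> : `|B (x - y) v| / 2 / (B v v + 1) * B v v + `|B (x - y) v| / 2 / (B v v + 1) =
  `|B (x - y) v| / 2 by field; rewrite gt_eqF.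
lra.
Qed.

End projection.

Section square_integrable.
Context d (T : measurableType d) (R : realType) (mu : {measure set T -> \bar R}).
Implicit Types f g h : T -> R.

Definition sqint f := measurable_fun [set: T] f /\
  mu.-integrable [set: T] (EFin \o (fun x => f x ^+ 2)).

Definition dot f g : R := \int[mu]_x (f x * g x).

Lemma sqint_Lfun f : sqint f <-> f \in Lfun mu 2%:E.
Proof.
split; last first.
  move=> fL; split; last exact: Lfun2_integrable_sqr.
  by move: fL; rewrite inE => /andP[]; rewrite !inE.
move=> [mf fi]; rewrite inE; apply/andP; rewrite !inE/=; split=> //.
rewrite /finite_norm unlock poweR_lty//.
have := integrable_lty measurableT fi.
apply: le_lt_trans; rewrite le_eqVlt; apply/orP; left; apply/eqP.
apply: eq_integral => x _ /=; congr EFin.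
by rewrite powR_mulrn// real_normK ?num_real.
Qed.

Lemma sqint_mul f g : sqint f -> sqint g ->
  mu.-integrable [set: T] (EFin \o (fun x => f x * g x)).
Proof.
move=> [mf fi] [mg gi].
apply: (le_integrable measurableT _ _ (integrableD measurableT fi gi)).
  by apply/measurable_EFinP; exact: measurable_funM.
move=> x _ /=; rewrite lee_fin [leRHS]ger0_norm ?addr_ge0 ?sqr_ge0//.
rewrite normrM -[f x ^+ 2]real_normK ?num_real// -[g x ^+ 2]real_normK ?num_real//.
have := sqr_ge0 (`|f x| - `|g x|); have := mulr_ge0 (normr_ge0 (f x)) (normr_ge0 (g x)); nra.
Qed.

Lemma sqint0 : sqint (fun=> 0).
Proof.
split; first exact: measurable_cst.
by rewrite /comp; under eq_fun do rewrite expr0n/=; exact: integrable0.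
Qed.

Lemma sqintZ c f : sqint f -> sqint (fun x => c * f x).
Proof.
move=> [mf fi]; split; first exact: measurable_funM.
have := integrableZl measurableT (c ^+ 2) fi.
by apply: eq_integrable => // x _ /=; rewrite -EFinM exprMn.
Qed.

Lemma sqintD f g : sqint f -> sqint g -> sqint (fun x => f x + g x).
Proof.
move=> sf sg; have [mf fi] := sf; have [mg gi] := sg.
split; first exact: measurable_funD.
have fgi := sqint_mul sf sg.
have := integrableD measurableT (integrableD measurableT fi gi) (integrableZl measurableT 2 fgi).
by apply: eq_integrable => // x _ /=; rewrite -!EFinM -!EFinD; congr EFin; ring.
Qed.

Lemma sqintB f g : sqint f -> sqint g -> sqint (fun x => f x - g x).
Proof.
move=> sf sg; have := sqintD sf (sqintZ (-1) sg).
by under eq_fun do rewrite mulN1r.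
Qed.

Lemma dotC f g : dot f g = dot g f.
Proof. by apply: eq_Rintegral => x _; rewrite mulrC. Qed.

Lemma dotD f g h : sqint f -> sqint g -> sqint h ->
  dot (fun x => f x + g x) h = dot f h + dot g h.
Proof.
move=> sf sg sh; rewrite /dot -RintegralD//; [|exact: sqint_mul..].
by apply: eq_Rintegral => x _; rewrite mulrDl.
Qed.

Lemma dotZ c f g : sqint f -> sqint g -> dot (fun x => c * f x) g = c * dot f g.
Proof.
move=> sf sg; rewrite /dot -RintegralZl//; last exact: sqint_mul.
by apply: eq_Rintegral => x _; rewrite mulrA.
Qed.

Lemma dotB f g h : sqint f -> sqint g -> sqint h ->
  dot (fun x => f x - g x) h = dot f h - dot g h.
Proof.
move=> sf sg sh; rewrite -mulN1r -dotZ// -dotD//; last exact: sqintZ.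
by congr dot; apply/funext => x; rewrite mulN1r.
Qed.

Lemma dot_ge0 f : 0 <= dot f f.
Proof. by apply: Rintegral_ge0 => x _; rewrite -expr2 sqr_ge0. Qed.

Lemma dotE f : sqint f -> (\int[mu]_x (f x ^+ 2)%:E)%E = (dot f f)%:E.
Proof.
move=> [_ fi]; rewrite /dot /Rintegral fineK.
  by apply: eq_integral => x _; rewrite expr2.
have := integrable_fin_num measurableT fi.
by under [X in _ -> X \is a fin_num]eq_integral do rewrite -expr2.
Qed.

Lemma sqint_ae f g : measurable_fun [set: T] g -> {ae mu, forall x, f x = g x} ->
  sqint f -> sqint g.
Proof.
move=> mg fg [mf fi]; split=> //.
have mg2 : measurable_fun [set: T] (EFin \o (fun x => g x ^+ 2)).
  by apply/measurable_EFinP; exact: measurable_funX.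
apply/integrableP; split => //.
have -> : (\int[mu]_x `|(EFin \o (fun x => (g x ^+ 2)%R)) x|)%E =
    (\int[mu]_x `|(EFin \o (fun x => (f x ^+ 2)%R)) x|)%E.
  apply: ge0_ae_eq_integral => //.
  - exact: measurableT_comp.
  - by apply: measurableT_comp => //; apply/measurable_EFinP; exact: measurable_funX.
  - by apply: filterS fg => x fgx _ /=; rewrite fgx.
by case/integrableP: fi.
Qed.

Lemma dot_ae f f' g g' : sqint f -> sqint f' -> sqint g -> sqint g' ->
  {ae mu, forall x, f x = f' x} -> {ae mu, forall x, g x = g' x} -> dot f g = dot f' g'.
Proof.
move=> [mf _] [mf' _] [mg _] [mg' _] ff gg; congr fine; apply: ae_eq_integral => //.
- by apply/measurable_EFinP; exact: measurable_funM.
- by apply/measurable_EFinP; exact: measurable_funM.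
- by apply: filterS2 ff gg => x e1 e2 _ /=; rewrite e1 e2.
Qed.

Lemma dot_triangle f g : sqint f -> sqint g ->
  dot (fun x => f x + g x) (fun x => f x + g x) <= 2 * dot f f + 2 * dot g g.
Proof.
move=> sf sg; have := dot_ge0 (fun x => f x - g x).
rewrite dotB//; last exact: sqintB.
rewrite dotD//; last exact: sqintD.
rewrite !(dotC _ (fun x => f x + g x)) !(dotC _ (fun x => f x - g x)).
rewrite !dotB// !dotD// (dotC g f); lra.
Qed.

Lemma geometric_cvg (a : nat -> R) (C : R) :
  (forall k, `|a k.+1 - a k| <= C * 2^-1 ^+ k) -> cvgn a.
Proof.
move=> ha.
(* The remainder of the geometric series from k on: a + z is nonincreasing and a - z
   nondecreasing. *)
pose z k := 2 * C * 2^-1 ^+ k.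
have C0 : 0 <= C by have := ha 0%N; rewrite expr0 mulr1; exact: le_trans.
have z0 k : 0 <= z k by rewrite !mulr_ge0 ?exprn_ge0.
have cz : z @ \oo --> (0 : R).
  by apply: cvg_geometric; rewrite ger0_norm// invf_lt1// ltr1n.
have zS k : z k - z k.+1 = C * 2^-1 ^+ k by rewrite /z exprS; field.
have cb : cvgn (fun k => a k + z k).
  apply: nonincreasing_is_cvgn.
    apply/nonincreasing_seqP => k; have := ha k; rewrite -zS ler_norml => /andP[_]; lra.
  exists (a 0%N - z 0%N) => _ [k _ <-].
  apply: (@le_trans _ _ (a k - z k)); last by have := z0 k; lra.
  elim: k => [//|k IH]; apply: (le_trans IH).
  by have := ha k; rewrite -zS ler_norml => /andP[+ _]; lra.
have -> : a = (fun k => (a k + z k) - z k) by apply/funext => k; rewrite addrK.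
by apply: is_cvgB => //; apply/cvg_ex; exists 0.
Qed.

End square_integrable.

(** * Completeness of the square integrable functions *)

Section riesz_fischer.
Context d (T : measurableType d) (R : realType) (mu : {measure set T -> \bar R}).
Implicit Types f g h : T -> R.
Let nrm f := dot mu f f.

Lemma fatou_dot (w : nat -> T -> R) (u : T -> R) (e : R) :
  (forall n, sqint mu (w n)) -> (forall x, w n x @[n --> \oo] --> u x) ->
  (\forall n \near \oo, nrm (w n) <= e) -> sqint mu u /\ nrm u <= e.
Proof.
move=> sw cw we.
have mw n : measurable_fun [set: T] (w n) by have [] := sw n.
have mu_ : measurable_fun [set: T] u.
  by apply: (measurable_fun_cvg (h := w)) => // x _; exact: cw.
pose F n x := (w n x ^+ 2)%:E.
have mF n : measurable_fun [set: T] (F n).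
  by apply/measurable_EFinP; exact: measurable_funX.
have F0 n x : [set: T] x -> (0 <= F n x)%E by move=> _; rewrite lee_fin sqr_ge0.
have := fatou mu measurableT mF F0.
have -> : (\int[mu]_x limn_einf (F^~ x) = \int[mu]_x (u x ^+ 2)%:E)%E.
  apply: eq_integral => x _; apply: (@cvg_limn_einf_sup _ (F^~ x) (u x ^+ 2)%:E _).1.
  have c : (fun n => w n x ^+ 2) @ \oo --> u x ^+ 2.
    by rewrite expr2; under eq_fun do rewrite expr2; apply: cvgM; exact: cw.
  by apply: cvg_EFin; [exact: nearW|exact: c].
have -> : (fun n => (\int[mu]_x F n x)%E) = (fun n => (nrm (w n))%:E).
  by apply/funext => n; rewrite dotE.
move=> h; have {h} le_e : (\int[mu]_x (u x ^+ 2)%:E <= e%:E)%E.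
  apply: (le_trans h); rewrite limn_einf_lim; apply: lime_le; first exact: is_cvg_einfs.
  apply: filterS we => n hn.
  have h1 : (einfs (fun n => (nrm (w n))%:E) n <= (nrm (w n))%:E)%E.
    by apply: ereal_inf_lbound; exists n => /=.
  by apply: le_trans h1 _; rewrite lee_fin.
have su : sqint mu u.
  split=> //; apply/integrableP; split.
    by apply/measurable_EFinP; exact: measurable_funX.
  apply: le_lt_trans (ltry e); apply: le_trans le_e.
  rewrite le_eqVlt; apply/orP; left; apply/eqP; apply: eq_integral => x _.
  by rewrite gee0_abs// lee_fin sqr_ge0.
by split=> //; move: le_e; rewrite dotE// lee_fin.
Qed.

(** The sum of 4^k |v_(k+1) - v_k|^2 has integral at most the sum of 4^k 8^-k, which is 2. It is
    therefore finite almost everywhere, and there the increments are O(2^-k), so v converges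
    pointwise. Fatou's lemma then gives the rate in norm. *)
Lemma fast_cauchy_cvg (v : nat -> T -> R) :
  (forall n, sqint mu (v n)) ->
  (forall k j, (k <= j)%N -> nrm (fun x => v j x - v k x) <= 8^-1 ^+ k) ->
  exists2 u, sqint mu u & forall k, nrm (fun x => v k x - u x) <= 8^-1 ^+ k.
Proof.
move=> sv hv.
have mv n : measurable_fun [set: T] (v n) by have [] := sv n.
pose g k x := (4 ^+ k * (v k.+1 x - v k x) ^+ 2)%:E.
have mg k : measurable_fun [set: T] (g k).
  apply/measurable_EFinP; apply: measurable_funM => //.
  by apply: measurable_funX; exact: measurable_funB.
have g0 k x : (0 <= g k x)%E by rewrite lee_fin; apply: mulr_ge0; [exact: exprn_ge0|exact: sqr_ge0].
pose S x := (\sum_(0 <= k <oo) g k x)%E.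
have mS : measurable_fun [set: T] S.
  by apply: (ge0_emeasurable_sum (P := predT)) => [k x _ _|k _] //; exact: mg.
have S0 x : (0 <= S x)%E by apply: nneseries_ge0.
have intS : (\int[mu]_x S x <= 2%:E)%E.
  rewrite integral_nneseries//; apply: lime_le.
    by apply: is_cvg_nneseries => k _ _; exact: integral_ge0.
  apply: nearW => n.
  have : (\sum_(0 <= k < n) \int[mu]_x g k x <= (2 - 2 * 2^-1 ^+ n)%:E)%E.
    elim: n => [|n IH]; first by rewrite big_geq// expr0 mulr1 subrr.
    rewrite big_nat_recr//=.
    have -> : (2 - 2 * 2^-1 ^+ n.+1 = (2 - 2 * 2^-1 ^+ n) + 2^-1 ^+ n :> R) by rewrite exprS; field.
    rewrite EFinD; apply: leeD => //.
    have -> : (\int[mu]_x g n x = (4 ^+ n)%:E * \int[mu]_x ((v n.+1 x - v n x) ^+ 2)%:E)%E.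
      rewrite -ge0_integralZl_EFin//.
      - by move=> x _; rewrite lee_fin sqr_ge0.
      - by apply/measurable_EFinP; apply: measurable_funX; exact: measurable_funB.
    rewrite dotE; last exact: sqintB.
    rewrite -EFinM lee_fin.
    have -> : 2^-1 ^+ n = 4 ^+ n * 8^-1 ^+ n :> R.
      by rewrite -exprMn; congr (_ ^+ _); field.
    by rewrite ler_wpM2l ?exprn_ge0// hv.
  move/le_trans; apply; rewrite lee_fin gerBl mulr_ge0// exprn_ge0//.
have iS : mu.-integrable [set: T] S.
  apply/integrableP; split => //.
  apply: le_lt_trans (ltry 2); apply: le_trans intS.
  by rewrite le_eqVlt; apply/orP; left; apply/eqP; apply: eq_integral => x _; rewrite gee0_abs.
pose A := [set x | (S x < +oo)%E].
have mA : measurable A.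
  rewrite -[A]setTI; apply: measurable_lte => //.
have aeA : {ae mu, forall x, A x}.
  have := integrable_ae measurableT iS; apply: filterS => x /(_ I).
  by rewrite /A/= ge0_fin_numE.
(* Setting the functions to 0 off A makes the sequence converge at every point, so the limit is
   measurable. *)
pose w k x := v k x * \1_A x.
have mw k : measurable_fun [set: T] (w k).
  by apply: measurable_funM => //; exact: measurable_indic.
have wv k : {ae mu, forall x, v k x = w k x}.
  by apply: filterS aeA => x Ax; rewrite /w indicE mem_set// mulr1.
have sw k : sqint mu (w k) by exact: sqint_ae (mw k) (wv k) (sv k).
have cw x : cvgn (w ^~ x).
  rewrite /w indicE; have [Ax|nAx] := pselect (A x); last first.
    rewrite memNset//=; under eq_fun do rewrite mulr0.
    exact: is_cvg_cst.
  rewrite mem_set//=; under eq_fun do rewrite mulr1.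
  have Sfin : S x \is a fin_num by rewrite ge0_fin_numE.
  pose C := fine (S x).
  have C0 : 0 <= C by rewrite fine_ge0.
  (* The estimate C <= (C + 1)^2 avoids a square root. *)
  apply: (@geometric_cvg _ _ (C + 1)) => k.
  have : 4 ^+ k * (v k.+1 x - v k x) ^+ 2 <= C.
    rewrite -lee_fin fineK//.
    apply: le_trans (nneseries_lim_ge k.+1 _) => //.
    rewrite big_nat_recr//= leeDr// sume_ge0// => i _.
  move=> h.
  rewrite -(ler_pXn2r (n := 2))// ?nnegrE ?mulr_ge0 ?addr_ge0 ?exprn_ge0//.
  rewrite real_normK ?num_real// exprMn -exprM mulnC exprM.
  have -> : 2^-1 ^+ 2 = 4^-1 :> R by field.
  rewrite exprVn ler_pdivlMr ?exprn_gt0// mulrC (le_trans h)//.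
  by nra.
pose u x := limn (w ^~ x).
have cu x : w n x @[n --> \oo] --> u x by exact: cw.
have main k : sqint mu (fun x => w k x - u x) /\ nrm (fun x => w k x - u x) <= 8^-1 ^+ k.
  apply: (@fatou_dot (fun n x => w k x - w n x)).
  - by move=> n; exact: sqintB.
  - by move=> x; apply: cvgB; [exact: cvg_cst|exact: cu].
  - near=> n.
    have kn : (k <= n)%N by near: n; exists k.
    apply: le_trans (hv k n kn); rewrite le_eqVlt; apply/orP; left; apply/eqP.
    have e : {ae mu, forall x, w k x - w n x = -1 * (v n x - v k x)}.
      by apply: filterS2 (wv k) (wv n) => x e1 e2; rewrite e1 e2 mulN1r opprB.
    have s1 := sqintB (sw k) (sw n); have s2 := sqintB (sv n) (sv k).
    rewrite /nrm (dot_ae s1 (sqintZ (-1) s2) s1 (sqintZ (-1) s2) e e).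
    rewrite dotZ// ?(dotC mu (fun x => v n x - v k x)) ?dotZ//; [ring|exact: sqintZ].
have su : sqint mu u.
  have [s _] := main 0%N; have := sqintB (sw 0%N) s.
  by under eq_fun do rewrite opprB addrC subrK.
exists u => // k; have [s1 le1] := main k.
apply: le_trans le1; rewrite le_eqVlt; apply/orP; left; apply/eqP.
have e : {ae mu, forall x, v k x - u x = w k x - u x}.
  by apply: filterS (wv k) => x ->.
by have s2 := sqintB (sv k) su; exact: dot_ae.
Unshelve. all: by end_near. Qed.

Lemma riesz_fischer (v : nat -> T -> R) : (forall n, sqint mu (v n)) ->
  (forall e, 0 < e -> exists N, forall m n, (N <= m)%N -> (N <= n)%N ->
     nrm (fun x => v m x - v n x) < e) ->
  exists2 u, sqint mu u & forall e, 0 < e -> exists N, forall n, (N <= n)%N ->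
     nrm (fun x => v n x - u x) < e.
Proof.
move=> sv hv.
have [p hp] : {p : nat -> nat & forall k m n, (p k <= m)%N -> (p k <= n)%N ->
     nrm (fun x => v m x - v n x) < 8^-1 ^+ k}.
  apply: (@choice _ _ (fun k N => forall m n, (N <= m)%N -> (N <= n)%N ->
     nrm (fun x => v m x - v n x) < 8^-1 ^+ k)) => k.
  by apply: hv; rewrite exprn_gt0// invr_gt0.
(* The sum dominates all [p i] with i <= k, so the subsequence satisfies every earlier Cauchy
   condition. *)
pose q k := (\sum_(i < k.+1) p i)%N.
have pq k j : (k <= j)%N -> (p k <= q j)%N.
  by move=> kj; rewrite /q (bigD1 (Ordinal (kj : (k < j.+1)%N)))//= leq_addr.
have [|k j kj|u su hu] := @fast_cauchy_cvg (fun k => v (q k)).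
- by move=> n; exact: sv.
- by apply/ltW/hp; exact: pq.
exists u => // e e0.
have [k hk] : exists k, 8^-1 ^+ k < e / 4.
  have : 8^-1 ^+ k @[k --> \oo] --> (0 : R).
    rewrite exprn_geometric; apply: cvg_geometric.
    by rewrite ger0_norm// invf_lt1// ltr1n.
  move/cvgrPdist_lt => /(_ (e / 4)).
  rewrite divr_gt0// => /(_ isT)[k _ /(_ k (leqnn k))].
  rewrite sub0r normrN ger0_norm ?exprn_ge0// => h.
  by exists k.
exists (p k) => n pn.
have := dot_triangle (sqintB (sv n) (sv (q k))) (sqintB (sv (q k)) su).
have -> : (fun x => v n x - v (q k) x + (v (q k) x - u x)) = (fun x => v n x - u x).
  by apply/funext => x; rewrite addrA subrK.
have := hp k n (q k) pn (pq k k (leqnn k)); have := hu k.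
rewrite /nrm => h1 h2 h3; apply: (le_lt_trans h3); lra.
Qed.

End riesz_fischer.

Section pair_projection.
Context d (T : measurableType d) (R : realType) (mu : {measure set T -> \bar R}).
Local Notation dot := (dot mu).
Local Notation sqint := (sqint mu).

Definition sqnorm (f : T -> R) : R := dot f f.

(** Projection in the graph space, the orthogonal sum of two copies of L^2; [W] plays the role of a
    graph. *)
Lemma pair_projection (W : (T -> R) -> (T -> R) -> Prop) (x1 x2 : T -> R) :
  (forall u v, W u v -> sqint u /\ sqint v) -> W (fun=> 0) (fun=> 0) ->
  (forall u v u' v', W u v -> W u' v' ->
     W (fun x => u x + u' x) (fun x => v x + v' x)) ->
  (forall c u v, W u v -> W (fun x => c * u x) (fun x => c * v x)) ->
  sqint x1 -> sqint x2 ->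
  exists y1 y2, [/\ sqint y1, sqint y2,
    forall e, 0 < e -> exists w1 w2, [/\ W w1 w2,
      sqnorm (fun x => w1 x - y1 x) < e & sqnorm (fun x => w2 x - y2 x) < e] &
    forall w1 w2, W w1 w2 ->
      dot (fun x => x1 x - y1 x) w1 + dot (fun x => x2 x - y2 x) w2 = 0].
Proof.
move=> WE W0 WD WZ sx1 sx2.
pose V := ((T -> R) * (T -> R))%type.
pose E : set V := [set p | sqint p.1 /\ sqint p.2].
pose B (p q : V) : R := dot p.1 q.1 + dot p.2 q.2.
have ED p q : E p -> E q -> E (p + q) by move=> [? ?] [? ?]; split; exact: sqintD.
have EZ c p : E p -> E (c *: p) by move=> [? ?]; split; exact: sqintZ.
have BC p q : B p q = B q p by rewrite /B dotC (dotC mu p.2).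
have BD p q r : E p -> E q -> E r -> B (p + q) r = B p r + B q r.
  by move=> [? ?] [? ?] [? ?]; rewrite /B !dotD//; ring.
have BZ c p q : E p -> E q -> B (c *: p) q = c * B p q.
  by move=> [? ?] [? ?]; rewrite /B !dotZ//; ring.
have B0 p : E p -> 0 <= B p p by move=> _; rewrite addr_ge0 ?dot_ge0.
have cpl (u : nat -> V) : (forall n, E (u n)) ->
  (forall e, 0 < e -> exists N, forall m n, (N <= m)%N -> (N <= n)%N ->
     B (u m - u n) (u m - u n) < e) ->
  exists2 y, E y & forall e, 0 < e -> exists N, forall n, (N <= n)%N ->
     B (u n - y) (u n - y) < e.
  move=> Eu cu.
  have [||y1 sy1 h1] := @riesz_fischer _ T R mu (fun n => (u n).1).
  - by move=> n; have [] := Eu n.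
  - move=> e e0; have [N hN] := cu e e0; exists N => m n Nm Nn.
    by apply: le_lt_trans (hN m n Nm Nn); rewrite lerDl dot_ge0.
  have [||y2 sy2 h2] := @riesz_fischer _ T R mu (fun n => (u n).2).
  - by move=> n; have [] := Eu n.
  - move=> e e0; have [N hN] := cu e e0; exists N => m n Nm Nn.
    by apply: le_lt_trans (hN m n Nm Nn); rewrite lerDr dot_ge0.
  exists (y1, y2) => // e e0.
  have e20 : 0 < e / 2 by rewrite divr_gt0.
  have [N1 hN1] := h1 _ e20; have [N2 hN2] := h2 _ e20.
  exists (maxn N1 N2) => n; rewrite geq_max => /andP[n1 n2].
  by rewrite (splitr e); apply: ltrD; [exact: hN1|exact: hN2].
have [|||||[y1 y2] [[sy1 sy2] h1 h2]] := @orthogonal_projection R V E B ED EZ BC BD BZ B0 cpl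
  [set p | W p.1 p.2] (x1, x2).
- by move=> p /WE.
- exact: W0.
- by move=> p q; exact: WD.
- by move=> c p; exact: WZ.
- by [].
exists y1, y2; split=> //.
- move=> e e0; have [w Ww hw] := h1 e e0; exists w.1, w.2; split=> //.
    by apply: le_lt_trans hw; rewrite lerDl dot_ge0.
  by apply: le_lt_trans hw; rewrite lerDr dot_ge0.
- by move=> w1 w2 Ww; exact: (h2 (w1, w2)).
Qed.

End pair_projection.

(** * Weak solutions *)

Section interval_integrals.
Context {R : realType}.
Local Notation mu := (@lebesgue_measure R).
Implicit Types (f g h : R -> R) (a b c r : R).

Definition int_on a b h : R := \int[mu]_(x in `[a, b]) h x.
Definition integrable_on a b h := mu.-integrable `[a, b] (EFin \o h).

Lemma within_continuous_integrable_on a b f : {within `[a, b], continuous f} -> integrable_on a b f.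
Proof. by move=> cf; apply: continuous_compact_integrable => //; exact: segment_compact. Qed.

Lemma within_continuous_bounded a b f : {within `[a, b], continuous f} ->
  exists2 M, 0 <= M & forall x, a <= x <= b -> `|f x| <= M.
Proof.
move=> cf; have [ab|ba] := leP a b; last first.
  by exists 0 => // x /andP[h1 h2]; have := le_trans h1 h2; rewrite leNgt ba.
have cn : {within `[a, b], continuous (fun x => `|f x|)}.
  move=> x; apply: (@continuous_comp _ _ _ (f : subspace `[a, b] -> R) (fun y => `|y|)).
    exact: cf.
  exact: norm_continuous.
have [c _ hc] := EVT_max ab cn.
exists `|f c| => // x h; apply: hc.
Qed.

Lemma integrable_on_mul a b f h : {within `[a, b], continuous f} ->
  integrable_on a b h -> integrable_on a b (fun x => f x * h x).
Proof.
move=> cf ih; have [M M0 hM] := within_continuous_bounded cf.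
have mf : measurable_fun `[a, b] f by exact: subspace_continuous_measurable_fun.
have := @integrableMr _ _ _ mu `[a, b]%classic (measurable_itv _) f (EFin \o h) mf _ ih.
apply; exists M; split; first exact: num_real.
move=> M' MM' x /=; rewrite in_itv/= => /hM; move=> /le_trans; apply; exact: ltW.
Qed.

Lemma integrable_onW a b c r h : a <= c -> r <= b -> integrable_on a b h -> integrable_on c r h.
Proof.
move=> ac rb; rewrite /integrable_on.
apply: (@integrableS _ _ _ mu `[a, b]%classic `[c, r]%classic (EFin \o h)).
- exact: measurable_itv.
- exact: measurable_itv.
by move=> x /=; rewrite !in_itv/= => /andP[h1 h2]; rewrite (le_trans ac) ?(le_trans h2).
Qed.

Lemma int_onD a b f g : integrable_on a b f -> integrable_on a b g ->
  int_on a b (fun x => f x + g x) = int_on a b f + int_on a b g.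
Proof. by move=> ? ?; rewrite /int_on RintegralD//; exact: measurable_itv. Qed.

Lemma int_onB a b f g : integrable_on a b f -> integrable_on a b g ->
  int_on a b (fun x => f x - g x) = int_on a b f - int_on a b g.
Proof. by move=> ? ?; rewrite /int_on RintegralB//; exact: measurable_itv. Qed.

Lemma int_onZ a b k f : integrable_on a b f ->
  int_on a b (fun x => k * f x) = k * int_on a b f.
Proof. by move=> ?; rewrite /int_on RintegralZl//; exact: measurable_itv. Qed.

Lemma integrable_onD a b f g : integrable_on a b f -> integrable_on a b g ->
  integrable_on a b (fun x => f x + g x).
Proof.
move=> hf hg; rewrite /integrable_on.
exact: (@integrableD _ _ _ mu `[a, b]%classic (measurable_itv _) (EFin \o f) (EFin \o g) hf hg).
Qed.

Lemma integrable_onB a b f g : integrable_on a b f -> integrable_on a b g ->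
  integrable_on a b (fun x => f x - g x).
Proof.
move=> hf hg; rewrite /integrable_on.
exact: (@integrableB _ _ _ mu `[a, b]%classic (measurable_itv _) (EFin \o f) (EFin \o g) hf hg).
Qed.

Lemma integrable_onZ a b k f : integrable_on a b f -> integrable_on a b (fun x => k * f x).
Proof.
move=> hf; rewrite /integrable_on.
exact: (@integrableZl _ _ _ mu `[a, b]%classic (measurable_itv _) k (EFin \o f) hf).
Qed.

Lemma integrable_on_norm a b f : integrable_on a b f -> integrable_on a b (fun x => `|f x|).
Proof. by move=> hf; rewrite /integrable_on; exact: (integrable_norm hf). Qed.

Lemma eq_int_on a b f g : (forall x, a <= x <= b -> f x = g x) -> int_on a b f = int_on a b g.
Proof. by move=> fg; apply: eq_Rintegral => x; rewrite inE/= in_itv/=; exact: fg. Qed.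

Lemma int_on_le a b f g : integrable_on a b f -> integrable_on a b g ->
  (forall x, a <= x <= b -> f x <= g x) -> int_on a b f <= int_on a b g.
Proof.
by move=> hf hg fg; apply: le_Rintegral.
Qed.

Lemma int_on_abs_le a b f : integrable_on a b f -> `|int_on a b f| <= int_on a b (fun x => `|f x|).
Proof. by move=> hf; apply: le_normr_Rintegral => //; exact: measurable_itv. Qed.

Lemma integrable_on_cst a b k : integrable_on a b (fun=> k).
Proof. by apply: within_continuous_integrable_on; apply: continuous_subspaceT => x; exact: cst_continuous. Qed.

Lemma int_on_cst a b k : a <= b -> int_on a b (fun=> k) = k * (b - a).
Proof.
move=> ab; rewrite /int_on Rintegral_cst//=.
by rewrite lebesgue_measure_itv/= lte_fin; case: ltgtP ab => // -> _; rewrite subrr.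
Qed.

Lemma int_on_split a b c h : a <= c -> c <= b -> integrable_on a b h ->
  int_on a b h - int_on a c h = int_on c b h.
Proof.
move=> ac cb hi; rewrite /int_on Rintegral_itvB//.
rewrite Rintegral_itv_obnd_cbnd//.
apply: (@integrableS _ _ _ mu `[a, b]%classic `]c, b]%classic (EFin \o h)) => //.
by move=> x /=; rewrite !in_itv/= => /andP[h1 h2]; rewrite h2 (le_trans ac)// ltW.
Qed.

Lemma int_on_point a h : int_on a a h = 0.
Proof. by rewrite /int_on set_itv1 Rintegral_set1. Qed.

Lemma int_on_subint_le a b c r h : a <= c -> r <= b -> integrable_on a b h ->
  (forall x, 0 <= h x) -> int_on c r h <= int_on a b h.
Proof.
move=> ac rb hi h0; have hi' := integrable_onW ac rb hi.
rewrite /int_on /Rintegral fine_le//.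
- by apply: integrable_fin_num => //; exact: measurable_itv.
- by apply: integrable_fin_num => //; exact: measurable_itv.
apply: ge0_subset_integral => //.
- by case/integrableP: hi.
- by move=> x _; rewrite lee_fin.
- by move=> x /=; rewrite !in_itv/= => /andP[h1 h2]; rewrite (le_trans ac)// (le_trans h2).
Qed.

Lemma within_continuous a b f : (forall x, a <= x <= b -> {for x, continuous f}) ->
  {within `[a, b], continuous f}.
Proof.
move=> cf; apply: continuous_in_subspaceT => x; rewrite inE/= in_itv/=; exact: cf.
Qed.

Lemma int_on_derive a b f x : a < x -> x < b -> integrable_on a b f -> {for x, continuous f} ->
  is_derive x 1 (fun y => int_on a y f) (f x).
Proof.
move=> ax xb fi cf.
have [] := @continuous_FTC1_closed R f a x b xb fi ax cf.
by move=> h1 h2; rewrite -h2; exact: derivable_is_derive1.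
Qed.

Lemma fundamental_int_on a b f F : a <= b ->
  (forall x, a <= x <= b -> is_derive x 1 F (f x)) ->
  (forall x, a <= x <= b -> {for x, continuous f}) ->
  int_on a b f = F b - F a.
Proof.
rewrite le_eqVlt => /predU1P[<-|ab] dF cf; first by rewrite int_on_point subrr.
have cF x : a <= x <= b -> {for x, continuous F}.
  by move=> h; exact: is_derive1_continuous (dF x h).
have aab : a <= a <= b by rewrite lexx ltW.
have bab : a <= b <= b by rewrite lexx ltW.
rewrite /int_on /Rintegral (@continuous_FTC2 R f F a b ab)//.
- exact: within_continuous.
- split.
  + by move=> x; rewrite in_itv/= => /andP[h1 h2]; apply: is_derive1_derivable (dF x _); rewrite !ltW.
  + by apply: cvg_at_right_filter; exact: cF.
  + by apply: cvg_at_left_filter; exact: cF.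
- by move=> x; rewrite in_itv/= => /andP[h1 h2]; apply: is_derive1_derive1 (dF x _); rewrite !ltW.
Qed.

End interval_integrals.

(** * Primitives and integration by parts for locally integrable functions *)

Section weak_derivative.
Context {R : realType}.
Local Notation mu := (@lebesgue_measure R).
Implicit Types (f g h phi : R -> R) (a b c r x : R).

Definition locint h := forall a b, 0 < a -> integrable_on a b h.

Definition contpos f := forall x, 0 < x -> {for x, continuous f}.

(** The signed integral from 1 to r: one of the two terms is taken over an empty interval or a
    point. *)
Definition J h r : R := int_on 1 r h - int_on r 1 h.

Definition pairing phi h : R := \int[mu]_(x in `]0, +oo[) (phi x * h x).

Lemma pairingE a b phi h : 0 < a -> vanishes_outside a b phi ->
  pairing phi h = int_on a b (fun x => phi x * h x).
Proof.
move=> a0 hphi; rewrite /pairing /int_on Rintegral_mkcond [RHS]Rintegral_mkcond.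
apply: eq_Rintegral => x _; rewrite /patch; have [xab|xab] := boolP (a <= x <= b).
  have x0 : 0 < x by case/andP: xab => ax _; exact: lt_le_trans ax.
  by rewrite !mem_set//= in_itv/= ?x0 ?xab.
rewrite [in RHS]memNset/= ?in_itv/=; last exact/negP.
rewrite hphi ?mul0r ?if_same//; move: xab; rewrite negb_and -!ltNge.
by move=> /orP[/ltW ->|/ltW ->]; rewrite ?orbT.
Qed.

(** A base point to the left of both 1 and r removes the case distinction in [J]. *)
Lemma J_base a r h : locint h -> 0 < a -> a <= 1 -> a <= r -> J h r = int_on a r h - int_on a 1 h.
Proof.
move=> hi a0 a1 ar; rewrite /J; have [r1|/ltW r1] := leP 1 r.
  rewrite -(int_on_split a1 r1 (hi _ _ a0)) [X in _ - X](_ : _ = 0) ?subr0//.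
  move: r1; rewrite le_eqVlt => /predU1P[<-|r1]; first exact: int_on_point.
  by rewrite /int_on set_itv_ge ?Rintegral_set0// bnd_simp -ltNge.
rewrite -(int_on_split ar r1 (hi _ _ a0)) [X in X - _](_ : _ = 0) ?sub0r ?opprB//.
move: r1; rewrite le_eqVlt => /predU1P[->|r1]; first exact: int_on_point.
by rewrite /int_on set_itv_ge ?Rintegral_set0// bnd_simp -ltNge.
Qed.

Lemma J_near r h : locint h -> 0 < r -> exists a b k,
  [/\ 0 < a, a < r, r < b & \near r, J h r = int_on a r h + k].
Proof.
move=> hi r0; pose a := Order.min (r / 2) 1.
have a0 : 0 < a by rewrite lt_min divr_gt0/=.
have ar : a < r by rewrite gt_min ltr_pdivrMr// ltr_pMr// ltr1n.
exists a, (r + 1), (- int_on a 1 h); split=> //; first by rewrite ltrDl.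
near=> x; apply: J_base => //; first by rewrite ge_min lexx orbT.
by apply/ltW; near: x; exact: lt_nbhsr.
Unshelve. all: by end_near. Qed.

Lemma contpos_within f a b : contpos f -> 0 < a -> {within `[a, b], continuous f}.
Proof. by move=> cf a0; apply: within_continuous => x /andP[ax _]; apply: cf; rewrite (lt_le_trans a0). Qed.

Lemma contpos_locint h : contpos h -> locint h.
Proof. by move=> ch a b a0; apply: within_continuous_integrable_on; exact: contpos_within. Qed.

Lemma locintM f h : contpos f -> locint h -> locint (fun x => f x * h x).
Proof. by move=> cf hi a b a0; apply: integrable_on_mul; [exact: contpos_within|exact: hi]. Qed.

Lemma contpos_J h : locint h -> contpos (J h).
Proof.
move=> hi r r0; have [a [b [k [a0 ar rb ne]]]] := J_near hi r0.
have ab := lt_trans ar rb.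
have : {within `[a, b], continuous (fun x => int_on a x h)}.
  by apply: parameterized_integral_continuous; [exact: ltW|exact: hi].
move/(continuous_within_itvP _ ab) => [+ _ _] => /(_ r).
rewrite in_itv/= ar rb => /(_ isT) c.
have c' : {for r, continuous (fun x => int_on a x h + k)}.
  by apply: cvgD => //; exact: cvg_cst.
have e : J h r = int_on a r h + k by exact: (nbhs_singleton ne).
change (J h x @[x --> r] --> J h r); rewrite e.
by apply: cvg_trans c'; apply: near_eq_cvg; apply: filterS ne => x ->.
Qed.

Lemma J_is_derive h r : contpos h -> 0 < r -> is_derive r 1 (J h) (h r).
Proof.
move=> ch r0; have hi := contpos_locint ch.
have [a [b [k [a0 ar rb ne]]]] := J_near hi r0.
apply: (is_derive1_unique_near ne).
have d := int_on_derive ar rb (hi _ _ a0) (ch _ r0).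
by have := is_derive1_add d (is_derive1_cst k r); rewrite addr0.
Qed.

Lemma continuous_approximation a b h e : integrable_on a b h -> 0 < e ->
  exists g, (forall x, {for x, continuous g}) /\ int_on a b (fun x => `|h x - g x|) < e.
Proof.
move=> hi e0.
have fin : (mu `[a, b]%classic < +oo)%E by rewrite lebesgue_measure_itv/=; case: ifP => // _; exact: ltry.
have [g [cg ig]] := approximation_continuous_integrable (measurable_itv _) fin hi.
move/fine_cvgP => [_ /cvgrPdist_lt /(_ e e0)] [n _ /(_ n (leqnn n))].
rewrite /= sub0r normrN => h1; exists (g n); split; first exact: cg.
by apply: le_lt_trans h1; rewrite ler_norm.
Qed.

Lemma test_continuous phi x : test phi -> {for x, continuous phi}.
Proof. by move=> [sp _]; exact: is_derive1_continuous (smooth_is_derive x sp). Qed.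

Let XE_algebra (A B C D : R) : A + B - (C + D) = A - C + (B - D).
Proof. by rewrite opprD addrACA. Qed.

(** The product rule needs a continuous integrand, so h is approximated by continuous g in L^1 on
    the support. For g the identity is exact, and both sides change by at most a constant times the
    L^1 distance. *)
Lemma pairing_J phi h : test phi -> locint h ->
  pairing phi h = - pairing (phi^`()%classic) (J h).
Proof.
move=> tphi hi.
have tphi' := test_derive1 tphi.
have [a0 [b0 [a00 ab0 v1 v2]]] := test2 tphi tphi'.
pose a := Order.min a0 1; pose b := Order.max b0 1.
have a1 : a <= 1 by rewrite ge_min lexx orbT.
have a_gt0 : 0 < a by rewrite lt_min a00 ltr01.
have ab : a < b by rewrite gt_min lt_max ab0.
have w1 : vanishes_outside a b phi by apply: vanishes_outsideW v1; rewrite ?ge_min ?le_max ?lexx.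
have w2 : vanishes_outside a b (phi^`()%classic).
  by apply: vanishes_outsideW v2; rewrite ?ge_min ?le_max ?lexx.
rewrite (pairingE _ a_gt0 w1) (pairingE _ a_gt0 w2).
set phi' := phi^`()%classic.
pose K x := int_on a x h.
have dphi x : is_derive x 1 phi (phi' x) by apply: smooth_is_derive; case: tphi.
have cphi c d : {within `[c, d], continuous phi}.
  by apply: within_continuous => x _; exact: test_continuous.
have cphi' c d : {within `[c, d], continuous phi'}.
  by apply: within_continuous => x _; exact: test_continuous.
have iphi' : integrable_on a b phi' by exact: within_continuous_integrable_on.
have iab := hi a b a_gt0.
have phi'0 : int_on a b phi' = 0.
  rewrite (fundamental_int_on (ltW ab) (fun x _ => dphi x)); last by move=> x _; exact: test_continuous.
  by rewrite !w1 ?lexx ?orbT// subrr.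
have cK h' : integrable_on a b h' -> {within `[a, b], continuous (fun x => int_on a x h')}.
  by move=> ih; apply: parameterized_integral_continuous => //; exact: ltW.
have iK h' : integrable_on a b h' -> integrable_on a b (fun x => phi' x * int_on a x h').
  move=> ih; apply: integrable_on_mul => //.
  by apply: within_continuous_integrable_on; exact: cK.
(* [J h] and [K] differ by a constant, which the mean-zero function phi' annihilates. *)
have EJ : int_on a b (fun x => phi' x * J h x) = int_on a b (fun x => phi' x * K x).
  rewrite (@eq_int_on _ _ _ _ (fun x => phi' x * K x - int_on a 1 h * phi' x)); last first.
    by move=> x /andP[ax _]; rewrite (J_base hi a_gt0 a1 ax) /K; ring.
  rewrite int_onB; [|exact: iK|exact: integrable_onZ].
  by rewrite int_onZ// phi'0 mulr0 subr0.
rewrite EJ.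
have [M M0 hM] := within_continuous_bounded (cphi a b).
have [M' M'0 hM'] := within_continuous_bounded (cphi' a b).
pose X := int_on a b (fun x => phi x * h x) + int_on a b (fun x => phi' x * K x).
suff : X = 0 by rewrite /X => /eqP; rewrite addr_eq0 => /eqP.
have bound e : 0 < e -> `|X| <= (M + M' * (b - a)) * e.
  move=> e0; have [g [cg hg]] := continuous_approximation iab e0.
  have ig c d : integrable_on c d g.
    by apply: within_continuous_integrable_on; apply: within_continuous => x _; exact: cg.
  have G0 : int_on a b (fun x => phi x * g x) + int_on a b (fun x => phi' x * int_on a x g) = 0.
    (* The lower limit is moved to a - 1 so that the primitive of g is differentiable at a from both
       sides; phi' again removes the constant. *)
    have aab x : a <= x -> int_on a x g = int_on (a - 1) x g - int_on (a - 1) a g.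
      by move=> ax; rewrite int_on_split// gerBl.
    rewrite (@eq_int_on _ _ _ (fun x => phi' x * int_on a x g)
      (fun x => phi' x * int_on (a - 1) x g - int_on (a - 1) a g * phi' x)); last first.
      by move=> x /andP[ax _]; rewrite aab//; ring.
    have dG x : a <= x <= b -> is_derive x 1 (fun y => int_on (a - 1) y g) (g x).
      move=> /andP[ax xb]; apply: (@int_on_derive _ (a - 1) (b + 1)) => //; lra.
    have cG x : a <= x <= b -> {for x, continuous (fun y => int_on (a - 1) y g)}.
      by move=> xab; exact: is_derive1_continuous (dG x xab).
    have iG : integrable_on a b (fun x => phi' x * int_on (a - 1) x g).
      apply: integrable_on_mul => //.
      by apply: within_continuous_integrable_on; apply: within_continuous.
    rewrite int_onB//; last exact: integrable_onZ.
    rewrite int_onZ// phi'0 mulr0 subr0 -int_onD//; last exact: integrable_on_mul.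
    pose F x := phi x * int_on (a - 1) x g.
    have dF x : a <= x <= b -> is_derive x 1 F (phi x * g x + phi' x * int_on (a - 1) x g).
      move=> xab; apply: is_derive_eq (is_derive1_mul (dphi x) (dG x xab)) _.
      by ring.
    rewrite (fundamental_int_on (ltW ab) dF).
      by rewrite /F !w1 ?lexx ?orbT// !mul0r subrr.
    move=> x xab; apply: cvgD; apply: cvgM.
    + exact: test_continuous.
    + exact: cg.
    + exact: test_continuous.
    + exact: cG.
  have ihg : integrable_on a b (fun x => h x - g x) by exact: integrable_onB.
  have iahg : integrable_on a b (fun x => `|h x - g x|) by exact: integrable_on_norm.
  have XE : X = int_on a b (fun x => phi x * (h x - g x)) +
      int_on a b (fun x => phi' x * int_on a x (fun y => h y - g y)).
    have -> : X = X - 0 by rewrite subr0.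
    rewrite -G0 /X.
    rewrite (@eq_int_on _ _ _ (fun x => phi x * (h x - g x)) (fun x => phi x * h x - phi x * g x)); last first.
      by move=> x _; rewrite mulrBr.
    rewrite (@eq_int_on _ _ _ (fun x => phi' x * int_on a x (fun y => h y - g y))
      (fun x => phi' x * K x - phi' x * int_on a x g)); last first.
      by move=> x /andP[ax xb]; rewrite int_onB ?mulrBr//; exact: hi.
    rewrite !int_onB; [exact: XE_algebra|exact: iK|exact: iK|exact: integrable_on_mul|exact: integrable_on_mul].
  rewrite XE mulrDl; apply: (ler_pair _ _ (lexx _)).
    apply: (le_trans (int_on_abs_le (integrable_on_mul (cphi a b) ihg))).
    apply: (@le_trans _ _ (int_on a b (fun x => M * `|h x - g x|))).
      apply: int_on_le; [exact/integrable_on_norm/integrable_on_mul|exact: integrable_onZ|].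
      by move=> x xab; rewrite normrM; exact: ler_wpM2r (normr_ge0 _) _ _ (hM x xab).
    by rewrite (int_onZ M iahg); exact: ler_wpM2l M0 _ _ (ltW hg).
  apply: (le_trans (int_on_abs_le (iK _ ihg))).
  apply: (@le_trans _ _ (int_on a b (fun=> M' * e))).
    apply: int_on_le; [exact/integrable_on_norm/iK|exact: integrable_on_cst|].
    move=> x xab; rewrite normrM; apply: ler_pM (normr_ge0 _) (normr_ge0 _) (hM' x xab) _.
    case/andP: xab => ax xb.
    have i2 : integrable_on a x (fun y => h y - g y) by apply: integrable_onW ihg.
    apply: (le_trans (int_on_abs_le i2)); apply: le_trans (ltW hg).
    exact: int_on_subint_le.
  by rewrite (int_on_cst _ (ltW ab)) mulrAC.
apply/eqP; rewrite -normr_eq0 eq_le normr_ge0 andbT leNgt; apply/negP => X0.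
have c0 : 0 <= M + M' * (b - a) by rewrite addr_ge0// mulr_ge0// subr_ge0 ltW.
have := bound (`|X| / 2 / (M + M' * (b - a) + 1)).
rewrite !divr_gt0//; last by lra.
move=> /(_ isT); apply/negP; rewrite -ltNge.
rewrite mulrCA; apply: (@le_lt_trans _ _ (`|X| / 2)).
  by rewrite ler_piMr ?divr_ge0// ler_pdivrMr; lra.
lra.
Qed.

End weak_derivative.

(** * The fundamental lemma and the du Bois-Reymond lemma of fourth order *)

Section du_bois_reymond.
Context {R : realType}.
Local Notation mu := (@lebesgue_measure R).
Implicit Types (f g h phi psi : R -> R) (a b c r x : R).

Lemma lebesgue_ae_imply (P Q : R -> Prop) : (forall x, P x -> Q x) ->
  {ae mu, forall x, P x} -> {ae mu, forall x, Q x}.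
Proof. by move=> PQ; apply: filterS; first exact: (ae_filter_ringOfSetsType mu). Qed.

Lemma lebesgue_ae_imply2 (P1 P2 Q : R -> Prop) : (forall x, P1 x -> P2 x -> Q x) ->
  {ae mu, forall x, P1 x} -> {ae mu, forall x, P2 x} -> {ae mu, forall x, Q x}.
Proof. by move=> PQ; apply: filterS2; first exact: (ae_filter_ringOfSetsType mu). Qed.

Lemma test_within phi a b : test phi -> {within `[a, b], continuous phi}.
Proof. by move=> tp; apply: within_continuous => x _; exact: test_continuous. Qed.

Lemma test_supp phi : test phi -> exists a b, [/\ 0 < a, a < b & vanishes_outside a b phi].
Proof. by case. Qed.

Lemma integrable_on_test phi h a b : test phi -> locint h -> 0 < a ->
  integrable_on a b (fun x => phi x * h x).
Proof. by move=> tp hi a0; apply: integrable_on_mul; [exact: test_within|exact: hi]. Qed.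

Lemma locintD g h : locint g -> locint h -> locint (fun x => g x + h x).
Proof. by move=> gi hi a b a0; apply: integrable_onD; [exact: gi|exact: hi]. Qed.

Lemma locintZ c h : locint h -> locint (fun x => c * h x).
Proof. by move=> hi a b a0; apply: integrable_onZ; exact: hi. Qed.

Lemma locintB g h : locint g -> locint h -> locint (fun x => g x - h x).
Proof. by move=> gi hi a b a0; apply: integrable_onB; [exact: gi|exact: hi]. Qed.

Lemma pairingDr phi g h : test phi -> locint g -> locint h ->
  pairing phi (fun x => g x + h x) = pairing phi g + pairing phi h.
Proof.
move=> tp gi hi; have [a [b [a0 ab v]]] := test_supp tp.
rewrite !(pairingE _ a0 v) -int_onD; [|exact: integrable_on_test..].
by apply: eq_int_on => x _; rewrite mulrDr.
Qed.

Lemma pairingZr phi c h : test phi -> locint h ->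
  pairing phi (fun x => c * h x) = c * pairing phi h.
Proof.
move=> tp hi; have [a [b [a0 ab v]]] := test_supp tp.
rewrite !(pairingE _ a0 v) -int_onZ; last exact: integrable_on_test.
by apply: eq_int_on => x _; rewrite mulrCA.
Qed.

Lemma pairingBr phi g h : test phi -> locint g -> locint h ->
  pairing phi (fun x => g x - h x) = pairing phi g - pairing phi h.
Proof.
move=> tp gi hi; rewrite -mulN1r -pairingZr// -pairingDr//; last exact: locintZ.
by congr pairing; apply/funext => x; rewrite mulN1r.
Qed.

Lemma pairingDl phi psi h : test phi -> test psi -> locint h ->
  pairing (fun x => phi x + psi x) h = pairing phi h + pairing psi h.
Proof.
move=> tp tq hi; have [a [b [a0 ab v w]]] := test2 tp tq.
have vw : vanishes_outside a b (fun x => phi x + psi x) by move=> x hx; rewrite v// w// addr0.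
rewrite (pairingE _ a0 v) (pairingE _ a0 w) (pairingE _ a0 vw) -int_onD; [|exact: integrable_on_test..].
by apply: eq_int_on => x _; rewrite mulrDl.
Qed.

Lemma pairingZl phi c h : test phi -> locint h ->
  pairing (fun x => c * phi x) h = c * pairing phi h.
Proof.
move=> tp hi; have [a [b [a0 ab v]]] := test_supp tp.
have vw : vanishes_outside a b (fun x => c * phi x) by move=> x hx; rewrite v// mulr0.
rewrite (pairingE _ a0 v) (pairingE _ a0 vw) -int_onZ; last exact: integrable_on_test.
by apply: eq_int_on => x _; rewrite mulrA.
Qed.

(** The bumps tend to the indicator of ]a, b[ and are at most 1, so dominated convergence applies
    with |g| as the bound. *)
Lemma int_on_of_pairing0 g a b : locint g -> (forall phi, test phi -> pairing phi g = 0) ->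
  0 < a -> a < b -> int_on a b g = 0.
Proof.
move=> gi g0 a0 ab.
have gab := gi a b a0.
have sub : `]a, b[%classic `<=` `[a, b]%classic.
  by move=> x /=; rewrite !in_itv/= => /andP[h1 h2]; rewrite !ltW.
have ioo : mu.-integrable `]a, b[ (EFin \o g).
  by apply: (@integrableS _ _ _ mu `[a, b]%classic `]a, b[%classic (EFin \o g)).
have tb n : test (@bump R a b n) by exact: bump_test.
have openclosed h : integrable_on a b h ->
    (\int[mu]_(x in `]a, b[) (h x)%:E = (int_on a b h)%:E)%E.
  move=> ih; rewrite /int_on /Rintegral fineK; last first.
    by apply: integrable_fin_num => //; exact: measurable_itv.
  apply/esym/integral_itv_bndoo.
  have : mu.-integrable `]a, b[ (EFin \o h).
    by apply: (@integrableS _ _ _ mu `[a, b]%classic `]a, b[%classic (EFin \o h)).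
  by case/integrableP.
have E n : (\int[mu]_(x in `]a, b[) ((bump a b n x * g x)%:E) = 0)%E.
  rewrite openclosed; last by apply: integrable_on_mul => //; exact: test_within.
  by rewrite -(pairingE _ a0 (@bump_vanishes _ a b n)) g0.
have mg : measurable_fun `]a, b[ g by case/integrableP: ioo => /measurable_EFinP.
have := @dominated_cvg _ _ _ mu `]a, b[%classic (measurable_itv _)
  (fun n x => (bump a b n x * g x)%:E) (EFin \o g) (fun x => `|(g x)%:E|)%E.
have -> : (fun n => (\int[mu]_(x in `]a, b[) (bump a b n x * g x)%:E)%E) = fun=> 0%E.
  by apply/funext => n; rewrite E.
rewrite openclosed// => H.
have : (fun _ : nat => 0%E : \bar R) @ \oo --> (int_on a b g)%:E.
  apply: H.
  - move=> n; apply/measurable_EFinP; apply: measurable_funM => //.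
    by apply: open_continuous_measurable_fun => // x _; exact: test_continuous.
  - move=> x /=; rewrite in_itv/= => /andP[ax xb]; apply: cvg_EFin; first exact: nearW.
    rewrite -[X in _ --> X]mul1r; apply: cvgM; last exact: cvg_cst.
    exact: bump_cvg.
  - by move=> x _.
  - exact: integrable_abse.
  - move=> n x _; rewrite lee_fin normrM ler_piMl// ger0_norm ?bump_ge0//.
    exact: bump_le1.
move=> c; have : (int_on a b g)%:E = 0%E by rewrite -(cvg_lim _ c)// lim_cst.
by move=> [].
Qed.

(** The primitive of g vanishes identically by [int_on_of_pairing0], and at a Lebesgue point its
    derivative is g. *)
Lemma fundamental_lemma g : locint g -> (forall phi, test phi -> pairing phi g = 0) ->
  {ae mu, forall x, 0 < x -> g x = 0}.
Proof.
move=> gi g0.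
have key a b : 0 < a -> a < b -> {ae mu, forall x, a < x -> x < b -> g x = 0}.
  move=> a0 ab; have gab := gi a b a0.
  pose f := g \_ `[a, b].
  have lf : locally_integrable [set: R] f by apply: integrable_locally_restrict => //.
  have := lebesgue_differentiation lf; apply: lebesgue_ae_imply => x lx ax xb.
  have fg y : a <= y <= b -> f y = g y.
    by move=> yab; rewrite /f patchE mem_set//= in_itv.
  have fi : integrable_on a b f.
    move: gab; apply: eq_integrable => // y.
    by rewrite inE/= in_itv/= => yab /=; rewrite fg.
  have ax' : (BLeft a < BRight x)%E by first [exact: ax|exact: ltW].
  have [dF] := FTC1_lebesgue_pt xb fi ax' lx.
  rewrite fg; last by rewrite !ltW.
  move=> <-; apply: is_derive1_derive1; apply: is_derive1_unique_near (is_derive1_cst 0 x).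
  near=> y.
  have ay : a < y by near: y; exact: lt_nbhsr.
  have yb : y < b by near: y; exact: lt_nbhsl.
  rewrite -(int_on_of_pairing0 gi g0 a0 ay); apply: eq_int_on => z /andP[az zy].
  by rewrite fg// az (le_trans zy)// ltW.
(* Countably many intervals exhaust the half-line; n + 2 instead of n + 1 keeps the first of them
   nondegenerate. *)
have : {ae mu, forall x, forall n : nat, n.+2%:R^-1 < x -> x < n.+2%:R -> g x = 0}.
  apply: ae_foralln => n; apply: key; first by rewrite invr_gt0.
  by apply: (@lt_trans _ _ 1); rewrite ?invf_lt1 ?ltr1n.
apply: lebesgue_ae_imply => x hx x0.
pose n := Num.truncn (x + x^-1).
have hn : x + x^-1 < n.+2%:R by apply: lt_le_trans (truncnS_gt _) _; rewrite ler_nat.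
have xi : 0 < x^-1 by rewrite invr_gt0.
apply: (hx n); last by lra.
by rewrite invf_plt ?posrE//; lra.
Unshelve. all: by end_near. Qed.

(** The vanishing integral is what makes the primitive return to 0 to the right of the support. *)
Lemma test_primitive psi : test psi -> pairing psi (fun=> 1) = 0 ->
  exists2 chi, test chi & chi^`()%classic = psi.
Proof.
move=> tp p0; have [a [b [a0 ab v]]] := test_supp tp.
pose chi r := int_on (a / 2) r psi.
have chi0 r : r <= a -> chi r = 0.
  move=> ra; rewrite /chi (@eq_int_on _ _ _ _ (fun=> 0)); last first.
    by move=> x /andP[_ xr]; rewrite v// (le_trans xr).
  by rewrite /int_on Rintegral_cst//= mul0r.
have d r : is_derive r 1 chi (psi r).
  have [ra|ar] := ltP r a.
    rewrite v ?(ltW ra)//; apply: is_derive1_unique_near (is_derive1_cst 0 r).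
    by apply: (gt_near ra) => y /ltW; exact: chi0.
  apply: (@int_on_derive _ (a / 2) (r + 1)).
  - by apply: lt_le_trans ar; lra.
  - by rewrite ltrDl.
  - by apply: within_continuous_integrable_on; exact: test_within.
  - exact: test_continuous.
exists chi; last exact: derive1_ext.
split; first by apply: (smoothS d); case: tp.
exists a, b; split=> // r /orP[/chi0//|br].
have v' : vanishes_outside (a / 2) r psi.
  by apply: vanishes_outsideW v => //; lra.
rewrite -p0 (pairingE _ _ v'); last by lra.
by apply: eq_int_on => x _; rewrite mulr1.
Qed.

Lemma derive1n_linear n f g c : smooth f -> smooth g ->
  (fun x => f x + c * g x)^`(n)%classic = fun x => f^`(n)%classic x + c * g^`(n)%classic x.
Proof.
elim: n f g => [//|n IH] f g sf sg; rewrite !derive1Sn.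
have -> : (fun x => f x + c * g x)^`()%classic = fun x => f^`()%classic x + c * g^`()%classic x.
  apply: derive1_ext => x; have df := smooth_is_derive x sf; have dg := smooth_is_derive x sg.
  by is_derive_tac; ring.
by rewrite IH//; exact: smooth_derive1.
Qed.

Lemma test_derive1n n phi : test phi -> test (phi^`(n)%classic).
Proof. by move=> tp; elim: n => [//|n IH]; rewrite derive1nS; exact: test_derive1. Qed.

Definition iterJ n h := iter n J h.

Lemma locint_J h : locint h -> locint (J h).
Proof. by move=> hi; apply: contpos_locint; exact: contpos_J. Qed.

Lemma locint_iterJ n h : locint h -> locint (iterJ n h).
Proof. by move=> hi; elim: n => [//|n IH]; exact: locint_J. Qed.

Lemma pairing_iterJ n k phi h : test phi -> locint h ->
  pairing (phi^`(k)%classic) h = (-1) ^+ n * pairing (phi^`(n + k)%classic) (iterJ n h).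
Proof.
move=> tp hi; elim: n => [|n IH]; first by rewrite expr0 mul1r.
rewrite IH pairing_J; [|exact: test_derive1n|exact: locint_iterJ].
by rewrite -derive1nS -addSn exprS; ring.
Qed.

Lemma locint_cst c : locint (fun=> c).
Proof. by move=> a b _; exact: integrable_on_cst. Qed.

(** The integral of a bump is shown to be nonzero without computing it: otherwise its primitive
    would be a nondecreasing function of compact support, hence 0, while the bump is positive at 3 /
    2. *)
Lemma unit_mass_test : exists2 phi : R -> R, test phi & pairing phi (fun=> 1) = 1.
Proof.
pose b := @bump R 1 2 0.
have tb : test b by apply: bump_test => //; rewrite ltr1n.
have p0 : pairing b (fun=> 1) != 0.
  apply/eqP => p0.
  have [chi tc e] := test_primitive tb p0.
  have [_ [a1 [b1 [_ _ v]]]] := tc.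
  have dchi (x : R) : is_derive x 1 chi (b x).
    by rewrite -e; apply: smooth_is_derive; case: tc.
  have nd x y : x <= y -> chi x <= chi y.
    by apply: (is_derive_nondecreasing (fun t _ => dchi t)) => t _; exact: bump_ge0.
  have z x : chi x = 0.
    have h1 : 0 <= chi x.
      rewrite -(v (Order.min a1 x)) ?ge_min ?lexx//.
      by apply: nd; rewrite ge_min lexx orbT.
    have h2 : chi x <= 0.
      rewrite -(v (Order.max b1 x)) ?le_max ?lexx ?orbT//.
      by apply: nd; rewrite le_max lexx orbT.
    by apply/eqP; rewrite eq_le h1 h2.
  have : b (3 / 2) = 0.
    rewrite -(is_derive1_derive1 (dchi (3 / 2))).
    have -> : chi = fun=> 0 by apply/funext.
    exact: is_derive1_derive1 (is_derive1_cst 0 _).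
  by apply/eqP; rewrite gt_eqF// bump_gt0//; lra.
exists (fun x => (pairing b (fun=> 1))^-1 * b x); first exact: testZ.
by rewrite pairingZl ?mulVf//; exact: locint_cst.
Qed.

(** For psi with integral c, the function psi - c phi0 has mean zero and is thus some chi', so
    psi^(n) pairs with g as c phi0^(n) does. The number c is itself (-1)^n times the pairing of
    psi^(n) with the n-fold primitive of 1, whence the sign in the witness. *)
Lemma du_bois_reymond_step n g : locint g ->
  (forall phi, test phi -> pairing (phi^`(n.+1)%classic) g = 0) ->
  exists c, forall phi, test phi ->
    pairing (phi^`(n)%classic) (fun x => g x - c * iterJ n (fun=> 1) x) = 0.
Proof.
move=> gi g0; have [phi0 t0 p0] := unit_mass_test.
pose C := pairing (phi0^`(n)%classic) g.
exists ((-1) ^+ n * C) => psi tp.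
pose c := pairing psi (fun=> 1).
have [||chi tc ec] := @test_primitive (fun x => psi x + (- c) * phi0 x).
- by apply: testD => //; exact: testZ.
- rewrite pairingDl//; [|exact: testZ|exact: locint_cst].
  by rewrite pairingZl// ?p0 ?mulr1 ?subrr//; exact: locint_cst.
have := g0 chi tc; rewrite derive1Sn ec derive1n_linear; [|by case: tp|by case: t0].
have tn := test_derive1n n tp; have t0n := test_derive1n n t0.
rewrite pairingDl//; last exact: testZ.
rewrite pairingZl// -/C => e.
have l1 := locint_iterJ n (locint_cst 1).
rewrite pairingBr//; last exact: locintZ.
rewrite pairingZr// mulrAC.
have -> : (-1) ^+ n * pairing psi^`(n)%classic (iterJ n (fun=> 1)) = c.
  by rewrite /c (@pairing_iterJ n 0 psi)// ?addn0//; exact: locint_cst.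
by rewrite -e mulNr.
Qed.

(** The right-hand side is a general cubic polynomial in the basis (x - 1)^k / k!, written through
    [J] because this is the form differentiated later. *)
Lemma du_bois_reymond4 g : locint g ->
  (forall phi, test phi -> pairing (phi^`(4)%classic) g = 0) ->
  exists c0 c1 c2 c3, {ae mu, forall x, 0 < x ->
    g x = c0 + c1 * J (fun=> 1) x + c2 * J (J (fun=> 1)) x + c3 * J (J (J (fun=> 1))) x}.
Proof.
move=> gi g0.
have li n c : locint (fun x => c * iterJ n (fun=> 1) x).
  by apply: locintZ; apply: locint_iterJ; exact: locint_cst.
have [c3 h3] := du_bois_reymond_step gi g0.
have g3 := locintB gi (li 3%N c3).
have [c2 h2] := du_bois_reymond_step g3 h3.
have g2 := locintB g3 (li 2%N c2).
have [c1 h1] := du_bois_reymond_step g2 h2.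
have g1 := locintB g2 (li 1%N c1).
have [c0 h0] := du_bois_reymond_step g1 h1.
exists c0, c1, c2, c3; have := fundamental_lemma (locintB g1 (li 0%N c0)) h0.
apply: lebesgue_ae_imply => x /[apply].
rewrite /iterJ/= mulr1; move: (J (fun=> 1) x) (J (J (fun=> 1)) x) (J (J (J (fun=> 1))) x) (g x) => j1 j2 j3 y; lra.
Qed.

End du_bois_reymond.

(** * Weak solutions are classical *)

Section regularity.
Context {R : realType}.
Local Notation mu := (@lebesgue_measure R).
Implicit Types (f g h phi psi u v w : R -> R) (a b c r x : R).
Variables c1 c2 : R.

(** The real form of [tau2] after the Leibniz expansion (see [tau2E]), arranged so that each summand
    is a constant times a test function. *)
Definition tau phi x : R := phi^`(4)%classic x + 2 * c1 * (x^-1 ^+ 2 * phi^`(2)%classic x)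
  + (- (4 * c1)) * (x^-1 ^+ 3 * phi^`(1)%classic x) + (6 * c1 + c2) * (x^-1 ^+ 4 * phi x).

Lemma test_tau phi : test phi -> test (tau phi).
Proof.
move=> tp; apply: testD; [apply: testD; [apply: testD|]|].
- exact: test_derive1n.
- by apply: testZ; apply: test_invX; exact: test_derive1n.
- by apply: testZ; apply: test_invX; exact: test_derive1n.
- by apply: testZ; exact: test_invX.
Qed.

Lemma contpos_invX k : contpos (fun x : R => x^-1 ^+ k).
Proof.
move=> x x0; apply: (is_derive1_continuous (a := k%:R * x^-1 ^+ k.-1 * (- x^-1 ^+ 2))).
by apply: is_derive1_exp; apply: is_derive1_invr; rewrite gt_eqF.
Qed.

Lemma pairing_shift f phi h : pairing (fun x => f x * phi x) h = pairing phi (fun x => f x * h x).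
Proof. by apply: eq_Rintegral => x _; rewrite mulrCA mulrA. Qed.

Lemma J_ae g h r : locint g -> locint h -> {ae mu, forall x, 0 < x -> g x = h x} ->
  0 < r -> J g r = J h r.
Proof.
move=> gi hi gh r0.
have key a b : 0 < a -> int_on a b g = int_on a b h.
  move=> a0; congr fine; apply: ae_eq_integral => //.
  - by case/integrableP: (gi a b a0).
  - by case/integrableP: (hi a b a0).
  - apply: lebesgue_ae_imply gh => x hx /=; rewrite in_itv/= => /andP[ax _].
    by rewrite hx// (lt_le_trans a0).
by rewrite /J !key.
Qed.

Lemma J_bound g K r : (forall a b, 0 < a -> a <= b -> 0 <= int_on a b g <= K) ->
  0 < r -> `|J g r| <= K.
Proof.
move=> gK r0; rewrite /J; have [r1|r1] := leP 1 r.
  have [h1 h2] := andP (gK 1 r ltr01 r1).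
  rewrite [X in _ - X](_ : _ = 0) ?subr0 ?ger0_norm//.
  move: r1; rewrite le_eqVlt => /predU1P[<-|r1]; first exact: int_on_point.
  by rewrite /int_on set_itv_ge ?Rintegral_set0// bnd_simp -ltNge.
have [h1 h2] := andP (gK r 1 r0 (ltW r1)).
rewrite [X in X - _](_ : _ = 0) ?sub0r ?normrN ?ger0_norm//.
by rewrite /int_on set_itv_ge ?Rintegral_set0// bnd_simp -ltNge.
Qed.

Local Opaque J pairing.

Definition one : R -> R := fun=> 1.

(* The weak equation [tau u = v] integrated four times and solved for [u]. *)
Definition representative (k0 k1 k2 k3 : R) u v x : R :=
  k0 + k1 * J one x + k2 * J (J one) x + k3 * J (J (J one)) x
  - 2 * c1 * J (J (fun y => y^-1 ^+ 2 * u y)) x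
  - 4 * c1 * J (J (J (fun y => y^-1 ^+ 3 * u y))) x
  - (6 * c1 + c2) * J (J (J (J (fun y => y^-1 ^+ 4 * u y)))) x
  + J (J (J (J v))) x.

Lemma pairing_combination_r a b c phi h1 h2 h3 h4 h5 : test phi -> locint h1 -> locint h2 ->
  locint h3 -> locint h4 -> locint h5 ->
  pairing phi (fun x => h1 x + a * h2 x + b * h3 x + c * h4 x - h5 x) =
  pairing phi h1 + a * pairing phi h2 + b * pairing phi h3 + c * pairing phi h4 - pairing phi h5.
Proof.
move=> tp i1 i2 i3 i4 i5.
have l2 := locintZ a i2; have l3 := locintZ b i3; have l4 := locintZ c i4.
have l12 := locintD i1 l2; have l123 := locintD l12 l3; have l1234 := locintD l123 l4.
rewrite (pairingBr tp l1234 i5) (pairingDr tp l123 l4) (pairingDr tp l12 l3) (pairingDr tp i1 l2).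
by rewrite (pairingZr a tp i2) (pairingZr b tp i3) (pairingZr c tp i4).
Qed.

Lemma pairing_combination_l a b c p1 p2 p3 p4 h : test p1 -> test p2 -> test p3 -> test p4 ->
  locint h -> pairing (fun x => p1 x + a * p2 x + b * p3 x + c * p4 x) h =
  pairing p1 h + a * pairing p2 h + b * pairing p3 h + c * pairing p4 h.
Proof.
move=> t1 t2 t3 t4 hi.
have l2 := testZ a t2; have l3 := testZ b t3; have l4 := testZ c t4.
have l12 := testD t1 l2; have l123 := testD l12 l3.
rewrite (pairingDl l123 l4 hi) (pairingDl l12 l3 hi) (pairingDl t1 l2 hi).
by rewrite (pairingZl a t2 hi) (pairingZl b t3 hi) (pairingZl c t4 hi).
Qed.

Lemma weak_form_algebra (P4 P2 P1 P0 Q Q2 Q3 Q4 Q5 : R) :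
  P4 + 2 * c1 * P2 + - (4 * c1) * P1 + (6 * c1 + c2) * P0 = Q ->
  P2 = (-1) ^+ 2 * Q2 -> P1 = (-1) ^+ 3 * Q3 -> P0 = (-1) ^+ 4 * Q4 -> Q = (-1) ^+ 4 * Q5 ->
  P4 + 2 * c1 * Q2 + 4 * c1 * Q3 + (6 * c1 + c2) * Q4 - Q5 = 0.
Proof.
move=> + h2 h1 h0 h; rewrite {}h2 {}h1 {}h0 {}h => h.
have -> : Q5 = (-1) ^+ 4 * Q5 by ring.
by rewrite -h; ring.
Qed.

Lemma weak_form_solve (y s A a B b C c d : R) :
  y + A * a + B * b + C * c - d = s -> y = s - A * a - B * b - C * c + d.
Proof. by move=> <-; ring. Qed.

Lemma weak_solution_representative u v : locint u -> locint v ->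
  (forall phi, test phi -> pairing (tau phi) u = pairing phi v) ->
  exists k0 k1 k2 k3, {ae mu, forall x, 0 < x -> u x = representative k0 k1 k2 k3 u v x}.
Proof.
move=> ui vi uv.
have li k : locint (fun y => y^-1 ^+ k * u y) by apply: locintM => //; exact: contpos_invX.
have J2 h : locint h -> locint (J (J h)) by move=> hi; do 2! apply: locint_J.
have J3 h : locint h -> locint (J (J (J h))) by move=> hi; do 3! apply: locint_J.
have J4 h : locint h -> locint (J (J (J (J h)))) by move=> hi; do 4! apply: locint_J.
(* Integrating the lower-order terms by parts moves four derivatives onto phi everywhere, so the
   weak equation says that g annihilates all fourth derivatives. Three integrations turn the
   coefficient - 4 c1 into + 4 c1. *)
pose g x := u x + 2 * c1 * J (J (fun y => y^-1 ^+ 2 * u y)) x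
  + 4 * c1 * J (J (J (fun y => y^-1 ^+ 3 * u y))) x
  + (6 * c1 + c2) * J (J (J (J (fun y => y^-1 ^+ 4 * u y)))) x
  - J (J (J (J v))) x.
have l2 := locintZ (2 * c1) (J2 _ (li 2%N)).
have l3 := locintZ (4 * c1) (J3 _ (li 3%N)).
have l4 := locintZ (6 * c1 + c2) (J4 _ (li 4%N)).
have l5 := J4 _ vi.
have gi : locint g.
  by apply: locintB => //; apply: locintD => //; apply: locintD => //; exact: locintD.
have [phi tp|k0 [k1 [k2 [k3 h]]]] := du_bois_reymond4 gi.
  have tn k := test_derive1n k tp.
  have t4 := tn 4%N.
  have -> := pairing_combination_r (2 * c1) (4 * c1) (6 * c1 + c2) t4 ui (J2 _ (li 2%N))
    (J3 _ (li 3%N)) (J4 _ (li 4%N)) (J4 _ vi).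
  have e := pairing_combination_l (2 * c1) (- (4 * c1)) (6 * c1 + c2) t4 (test_invX 2 (tn 2%N))
    (test_invX 3 (tn 1%N)) (test_invX 4 tp) ui.
  have e2 := etrans (pairing_shift _ _ _) (pairing_iterJ 2 2 tp (li 2%N)).
  have e3 := etrans (pairing_shift _ _ _) (pairing_iterJ 3 1 tp (li 3%N)).
  have e4 := etrans (pairing_shift _ _ _) (pairing_iterJ 4 0 tp (li 4%N)).
  have e5 := pairing_iterJ 4 0 tp vi.
  exact: (weak_form_algebra (etrans (esym e) (uv phi tp)) e2 e3 e4 e5).
exists k0, k1, k2, k3; apply: lebesgue_ae_imply h => x hx x0.
exact: (weak_form_solve (hx x0)).
Qed.

(** The functions stand for iterated primitives, one letter per source term, the index counting
    integrations. The second derivative contains r^-2 u itself, so the third rests on the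
    differentiability of u obtained first. *)
Lemma integral_equation_derivatives (k0 k1 k2 k3 : R)
    (u v o1 o2 o3 p1 p2 q1 q2 q3 s1 s2 s3 s4 t1 t2 t3 t4 : R -> R) :
  (forall r : R, 0 < r -> is_derive r 1 o1 1) ->
  (forall r : R, 0 < r -> is_derive r 1 o2 (o1 r)) ->
  (forall r : R, 0 < r -> is_derive r 1 o3 (o2 r)) ->
  (forall r : R, 0 < r -> is_derive r 1 p1 (r^-1 ^+ 2 * u r)) ->
  (forall r : R, 0 < r -> is_derive r 1 p2 (p1 r)) ->
  (forall r : R, 0 < r -> is_derive r 1 q1 (r^-1 ^+ 3 * u r)) ->
  (forall r : R, 0 < r -> is_derive r 1 q2 (q1 r)) ->
  (forall r : R, 0 < r -> is_derive r 1 q3 (q2 r)) ->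
  (forall r : R, 0 < r -> is_derive r 1 s1 (r^-1 ^+ 4 * u r)) ->
  (forall r : R, 0 < r -> is_derive r 1 s2 (s1 r)) ->
  (forall r : R, 0 < r -> is_derive r 1 s3 (s2 r)) ->
  (forall r : R, 0 < r -> is_derive r 1 s4 (s3 r)) ->
  (forall r : R, 0 < r -> is_derive r 1 t1 (v r)) ->
  (forall r : R, 0 < r -> is_derive r 1 t2 (t1 r)) ->
  (forall r : R, 0 < r -> is_derive r 1 t3 (t2 r)) ->
  (forall r : R, 0 < r -> is_derive r 1 t4 (t3 r)) ->
  (forall x, 0 < x -> u x = k0 + k1 * o1 x + k2 * o2 x + k3 * o3 x
    - 2 * c1 * p2 x - 4 * c1 * q3 x - (6 * c1 + c2) * s4 x + t4 x) ->
  exists U1 U2 U3 : R -> R,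
  [/\ forall r : R, 0 < r -> is_derive r 1 u (U1 r),
   forall r : R, 0 < r -> is_derive r 1 U1 (U2 r),
   forall r : R, 0 < r -> is_derive r 1 U2 (U3 r) &
   forall r : R, 0 < r -> is_derive r 1 U3 (v r - lower_order c1 c2 u U1 U2 r)].
Proof.
move=> o1' o2' o3' p1' p2' q1' q2' q3' s1' s2' s3' s4' t1' t2' t3' t4' uE.
pose U x := k0 + k1 * o1 x + k2 * o2 x + k3 * o3 x
    - 2 * c1 * p2 x - 4 * c1 * q3 x - (6 * c1 + c2) * s4 x + t4 x.
pose U1 x := k1 + k2 * o1 x + k3 * o2 x - 2 * c1 * p1 x - 4 * c1 * q2 x
  - (6 * c1 + c2) * s3 x + t3 x.
pose U2 x := k2 + k3 * o1 x - 2 * c1 * (x^-1 ^+ 2 * u x) - 4 * c1 * q1 x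
  - (6 * c1 + c2) * s2 x + t2 x.
pose U3 x := k3 - 2 * c1 * (x^-1 ^+ 2 * U1 x - 2 * x^-1 ^+ 3 * u x)
  - 4 * c1 * (x^-1 ^+ 3 * u x) - (6 * c1 + c2) * s1 x + t1 x.
have dU r : 0 < r -> is_derive r 1 U (U1 r).
  move=> r0; have := (o1' r r0, o2' r r0, o3' r r0, p2' r r0, q3' r r0, s4' r r0, t4' r r0).
  move=> [[[[[[a1 a2] a3] a4] a5] a6] a7].
  by rewrite /U; is_derive_tac; rewrite /U1; ring.
have du r : 0 < r -> is_derive r 1 u (U1 r).
  move=> r0; apply: is_derive1_unique_near (dU r r0).
  by apply: (lt_near r0) => y y0; exact: uE.
have dU1 r : 0 < r -> is_derive r 1 U1 (U2 r).
  move=> r0; have := (o1' r r0, o2' r r0, p1' r r0, q2' r r0, s3' r r0, t3' r r0).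
  move=> [[[[[a1 a2] a4] a5] a6] a7].
  by rewrite /U1; is_derive_tac; rewrite /U2; ring.
exists U1, U2, U3; split; [exact: du|exact: dU1| |]; move=> r r0;
  have di := is_derive1_invr (lt0r_neq0 r0); have a0 := du r r0.
- have [[[a1 a5] a6] a7] := (o1' r r0, q1' r r0, s2' r r0, t2' r r0).
  by rewrite /U2; is_derive_tac; rewrite /U3; ring.
- have [[a1 a6] a7] := (dU1 r r0, s1' r r0, t1' r r0).
  by rewrite /U3; is_derive_tac; rewrite /lower_order; ring.
Qed.

Lemma representative_derivatives k0 k1 k2 k3 u v : contpos u -> contpos v ->
  (forall x, 0 < x -> u x = representative k0 k1 k2 k3 u v x) ->
  exists U1 U2 U3 : R -> R,
  [/\ forall r : R, 0 < r -> is_derive r 1 u (U1 r),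
   forall r : R, 0 < r -> is_derive r 1 U1 (U2 r),
   forall r : R, 0 < r -> is_derive r 1 U2 (U3 r) &
   forall r : R, 0 < r -> is_derive r 1 U3 (v r - lower_order c1 c2 u U1 U2 r)].
Proof.
move=> uc vc uU.
have dJ h : contpos h -> forall r : R, 0 < r -> is_derive r 1 (J h) (h r).
  by move=> ch r r0; exact: J_is_derive.
have cJ h : contpos h -> contpos (J h) by move=> ch; apply: contpos_J; exact: contpos_locint.
have li k : contpos (fun y => y^-1 ^+ k * u y).
  by move=> x x0; apply: cvgM; [exact: contpos_invX|exact: uc].
have co : contpos one by move=> x x0; exact: cst_continuous.
have coj := cJ _ co; have cojj := cJ _ coj.
have l2 := @li 2; have l2j := cJ _ l2.
have l3 := @li 3; have l3j := cJ _ l3; have l3jj := cJ _ l3j.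
have l4 := @li 4; have l4j := cJ _ l4; have l4jj := cJ _ l4j; have l4jjj := cJ _ l4jj.
have vj := cJ _ vc; have vjj := cJ _ vj; have vjjj := cJ _ vjj.
exact: (integral_equation_derivatives (dJ _ co) (dJ _ coj) (dJ _ cojj) (dJ _ l2) (dJ _ l2j)
  (dJ _ l3) (dJ _ l3j) (dJ _ l3jj) (dJ _ l4) (dJ _ l4j) (dJ _ l4jj) (dJ _ l4jjj)
  (dJ _ vc) (dJ _ vj) (dJ _ vjj) (dJ _ vjjj) uU).
Qed.

Lemma contposD f g : contpos f -> contpos g -> contpos (fun x => f x + g x).
Proof. by move=> cf cg x x0; apply: cvgD; [exact: cf|exact: cg]. Qed.

Lemma contposN f : contpos f -> contpos (fun x => - f x).
Proof. by move=> cf x x0; apply: cvgN; exact: cf. Qed.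

Lemma contposZ k f : contpos f -> contpos (fun x => k * f x).
Proof. by move=> cf x x0; apply: cvgM; [exact: cst_continuous|exact: cf]. Qed.

Lemma contpos_representative k0 k1 k2 k3 u v : locint u -> locint v ->
  contpos (representative k0 k1 k2 k3 u v).
Proof.
move=> ui vi.
have li k : locint (fun y => y^-1 ^+ k * u y) by apply: locintM => //; exact: contpos_invX.
have lo : locint one by exact: locint_cst.
have c0 : contpos (fun=> k0) by move=> x x0; exact: cst_continuous.
have loj := locint_J lo; have lojj := locint_J loj.
have l2 := locint_J (li 2%N).
have l3 := locint_J (locint_J (li 3%N)).
have l4 := locint_J (locint_J (locint_J (li 4%N))).
have l5 := locint_J (locint_J (locint_J vi)).
have H := (contposD (contposD (contposD (contposD (contposD (contposD (contposD c0
  (contposZ (k := k1) (contpos_J lo))) (contposZ (k := k2) (contpos_J loj))) (contposZ (k := k3) (contpos_J lojj)))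
  (contposN (contposZ (k := 2 * c1) (contpos_J l2)))) (contposN (contposZ (k := 4 * c1) (contpos_J l3))))
  (contposN (contposZ (k := 6 * c1 + c2) (contpos_J l4)))) (contpos_J l5)).
by move=> x x0; exact: H x x0.
Qed.

(** The representative sees only almost-everywhere classes. Hence the continuous function equal to u
    almost everywhere satisfies the integral equation with itself on the right, at every x > 0. *)
Lemma representative_ae k0 k1 k2 k3 u v u' v' x : locint u -> locint v -> locint u' -> locint v' ->
  {ae mu, forall x, 0 < x -> u x = u' x} -> {ae mu, forall x, 0 < x -> v x = v' x} -> 0 < x ->
  representative k0 k1 k2 k3 u v x = representative k0 k1 k2 k3 u' v' x.
Proof.
move=> ui vi ui' vi' uu vv x0.
have li w k : locint w -> locint (fun y => y^-1 ^+ k * w y).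
  by move=> wi; apply: locintM => //; exact: contpos_invX.
have ext g h : locint g -> locint h -> (forall y, 0 < y -> g y = h y) ->
    forall y, 0 < y -> J g y = J h y.
  by move=> gi hi gh y y0; apply: J_ae => //; apply: nearW.
have e k y : 0 < y -> J (fun y => y^-1 ^+ k * u y) y = J (fun y => y^-1 ^+ k * u' y) y.
  move=> y0; apply: J_ae => //; [exact: li|exact: li|].
  by apply: lebesgue_ae_imply uu => z hz z0; rewrite hz.
have ev y : 0 < y -> J v y = J v' y by exact: J_ae.
have e2 := e 2%N; have e3 := e 3%N; have e4 := e 4%N.
have l2 := li u 2%N ui; have l2' := li u' 2%N ui'.
have l3 := li u 3%N ui; have l3' := li u' 3%N ui'.
have l4 := li u 4%N ui; have l4' := li u' 4%N ui'.
have ee2 := ext _ _ (locint_J l2) (locint_J l2') e2.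
have ee3 := ext _ _ (locint_J l3) (locint_J l3') e3.
have eee3 := ext _ _ (locint_J (locint_J l3)) (locint_J (locint_J l3')) ee3.
have ee4 := ext _ _ (locint_J l4) (locint_J l4') e4.
have eee4 := ext _ _ (locint_J (locint_J l4)) (locint_J (locint_J l4')) ee4.
have eeee4 := ext _ _ (locint_J (locint_J (locint_J l4))) (locint_J (locint_J (locint_J l4'))) eee4.
have eev := ext _ _ (locint_J vi) (locint_J vi') ev.
have eeev := ext _ _ (locint_J (locint_J vi)) (locint_J (locint_J vi')) eev.
have eeeev := ext _ _ (locint_J (locint_J (locint_J vi))) (locint_J (locint_J (locint_J vi'))) eeev.
exact: (f_equal4 (fun p q s t => k0 + k1 * J one x + k2 * J (J one) x + k3 * J (J (J one)) x
  - 2 * c1 * p - 4 * c1 * q - (6 * c1 + c2) * s + t)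
  (ee2 x x0) (eee3 x x0) (eeee4 x x0) (eeeev x x0)).
Qed.

Lemma weak_deficiency_trivial u v :
  stable_roots (5 / 4 - c1) (9 / 16 + 3 / 2 * c1 + c2) ->
  locint u -> locint v ->
  (forall phi, test phi -> pairing (tau phi) u = pairing phi v) ->
  (forall phi, test phi -> pairing (tau phi) v = pairing phi (fun x => - u x)) ->
  (exists K, forall a b, 0 < a -> a <= b -> int_on a b (fun x => u x ^+ 2 + v x ^+ 2) <= K) ->
  {ae mu, forall x, 0 < x -> u x = 0 /\ v x = 0}.
Proof.
move=> st ui vi uv vu [K hK].
have nui : locint (fun x => - u x).
  by have := locintZ (-1) ui; under eq_fun do rewrite mulN1r.
have [U [V [[cU cV] [ae1 ae2] [k0 [k1 [k2 [k3 eU]]]] [l0 [l1 [l2 [l3 eV]]]]]]] :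
    exists U V, [/\ contpos U /\ contpos V,
      {ae mu, forall x, 0 < x -> u x = U x} /\ {ae mu, forall x, 0 < x -> v x = V x},
      exists k0 k1 k2 k3, forall x, 0 < x -> U x = representative k0 k1 k2 k3 U V x &
      exists l0 l1 l2 l3, forall x, 0 < x ->
        V x = representative l0 l1 l2 l3 V (fun x => - U x) x].
  have [k0 [k1 [k2 [k3 ae1]]]] := weak_solution_representative ui vi uv.
  have [l0 [l1 [l2 [l3 ae2]]]] := weak_solution_representative vi nui vu.
  have cU := @contpos_representative k0 k1 k2 k3 _ _ ui vi.
  have cV := @contpos_representative l0 l1 l2 l3 _ _ vi nui.
  have iU := contpos_locint cU; have iV := contpos_locint cV.
  have iNU := contpos_locint (contposN cU).
  have ae1n : {ae mu, forall x, 0 < x -> - u x = - representative k0 k1 k2 k3 u v x}.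
    by apply: lebesgue_ae_imply ae1 => y hy y0; rewrite -hy.
  exists (representative k0 k1 k2 k3 u v), (representative l0 l1 l2 l3 v (fun x => - u x)).
  split; [by split|by split| |].
    exists k0, k1, k2, k3 => x x0.
    exact: (@representative_ae k0 k1 k2 k3 _ _ _ _ _ ui vi iU iV ae1 ae2 x0).
  exists l0, l1, l2, l3 => x x0.
  exact: (@representative_ae l0 l1 l2 l3 _ _ _ _ _ vi nui iV iNU ae2 ae1n x0).
have cNU := contposN cU; have iU := contpos_locint cU; have iV := contpos_locint cV.
have [U1 [U2 [U3 [d0 d1 d2 d3]]]] := representative_derivatives cU cV eU.
have [V1 [V2 [V3 [e0 e1 e2 e3]]]] := representative_derivatives cV cNU eV.
pose q x := U x ^+ 2 + V x ^+ 2.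
have cq : contpos q.
  move=> x x0; apply: (is_derive1_continuous (a := 2 * U x ^+ 1 * U1 x + 2 * V x ^+ 1 * V1 x)).
  have h1 := d0 x x0; have h2 := e0 x x0.
  by rewrite /q; is_derive_tac.
have iq := contpos_locint cq.
have qK a b : 0 < a -> a <= b -> 0 <= int_on a b q <= K.
  move=> a0 ab; apply/andP; split.
    by apply: Rintegral_ge0 => x _; rewrite addr_ge0 ?sqr_ge0.
  apply: le_trans (hK a b a0 ab); rewrite le_eqVlt; apply/orP; left; apply/eqP.
  congr fine; apply: ae_eq_integral => //.
  - by case/integrableP: (iq a b a0).
  - apply/measurable_EFinP; apply: measurable_funD; apply: measurable_funX.
      by have [/measurable_EFinP] := integrableP _ _ _ (ui a b a0).
    by have [/measurable_EFinP] := integrableP _ _ _ (vi a b a0).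
  - apply: lebesgue_ae_imply2 ae1 ae2 => x hx1 hx2 /=; rewrite in_itv/= => /andP[ax _].
    have x0 := lt_le_trans a0 ax.
    by rewrite /q -(hx1 x0) -(hx2 x0).
have HK r : 0 < r -> `|J q r| <= K by move=> r0; exact: J_bound.
(* [J q] is the bounded primitive of U^2 + V^2 required by [classical_deficiency_trivial]. *)
have dJq r : 0 < r -> is_derive r 1 (J q) (q r) by move=> r0; exact: J_is_derive.
have z := @classical_deficiency_trivial R c1 c2 U U1 U2 U3 V V1 V2 V3 (J q) K st d0 d1 d2 d3
  e0 e1 e2 e3 dJq HK.
apply: lebesgue_ae_imply2 ae1 ae2 => x hx1 hx2 x0.
by rewrite hx1// hx2//; exact: z.
Qed.

End regularity.

(** * The operator on the half-line *)

Section halfline.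
Context {R : realType}.
Local Notation mu := (@lebesgue_measure R).
Local Notation nu := (halfline_measure R).
Let D : set R := `]0, +oo[%classic.

Let mD : measurable D. Proof. exact: measurable_itv. Qed.

Lemma halfline_measureE (A : set R) : nu A = mu (A `&` D). Proof. by []. Qed.

Lemma halfline_complement : nu (~` D) = 0%E.
Proof. by rewrite halfline_measureE setICl measure0. Qed.

Lemma halfline_ae (P : R -> Prop) :
  {ae nu, forall x, P x} <-> {ae mu, forall x, 0 < x -> P x}.
Proof.
split=> [[A [mA A0 PA]]|[A [mA A0 PA]]].
  exists (A `&` D); split; [exact: measurableI|exact: A0|].
  move=> x /= /not_implyP[x0 nP]; split; first exact: PA.
  by rewrite /D/= in_itv/= x0.
exists (A `|` ~` D); split.
- by apply: measurableU => //; exact: measurableC.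
- rewrite halfline_measureE setIUl setICl setU0.
  by apply: (subset_measure0 _ _ _ A0) => //; exact: measurableI.
- move=> x /= nP; have [Dx|nDx] := pselect (D x); last by right.
  by left; apply: PA => /= h; apply: nP; apply: h; move: Dx; rewrite /D/= in_itv/= andbT.
Qed.

Lemma ge0_halfline_integral (f : R -> \bar R) : measurable_fun [set: R] f ->
  (forall x, 0 <= f x)%E -> (\int[nu]_x f x = \int[mu]_(x in D) f x)%E.
Proof.
move=> mf f0.
rewrite (@ge0_negligible_integral _ _ _ nu setT (~` D))//; last 2 first.
  exact: measurableC.
  exact: halfline_complement.
rewrite setTD setCK; apply: eq_measure_integral => A mA AD.
by rewrite halfline_measureE setIidl.
Qed.

Lemma halfline_integrable (f : R -> R) : measurable_fun [set: R] f ->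
  nu.-integrable [set: R] (EFin \o f) <-> mu.-integrable D (EFin \o f).
Proof.
move=> mf; have mfE : measurable_fun [set: R] (EFin \o f) by exact/measurable_EFinP.
have mfa : measurable_fun [set: R] (fun x => `|(EFin \o f) x|%E) by exact: measurableT_comp.
split=> /integrableP[_ fi]; apply/integrableP; split.
- exact: measurable_funTS.
- by move: fi; rewrite ge0_halfline_integral.
- exact: mfE.
- by rewrite ge0_halfline_integral.
Qed.

Lemma halfline_Rintegral (f : R -> R) : measurable_fun [set: R] f ->
  \int[nu]_x f x = \int[mu]_(x in D) f x.
Proof.
move=> mf; have mfE : measurable_fun [set: R] (EFin \o f) by exact/measurable_EFinP.
congr fine; rewrite integralE [RHS]integralE.
rewrite (ge0_halfline_integral (measurable_funepos mfE))//.
by rewrite (ge0_halfline_integral (measurable_funeneg mfE)).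
Qed.

Lemma test_measurable (phi : R -> R) : test phi -> measurable_fun [set: R] phi.
Proof.
by move=> tp; apply: continuous_measurable_fun => x; exact: test_continuous.
Qed.

Lemma test_integrable (phi : R -> R) : test phi -> nu.-integrable [set: R] (EFin \o phi).
Proof.
move=> tp; apply/halfline_integrable; first exact: test_measurable.
have [a [b [a0 ab v]]] := test_supp tp.
have i1 : mu.-integrable `[a, b] (EFin \o phi).
  by apply: within_continuous_integrable_on; exact: test_within.
have sub : `[a, b]%classic `<=` D.
  by move=> x /=; rewrite /D/= !in_itv/= => /andP[ax _]; rewrite (lt_le_trans a0).
have := (@integrable_mkcond _ _ _ mu _ (EFin \o phi) (measurable_itv `[a, b])).1 i1.
move=> i2; have := @integrableS _ _ _ mu setT D _ measurableT mD (@subsetT _ _) i2.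
apply: eq_integrable => // x _; rewrite patchE; case: ifPn => // /negP h /=.
rewrite v//; move: h; rewrite inE/= in_itv/= => /negP; rewrite negb_and -!ltNge.
by move=> /orP[/ltW ->|/ltW ->]; rewrite ?orbT.
Qed.

Lemma testM phi psi : @test R phi -> test psi -> test (fun x => phi x * psi x).
Proof. by move=> [sp _]; exact: testMl. Qed.

Lemma test_sqint phi : test phi -> sqint nu phi.
Proof.
move=> tp; split; first exact: test_measurable.
have := test_integrable (testM tp tp).
by under [fun x => _ * _]eq_fun do rewrite -expr2.
Qed.

Lemma sqint_locint u : sqint nu u -> locint u.
Proof.
move=> [mu_ ui] a b a0.
have iu2 : integrable_on a b (fun x => u x ^+ 2).
  have := (halfline_integrable (measurable_funX 2 mu_)).1 ui.
  apply: (@integrableS _ _ _ mu D `[a, b]%classic) => //.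
  by move=> x /=; rewrite /D/= !in_itv/= => /andP[ax _]; rewrite (lt_le_trans a0).
have i2 := integrable_onD (@integrable_on_cst R a b 1) iu2.
rewrite /integrable_on in i2; apply: (@le_integrable _ _ _ mu _ (measurable_itv _) _ _ _ _ i2).
  by apply/measurable_EFinP; exact: measurable_funTS.
move=> x _ /=; rewrite lee_fin [leRHS]ger0_norm ?addr_ge0 ?sqr_ge0//.
have := sqr_ge0 (`|u x| - 2^-1); rewrite -[u x ^+ 2]real_normK ?num_real//; nra.
Qed.

Lemma dot_pairing phi u : test phi -> sqint nu u -> dot nu phi u = pairing phi u.
Proof.
move=> tp [mu_ _]; rewrite /dot halfline_Rintegral//.
by apply: measurable_funM => //; exact: test_measurable.
Qed.

Lemma sqint_int_on_le u v : sqint nu u -> sqint nu v ->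
  exists K, forall a b, 0 < a -> a <= b -> int_on a b (fun x => u x ^+ 2 + v x ^+ 2) <= K.
Proof.
move=> [mu_ ui] [mv vi]; pose q x := u x ^+ 2 + v x ^+ 2.
have mq : measurable_fun [set: R] q by apply: measurable_funD; exact: measurable_funX.
have qi : mu.-integrable D (EFin \o q).
  by apply/halfline_integrable => //; exact: (integrableD measurableT ui vi).
exists (\int[mu]_(x in D) q x) => a b a0 ab.
have sub : `[a, b]%classic `<=` D.
  by move=> x /=; rewrite /D/= !in_itv/= => /andP[ax _]; rewrite (lt_le_trans a0).
have qab : mu.-integrable `[a, b]%classic (EFin \o q).
  by apply: (@integrableS _ _ _ mu D `[a, b]%classic).
rewrite /int_on /Rintegral fine_le//; try exact: integrable_fin_num.
apply: ge0_subset_integral => //.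
- by apply/measurable_EFinP; exact: measurable_funTS.
- by move=> x _; rewrite lee_fin addr_ge0 ?sqr_ge0.
Qed.

End halfline.

(** * Reduction of complex test functions and [tau2] to real parts *)

Section complex_test.
Context {R : realType}.
Implicit Types (f : R -> R[i]) (a b : R).

Lemma complex_vanishes f x : f x = 0 <-> complex.Re (f x) = 0 /\ complex.Im (f x) = 0.
Proof. by case: (f x) => u v /=; split=> [[-> ->]|[-> ->]]. Qed.

Lemma test_functionP f : test_function f <->
  test (fun x => complex.Re (f x)) /\ test (fun x => complex.Im (f x)).
Proof.
split; last first.
  move=> [tu tv]; have [a [b [a0 ab vu vv]]] := test2 tu tv.
  have sub : closure [set r | f r != 0] `<=` `[a, b]%classic.
    rewrite (closure_id `[a, b]%classic).1; last exact: interval_closed.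
    apply: closure_subset => x /= fx; rewrite in_itv/=.
    apply/negPn/negP; rewrite negb_and -!ltNge => h; move/negP: fx; apply; apply/eqP/complex_vanishes.
    by split; [apply: vu|apply: vv]; case/orP: h => /ltW ->; rewrite ?orbT.
  split.
  - move=> n r; split; first exact: ((smoothP _).1 tu.1).
    exact: ((smoothP _).1 tv.1).
  - by apply: (subclosed_compact _ (@segment_compact _ a b)) => //; exact: closed_closure.
  - by move=> x /sub/=; rewrite !in_itv/= andbT => /andP[ax _]; exact: lt_le_trans ax.
move=> [fs fc fsub].
have [a [b [a0 ab vf]]] : exists a b, [/\ 0 < a, a < b & forall x, (x <= a) || (b <= x) -> f x = 0].
  have [e|/set0P ne] := eqVneq (closure [set r | f r != 0]) set0.
    exists 1, 2; split=> //; first by rewrite ltr1n.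
    move=> x _; apply/eqP/negPn/negP => fx.
    have : closure [set r | f r != 0] x by exact: subset_closure.
    by rewrite e.
  have ci : {within closure [set r | f r != 0], continuous (fun x : R => x)}.
    by apply: continuous_subspaceT => x; exact: cvg_id.
  have [c /set_mem cA hc] := compact_EVT_min ne fc ci.
  have [e /set_mem eA he] := compact_EVT_max ne fc ci.
  have c0 : 0 < c by move: (fsub _ cA) => /=; rewrite in_itv/= andbT.
  have ce : c <= e by apply: hc; exact: mem_set.
  (* The extreme points c <= e of the support may carry nonzero values or coincide, while the
     interval must be nondegenerate with zeros at its ends; hence the margins. *)
  exists (c / 2), (e + 1); split; [by rewrite divr_gt0|lra|].
  move=> x h; apply/eqP/negPn/negP => fx.
  have xA : x \in closure [set r | f r != 0] by apply/mem_set; exact: subset_closure.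
  by have := hc _ xA; have := he _ xA; case/orP: h => ?; lra.
split; split.
- by apply/smoothP => n x; exact: (fs n x).1.
- by exists a, b; split=> // x /vf/complex_vanishes[].
- by apply/smoothP => n x; exact: (fs n x).2.
- by exists a, b; split=> // x /vf/complex_vanishes[].
Qed.

Lemma test_invX_derive2 phi x : @test R phi ->
  (fun s => s^-1 ^+ 2 * phi s)^`(2)%classic x =
  x^-1 ^+ 2 * phi^`(2)%classic x - 4 * (x^-1 ^+ 3 * phi^`(1)%classic x) + 6 * (x^-1 ^+ 4 * phi x).
Proof.
move=> tp.
have E1 : (fun s => s^-1 ^+ 2 * phi s)^`()%classic =
    (fun s => s^-1 ^+ 2 * phi^`()%classic s + (- 2) * (s^-1 ^+ 3 * phi s)).
  by apply: derive1_ext => y; exact: test_invX_derive.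
have -> : (fun s => s^-1 ^+ 2 * phi s)^`(2)%classic x =
   ((fun s => s^-1 ^+ 2 * phi s)^`()%classic)^`()%classic x by [].
rewrite E1; apply: is_derive1_derive1.
have d2 := test_invX_derive 2 x (test_derive1 tp).
have d3 := test_invX_derive 3 x tp.
apply: is_derive_eq (is_derive1_add d2 (is_derive1_mul (is_derive1_cst (- 2) x) d3)) _.
have -> : phi^`(2)%classic x = (phi^`()%classic)^`()%classic x by [].
rewrite derive1n1; ring.
Qed.

Lemma Complex_eq (a b a' b' : R) : a = a' -> b = b' -> Complex a b = Complex a' b'.
Proof. by move=> -> ->. Qed.

Let tau2_parts (c1 c2 k2 k4 : R) (d4 d2 e2 f0 : R[i]) :
  d4 + real_complex R c1 * (real_complex R k2 * d2 + e2) + real_complex R c2 * real_complex R k4 * f0 =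
  Complex (complex.Re d4 + c1 * (k2 * complex.Re d2 + complex.Re e2) + c2 * (k4 * complex.Re f0))
    (complex.Im d4 + c1 * (k2 * complex.Im d2 + complex.Im e2) + c2 * (k4 * complex.Im f0)).
Proof. by case: d4 d2 e2 f0 => [? ?] [? ?] [? ?] [? ?]; apply: Complex_eq => /=; ring. Qed.

Let tau2_algebra (c1 c2 d4 p2 p1 p0 : R) :
  d4 + c1 * (p2 + (p2 - 4 * p1 + 6 * p0)) + c2 * p0 =
  d4 + 2 * c1 * p2 + (- (4 * c1)) * p1 + (6 * c1 + c2) * p0.
Proof. by ring. Qed.

Lemma tau2E c1 c2 f x : test_function f -> tau2 c1 c2 f x =
  Complex (tau c1 c2 (fun x => complex.Re (f x)) x) (tau c1 c2 (fun x => complex.Im (f x)) x).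
Proof.
move=> /test_functionP[tu tv].
have ER : (fun s => complex.Re (real_complex R (s ^- 2) * f s)) = (fun s => s^-1 ^+ 2 * complex.Re (f s)).
  by apply/funext => s; rewrite exprVn; case: (f s) => a b /=; ring.
have EI : (fun s => complex.Im (real_complex R (s ^- 2) * f s)) = (fun s => s^-1 ^+ 2 * complex.Im (f s)).
  by apply/funext => s; rewrite exprVn; case: (f s) => a b /=; ring.
rewrite /tau2 tau2_parts /Cderiv ER EI -!exprVn.
rewrite (test_invX_derive2 x tu) (test_invX_derive2 x tv).
by apply: Complex_eq; exact: tau2_algebra.
Qed.

End complex_test.

(** * Scalar product and distance of L^2 in terms of real and imaginary parts *)

Section L2C_parts.
Context d (T : measurableType d) (R : realType) (mu : {measure set T -> \bar R}).
Implicit Types f g : L2C mu.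

Definition L2part f (b : bool) : T -> R := fun x => if b then complex.Im (f x) else complex.Re (f x).

Lemma LspaceType2_sqint (h : LspaceType2 mu) : sqint mu (h : T -> R).
Proof.
have mh : measurable_fun [set: T] (h : T -> R).
  by case: h => c ?; exact: (measurable_funPT (repr c)).
apply/sqint_Lfun; rewrite inE; apply/andP; rewrite !inE/=; split=> //.
exact: Lebesgue_finite.
Qed.

Lemma L2part_sqint f b : sqint mu (L2part f b).
Proof. by case: b; exact: LspaceType2_sqint. Qed.

Lemma L2_dotE f g : L2_dot f g =
  Complex (dot mu (L2part f false) (L2part g false) + dot mu (L2part f true) (L2part g true))
          (dot mu (L2part f true) (L2part g false) - dot mu (L2part f false) (L2part g true)).
Proof.
have i (b b' : bool) := sqint_mul (L2part_sqint f b) (L2part_sqint g b').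
rewrite /L2_dot /Cintegral /dot -RintegralD// -RintegralB//.
apply: Complex_eq; apply: eq_Rintegral => x _; rewrite /L2part;
  case: (f x) (g x) => a b [a' b'] /=; ring.
Qed.

Definition sqdist f g : R := sqnorm mu (fun x => L2part f false x - L2part g false x) +
  sqnorm mu (fun x => L2part f true x - L2part g true x).

Lemma L2_distE f g : L2_dist f g = (Num.sqrt (sqdist f g))%:E.
Proof.
have s b := sqintB (L2part_sqint f b) (L2part_sqint g b).
have mq := measurable_funX 2.
rewrite /L2_dist unlock /sqdist /sqnorm.
have -> : (\int[mu]_x `|(complex.Re `|f x - g x|)%:E| `^ 2 =
  (dot mu (fun x => L2part f false x - L2part g false x) (fun x => L2part f false x - L2part g false x)
  + dot mu (fun x => L2part f true x - L2part g true x) (fun x => L2part f true x - L2part g true x))%:E)%E.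
  rewrite EFinD -!dotE// -ge0_integralD//.
  - apply: eq_integral => x _.
    have -> : complex.Re `|f x - g x| = Num.sqrt ((L2part f false x - L2part g false x) ^+ 2 +
        (L2part f true x - L2part g true x) ^+ 2).
      by rewrite normc_def /L2part; case: (f x) (g x) => a b [a' b'].
    rewrite abse_EFin poweR_EFin powR_mulrn//.
    by rewrite real_normK ?num_real// sqr_sqrtr ?addr_ge0 ?sqr_ge0.
  - by move=> x _; rewrite lee_fin sqr_ge0.
  - by apply/measurable_EFinP; apply: measurable_funX; exact: (s false).1.
  - by move=> x _; rewrite lee_fin sqr_ge0.
  - by apply/measurable_EFinP; apply: measurable_funX; exact: (s true).1.
by rewrite poweR_EFin powR12_sqrt// addr_ge0 ?dot_ge0.
Qed.

Lemma L2_dist_lt f g e : 0 < e -> (L2_dist f g < e%:E)%E <-> sqdist f g < e ^+ 2.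
Proof.
move=> e0; rewrite L2_distE lte_fin -{1}[e]ger0_norm ?ltW// -sqrtr_sqr.
by rewrite ltr_sqrt// exprn_gt0.
Qed.

Lemma L2C_parts_exist (u v : T -> R) : sqint mu u -> sqint mu v -> exists f,
  {ae mu, forall x, L2part f false x = u x} /\ {ae mu, forall x, L2part f true x = v x}.
Proof.
move=> /sqint_Lfun su /sqint_Lfun sv.
have [f hf] := @L2C_exists _ T R mu (fun x => Complex (u x) (v x)) su sv.
exists f; split; apply: filterS hf => x E.
  by move: E; rewrite /L2part; case: (L2C_fun f x) => a b [-> _].
by move: E; rewrite /L2part; case: (L2C_fun f x) => a b [_ ->].
Qed.

End L2C_parts.

(** * Classical functions in the weak equation, and symmetry on test functions *)

Section classical_weak.
Context {R : realType}.
Implicit Types (f g phi psi u v : R -> R).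
Variables c1 c2 : R.

Lemma pairing_by_parts phi f g : test phi -> (forall x : R, 0 < x -> is_derive x 1 f (g x)) ->
  contpos g -> pairing (phi^`()%classic) f = - pairing phi g.
Proof.
move=> tp df cg; have tp' := test_derive1 tp.
have cf : contpos f by move=> x x0; exact: is_derive1_continuous (df x x0).
have [a [b [a0 ab v v']]] := test2 tp tp'.
rewrite (pairingE _ a0 v) (pairingE _ a0 v').
have dp x : a <= x <= b -> is_derive x 1 (fun y => phi y * f y) (phi x * g x + phi^`()%classic x * f x).
  move=> /andP[ax _]; have dphi : is_derive x 1 phi (phi^`()%classic x) by apply: smooth_is_derive; case: tp.
  apply: is_derive_eq (is_derive1_mul dphi (df x (lt_le_trans a0 ax))) _; ring.
have i1 : integrable_on a b (fun x => phi x * g x) by apply: integrable_on_test => //; exact: contpos_locint.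
have i2 : integrable_on a b (fun x => phi^`()%classic x * f x).
  by apply: integrable_on_test => //; exact: contpos_locint.
apply/eqP; rewrite -addr_eq0 addrC -int_onD//.
rewrite (fundamental_int_on (ltW ab) dp); first by rewrite !v ?lexx ?orbT// !mul0r subrr.
move=> x /andP[ax _]; have x0 := lt_le_trans a0 ax.
apply: cvgD; (apply: cvgM; first exact: test_continuous); [exact: cg|exact: cf].
Qed.

Let weak_classical_algebra (P4 P2 P1 U4 A2 A1 A0 : R) :
  P4 = U4 -> P2 = A2 + - (4%:R) * A1 + 6 * A0 -> P1 = - (A1 + - (3%:R) * A0) ->
  P4 + 2 * c1 * P2 + - (4 * c1) * P1 + (6 * c1 + c2) * A0 =
  U4 + 2 * c1 * A2 + (- (4 * c1)) * A1 + (6 * c1 + c2) * A0 - 0.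
Proof. by move=> -> -> ->; ring. Qed.

(** Integration by parts has no boundary terms, because phi vanishes near 0 and for large x. It
    serves twice: with a test function as u0 for symmetry, and with the lifted cut-off solutions for
    necessity. *)
Lemma weak_classical (u0 u1 u2 u3 u4 : R -> R) phi :
  (forall x : R, 0 < x -> is_derive x 1 u0 (u1 x)) -> (forall x : R, 0 < x -> is_derive x 1 u1 (u2 x)) ->
  (forall x : R, 0 < x -> is_derive x 1 u2 (u3 x)) -> (forall x : R, 0 < x -> is_derive x 1 u3 (u4 x)) ->
  contpos u4 -> test phi ->
  pairing (tau c1 c2 phi) u0 = pairing phi (fun x => u4 x + lower_order c1 c2 u0 u1 u2 x).
Proof.
move=> d0 d1 d2 d3 cu4 tp.
have cu0 : contpos u0 by move=> x x0; exact: is_derive1_continuous (d0 x x0).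
have cu1 : contpos u1 by move=> x x0; exact: is_derive1_continuous (d1 x x0).
have cu2 : contpos u2 by move=> x x0; exact: is_derive1_continuous (d2 x x0).
have cu3 : contpos u3 by move=> x x0; exact: is_derive1_continuous (d3 x x0).
have cM k (h : R -> R) : contpos h -> contpos (fun x => x^-1 ^+ k * h x).
  by move=> ch x x0; apply: cvgM; [exact: contpos_invX|exact: ch].
have dM k (h h' : R -> R) : (forall x : R, 0 < x -> is_derive x 1 h (h' x)) ->
    forall x : R, 0 < x -> is_derive x 1 (fun s => s^-1 ^+ k * h s)
      (x^-1 ^+ k * h' x + - (k%:R) * (x^-1 ^+ k.+1 * h x)).
  move=> dh x x0; have di := is_derive1_invr (lt0r_neq0 x0); have dhx := dh x x0.
  by is_derive_tac; case: k => [|k] /=; [ring|rewrite !exprS; ring].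
have t1 := test_derive1n 1 tp; have t2 := test_derive1n 2 tp; have t3 := test_derive1n 3 tp.
have t4 := test_derive1n 4 tp.
rewrite /tau (@pairing_combination_l _ (2 * c1) (- (4 * c1)) (6 * c1 + c2) (phi^`(4)%classic)
  (fun x => x^-1 ^+ 2 * phi^`(2)%classic x) (fun x => x^-1 ^+ 3 * phi^`(1)%classic x)
  (fun x => x^-1 ^+ 4 * phi x))//; [|exact: test_invX..|exact: contpos_locint].
rewrite !pairing_shift.
have E4 : pairing (phi^`(4)%classic) u0 = pairing phi u4.
  rewrite (derive1nS phi 3) (pairing_by_parts t3 d0 cu1) (derive1nS phi 2) (pairing_by_parts t2 d1 cu2).
  by rewrite (derive1nS phi 1) (pairing_by_parts t1 d2 cu3) derive1n1 (pairing_by_parts tp d3 cu4) !opprK.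
have L k (h : R -> R) : contpos h -> locint (fun x => x^-1 ^+ k * h x).
  by move=> ch; apply/contpos_locint/cM.
have E2 : pairing (phi^`(2)%classic) (fun x => x^-1 ^+ 2 * u0 x) =
    pairing phi (fun x => x^-1 ^+ 2 * u2 x) + - 4%:R * pairing phi (fun x => x^-1 ^+ 3 * u1 x)
    + 6 * pairing phi (fun x => x^-1 ^+ 4 * u0 x).
  pose g1 x := x^-1 ^+ 2 * u1 x + - 2%:R * (x^-1 ^+ 3 * u0 x).
  pose g2 x := x^-1 ^+ 2 * u2 x + - 4%:R * (x^-1 ^+ 3 * u1 x) + 6 * (x^-1 ^+ 4 * u0 x).
  have cg1 : contpos g1 by apply: contposD; [exact: cM|apply: contposZ; exact: cM].
  have cg2 : contpos g2.
    by apply: contposD; [apply: contposD; [|apply: contposZ]|apply: contposZ]; exact: cM.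
  have dg1 (x : R) : 0 < x -> is_derive x 1 g1 (g2 x).
    move=> x0; have h1 := dM 2 _ _ d1 x x0; have h2 := dM 3 _ _ d0 x x0.
    apply: is_derive_eq (is_derive1_add h1 (is_derive1_mul (is_derive1_cst (- 2%:R) x) h2)) _.
    by rewrite /g2; ring.
  rewrite (derive1nS phi 1) (pairing_by_parts t1 (dM 2 _ _ d0) cg1) derive1n1.
  rewrite (pairing_by_parts tp dg1 cg2) opprK /g2.
  rewrite pairingDr//; [|by apply: locintD; [|apply: locintZ]; exact: L|by apply: locintZ; exact: L].
  rewrite pairingDr//; [|exact: L|by apply: locintZ; exact: L].
  by rewrite !pairingZr//; exact: L.
have E1 : pairing (phi^`(1)%classic) (fun x => x^-1 ^+ 3 * u0 x) =
    - (pairing phi (fun x => x^-1 ^+ 3 * u1 x) + - 3%:R * pairing phi (fun x => x^-1 ^+ 4 * u0 x)).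
  rewrite derive1n1 (pairing_by_parts tp (dM 3 _ _ d0)); last first.
    by apply: contposD; [|apply: contposZ]; exact: cM.
  rewrite pairingDr//; [|exact: L|by apply: locintZ; exact: L].
  by rewrite pairingZr//; exact: L.
apply: (eq_trans (weak_classical_algebra E4 E2 E1)).
have l0 : locint (fun=> (0 : R)) by exact: locint_cst.
have P0 : pairing phi (fun=> 0) = 0.
  transitivity (0 * pairing phi (fun=> 0)); last exact: mul0r.
  by rewrite -(pairingZr _ tp l0); congr pairing; apply/funext => x; rewrite mul0r.
rewrite -[X in _ - X = _]P0 -pairing_combination_r//; [|exact: contpos_locint|exact: L..].
by congr pairing; apply/funext => x; rewrite /lower_order; ring.
Qed.

Let tau_lower_order (d4 d2 d1 d0 i2 i3 i4 : R) :
  d4 + (2 * c1 * i2 * d2 - 4 * c1 * i3 * d1 + (6 * c1 + c2) * i4 * d0) =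
  d4 + 2 * c1 * (i2 * d2) + (- (4 * c1)) * (i3 * d1) + (6 * c1 + c2) * (i4 * d0).
Proof. by ring. Qed.

Lemma tau_symmetric phi psi : test phi -> test psi ->
  pairing (tau c1 c2 phi) psi = pairing phi (tau c1 c2 psi).
Proof.
move=> tp ts; have d k (x : R) : is_derive x 1 (psi^`(k)%classic) (psi^`(k.+1)%classic x).
  by rewrite derive1nS; apply: smooth_is_derive; case: (test_derive1n k ts).
rewrite (weak_classical (fun x _ => d 0%N x) (fun x _ => d 1%N x) (fun x _ => d 2%N x)
  (fun x _ => d 3%N x) _ tp); last by move=> x _; apply/test_continuous/test_derive1n.
congr pairing; apply/funext => x; rewrite /tau /lower_order; exact: tau_lower_order.
Qed.

End classical_weak.

Section dot_estimates.
Context d (T : measurableType d) (R : realType) (mu : {measure set T -> \bar R}).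
Local Notation dot := (dot mu).
Local Notation sqint := (sqint mu).
Implicit Types f g h : T -> R.

Lemma dotr0 f : dot f (fun=> 0) = 0.
Proof. by rewrite /dot; under eq_Rintegral do rewrite mulr0; rewrite /Rintegral integral0. Qed.

Lemma dotBr f g h : sqint f -> sqint g -> sqint h ->
  dot h (fun x => f x - g x) = dot h f - dot h g.
Proof. by move=> sf sg sh; rewrite dotC (dotB sf sg sh) (dotC mu f) (dotC mu g). Qed.

Lemma dotNr f g : sqint f -> sqint g -> dot g (fun x => - f x) = - dot g f.
Proof.
move=> sf sg; rewrite -mulN1r (dotC mu g f) -(dotZ _ sf sg) dotC; congr (dot _ _).
by apply/funext => x; rewrite mulN1r.
Qed.

Let young_algebra (a b c k : R) : 0 <= a -> 0 <= b -> 0 < k ->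
  0 <= k ^+ 2 * a + 2 * k * c + b -> 0 <= k ^+ 2 * a - 2 * k * c + b ->
  `|c| <= k * a + k^-1 * b.
Proof.
move=> a0 b0 k0 h1 h2.
have ki : 0 < k^-1 by rewrite invr_gt0.
have E : k^-1 * k = 1 by rewrite mulVf// gt_eqF.
have e1 := mulr_ge0 (ltW ki) h1; have e2 := mulr_ge0 (ltW ki) h2.
have E1 : k^-1 * (k ^+ 2 * a + 2 * k * c + b) = (k^-1 * k) * (k * a + 2 * c) + k^-1 * b by ring.
have E2 : k^-1 * (k ^+ 2 * a - 2 * k * c + b) = (k^-1 * k) * (k * a - 2 * c) + k^-1 * b by ring.
rewrite E1 E mul1r in e1; rewrite E2 E mul1r in e2.
have ka : 0 <= k * a by rewrite mulr_ge0// ltW.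
have kb : 0 <= k^-1 * b by rewrite mulr_ge0// ltW.
by rewrite ler_norml; apply/andP; split; lra.
Qed.

Lemma dot_young f g k : sqint f -> sqint g -> 0 < k ->
  `|dot f g| <= k * dot f f + k^-1 * dot g g.
Proof.
move=> sf sg k0; have skf := sqintZ k sf.
apply: young_algebra => //; [exact: dot_ge0|exact: dot_ge0| |].
- have := dot_ge0 mu (fun x => k * f x + g x); have sD := sqintD skf sg.
  rewrite (dotD skf sg sD) (dotC mu _ (fun x => k * f x + g x)) (dotC mu g (fun x => k * f x + g x)).
  rewrite (dotD skf sg skf) (dotD skf sg sg) (dotC mu g) !(dotZ k sf)// (dotC mu f (fun x => k * f x)).
  by rewrite (dotZ k sf sf); set A := dot f f; set B := dot f g; set C := dot g g; move: A B C => A B C; lra.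
- have := dot_ge0 mu (fun x => k * f x - g x); have sD := sqintB skf sg.
  rewrite (dotB skf sg sD) (dotBr skf sg skf) (dotBr skf sg sg) (dotC mu g) !(dotZ k sf)// (dotC mu f (fun x => k * f x)).
  by rewrite (dotZ k sf sf); set A := dot f f; set B := dot f g; set C := dot g g; move: A B C => A B C; lra.
Qed.

End dot_estimates.

(** * Closure and adjoint for real functions *)

Section weak_graph.
Context {R : realType}.
Local Notation nu := (halfline_measure R).
Local Notation dot := (dot nu).
Local Notation sqint := (sqint nu).
Local Notation sqnorm := (sqnorm nu).
Implicit Types (f g phi psi u v : R -> R) (e : R).
Variables c1 c2 : R.
Local Notation tau := (tau c1 c2).

(** The graph of the adjoint in real form; [closed_graph] below is that of the closure. The links
    with the operators are [adjointP] and [op_closureP]. *)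
Definition weak_graph u v := forall phi, test phi -> dot (tau phi) u = dot phi v.

Definition closed_graph u v := forall e, 0 < e -> exists phi,
  [/\ test phi, sqnorm (fun x => phi x - u x) < e & sqnorm (fun x => tau phi x - v x) < e].

Lemma sqint_tau phi : test phi -> sqint (tau phi).
Proof. by move=> tp; apply/test_sqint/test_tau. Qed.

Lemma weak_closed_dot a b u v : sqint a -> sqint b -> sqint u -> sqint v ->
  weak_graph a b -> closed_graph u v -> dot b u = dot a v.
Proof.
move=> sa sb su sv ab uv.
apply/eqP; rewrite -subr_eq0 -normr_le0; apply/ler_addgt0Pl => e e0; rewrite addr0.
(* Each of the two errors is at most k times a squared norm plus k, together k M = e. *)
pose M := dot a a + dot b b + 2.
have M0 : 0 < M by rewrite /M ltr_wpDl ?addr_ge0 ?dot_ge0.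
pose k := e / M; have k0 : 0 < k by rewrite divr_gt0.
have [phi [tp h1 h2]] := uv (k ^+ 2) (exprn_gt0 2 k0).
have sp := test_sqint tp; have st := sqint_tau tp.
have E : dot b u - dot a v = - dot b (fun x => phi x - u x) + dot a (fun x => tau phi x - v x).
  have E1 : dot a (tau phi) = dot b phi by rewrite dotC (ab _ tp) dotC.
  by rewrite (dotBr sp su sb) (dotBr st sv sa) E1 opprB addrA subrK.
rewrite E (le_trans (ler_normD _ _))// normrN.
have y1 := dot_young sb (sqintB sp su) k0; have y2 := dot_young sa (sqintB st sv) k0.
apply: (le_trans (lerD y1 y2)).
have z (q : R) : q < k ^+ 2 -> k^-1 * q <= k.
  by move=> qk; rewrite mulrC ler_pdivrMr// -expr2 ltW.
have := z _ h1; have := z _ h2; rewrite /sqnorm.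
have Ek : k * M = e by rewrite /k divfK// gt_eqF.
move: Ek; rewrite /M; move: (dot a a) (dot b b) => A B.
move: (k^-1 * _) (k^-1 * _) => q1 q2 Ek; lra.
Qed.

Lemma tau_linear phi psi c : test phi -> test psi ->
  tau (fun x => phi x + c * psi x) = fun x => tau phi x + c * tau psi x.
Proof.
move=> [sp _] [ss _]; apply/funext => x; rewrite /tau !derive1n_linear//.
move: (phi^`(4)%classic x) (phi^`(2)%classic x) (phi^`(1)%classic x) (phi x) => a4 a2 a1 a0.
move: (psi^`(4)%classic x) (psi^`(2)%classic x) (psi^`(1)%classic x) (psi x) => b4 b2 b1 b0.
ring.
Qed.

Lemma tau0 : tau (fun=> 0) = fun=> 0.
Proof.
have := tau_linear (-1) (@test0 R) (@test0 R).
have -> : (fun x : R => 0 + -1 * 0) = (fun=> 0 : R) by apply/funext => x; ring.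
by move=> E; rewrite E; apply/funext => x; ring.
Qed.

Lemma test_weak phi : test phi -> weak_graph phi (tau phi).
Proof.
move=> tp psi ts; rewrite !dot_pairing//; [exact: tau_symmetric|exact: sqint_tau|exact: test_tau|exact: test_sqint].
Qed.

Lemma closed_weak u v : sqint u -> sqint v -> closed_graph u v -> weak_graph u v.
Proof.
move=> su sv uv phi tp.
exact: (weak_closed_dot (test_sqint tp) (sqint_tau tp) su sv (test_weak tp) uv).
Qed.

Lemma sqnorm_ae f g : sqint f -> sqint g -> {ae nu, forall x, f x = g x} -> sqnorm f = sqnorm g.
Proof. by move=> sf sg fg; exact: dot_ae. Qed.

Lemma halfline_ae_imply (P Q : R -> Prop) : (forall x, P x -> Q x) ->
  {ae nu, forall x, P x} -> {ae nu, forall x, Q x}.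
Proof.
by move=> PQ; apply: filterS; first exact: (ae_filter_ringOfSetsType nu).
Qed.

(** The residue of the projection of (u, 0) onto the pairs (test function, 0) is orthogonal to all
    test functions, hence zero by [fundamental_lemma]. *)
Lemma test_dense u e : sqint u -> 0 < e ->
  exists2 phi, test phi & sqnorm (fun x => phi x - u x) < e.
Proof.
move=> su e0.
pose W f g : Prop := test f /\ g = (fun=> 0 : R).
have [||||||y1 [y2 [sy1 _ h1 h2]]] := @pair_projection _ _ R nu W u (fun=> 0).
- by move=> f g [tf ->]; split; [exact: test_sqint|exact: sqint0].
- by split=> //; exact: test0.
- by move=> f g f' g' [tf ->] [tf' ->]; split; [exact: testD|apply/funext => x; rewrite addr0].
- by move=> c f g [tf ->]; split; [exact: testZ|apply/funext => x; rewrite mulr0].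
- exact: su.
- exact: sqint0.
have [phi [_ [[tp _] hp _]]] := h1 e e0.
exists phi => //.
have sd := sqintB su sy1.
have z : {ae nu, forall x, u x - y1 x = 0}.
  apply/halfline_ae/fundamental_lemma; first exact: sqint_locint.
  move=> psi ts; rewrite -dot_pairing// dotC.
  by have := h2 psi (fun=> 0) (conj ts erefl); rewrite dotr0 addr0.
rewrite (_ : sqnorm _ = sqnorm (fun x => phi x - y1 x))//.
have sp := test_sqint tp.
apply: sqnorm_ae; [exact: sqintB|exact: sqintB|].
by apply: halfline_ae_imply z => x /eqP; rewrite subr_eq0 => /eqP ->.
Qed.

Lemma weak_closed u v : stable_roots (5 / 4 - c1) (9 / 16 + 3 / 2 * c1 + c2) ->
  sqint u -> sqint v -> weak_graph u v -> closed_graph u v.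
Proof.
move=> st su sv uv.
pose W f g : Prop := test f /\ g = tau f.
have [||||||y1 [y2 [sy1 sy2 h1 h2]]] := @pair_projection _ _ R nu W u v.
- by move=> f g [tf ->]; split; [exact: test_sqint|exact: sqint_tau].
- by split; [exact: test0|rewrite tau0].
- move=> f g f' g' [tf ->] [tf' ->]; split; first exact: testD.
  have := tau_linear 1 tf tf'.
  rewrite (_ : (fun x => f x + 1 * f' x) = (fun x => f x + f' x)) => [->|]; apply/funext => x; rewrite mul1r//.
- move=> c f g [tf ->]; split; first exact: testZ.
  have := tau_linear c (@test0 R) tf; rewrite tau0.
  rewrite (_ : (fun x => 0 + c * f x) = (fun x => c * f x)) => [->|]; apply/funext => x; rewrite add0r//.
- exact: su.
- exact: sv.
have cy : closed_graph y1 y2.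
  by move=> e e0; have [f [_ [[tf ->] ? ?]]] := h1 e e0; exists f.
have wy := closed_weak sy1 sy2 cy.
have sa := sqintB su sy1; have sb := sqintB sv sy2.
have z : {ae nu, forall x, u x - y1 x = 0 /\ v x - y2 x = 0}.
  apply/halfline_ae.
  apply: (@weak_deficiency_trivial R c1 c2 (fun x => u x - y1 x) (fun x => v x - y2 x) st).
  - exact: sqint_locint.
  - exact: sqint_locint.
  - move=> phi tp; rewrite -(dot_pairing (test_tau _ _ tp) sa) -(dot_pairing tp sb).
    have sp := test_sqint tp; have stp := sqint_tau tp.
    by rewrite !dotBr// uv// wy.
  - move=> phi tp.
    have sp := test_sqint tp; have stp := sqint_tau tp.
    have sna : sqint (fun x => - (u x - y1 x)).
      by have := sqintZ (-1) sa; under eq_fun do rewrite mulN1r.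
    rewrite -(dot_pairing (test_tau _ _ tp) sb) -(dot_pairing tp sna).
    rewrite (dotNr sa sp).
    (* Orthogonality to the graph is precisely the second deficiency equation for the residue. *)
    have := h2 phi (tau phi) (conj tp erefl).
    rewrite (dotC nu (fun x => u x - y1 x) phi) (dotC nu (fun x => v x - y2 x) (tau phi)).
    by rewrite addrC => /eqP; rewrite addr_eq0 => /eqP.
  - exact: sqint_int_on_le.
move=> e e0; have [phi [tp p1 p2]] := cy e e0; exists phi.
have sp := test_sqint tp; have stp := sqint_tau tp.
split=> //.
- rewrite (_ : sqnorm _ = sqnorm (fun x => phi x - y1 x))//.
  apply: sqnorm_ae; [exact: sqintB|exact: sqintB|].
  by apply: halfline_ae_imply z => x [/eqP]; rewrite subr_eq0 => /eqP ->.
- rewrite (_ : sqnorm _ = sqnorm (fun x => tau phi x - y2 x))//.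
  apply: sqnorm_ae; [exact: sqintB|exact: sqintB|].
  by apply: halfline_ae_imply z => x [_ /eqP]; rewrite subr_eq0 => /eqP ->.
Qed.

End weak_graph.

(** * The complex operator, its closure and its adjoint *)

Section complex_operator.
Context {R : realType}.
Local Notation nu := (halfline_measure R).
Implicit Types (phi psi u v : R -> R) (e : R) (p q : L2C nu * L2C nu).
Variables c1 c2 : R.
Local Notation tau := (tau c1 c2).
Local Notation weak_graph := (weak_graph c1 c2).
Local Notation closed_graph := (closed_graph c1 c2).
Local Notation A := (tau2_op c1 c2).

Lemma halfline_ae2 (P1 P2 Q : R -> Prop) : (forall x, P1 x -> P2 x -> Q x) ->
  {ae nu, forall x, P1 x} -> {ae nu, forall x, P2 x} -> {ae nu, forall x, Q x}.
Proof. by move=> PQ; apply: filterS2; first exact: (ae_filter_ringOfSetsType nu). Qed.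

Lemma tau2_opP p : A p <-> exists phi : bool -> R -> R,
  [/\ forall b, test (phi b), forall b, {ae nu, forall x, L2part p.1 b x = phi b x} &
    forall b, {ae nu, forall x, L2part p.2 b x = tau (phi b) x}].
Proof.
split=> [[f [tf h1 h2]]|[phi [tp h1 h2]]].
  have [tu tv] := (test_functionP f).1 tf.
  exists (fun b => if b then (fun x => complex.Im (f x)) else (fun x => complex.Re (f x))); split.
  - by case.
  - by move=> b; apply: halfline_ae_imply h1 => x; rewrite /L2part => ->; case: b.
  - move=> b; apply: halfline_ae_imply h2 => x; rewrite /L2part => ->; rewrite tau2E//.
    by case: b.
pose f x := Complex (phi false x) (phi true x).
have tf : test_function f by apply/test_functionP; split; [exact: (tp false)|exact: (tp true)].
exists f; split=> //.
- apply: halfline_ae2 (h1 false) (h1 true) => x; rewrite /L2part /f => <- <-.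
  by case: (L2C_fun p.1 x).
- apply: halfline_ae2 (h2 false) (h2 true) => x; rewrite tau2E// /L2part /f => <- <-.
  by case: (L2C_fun p.2 x).
Qed.

Lemma tau2_op_exists phi psi : test phi -> test psi -> exists2 p, A p &
  [/\ {ae nu, forall x, L2part p.1 false x = phi x}, {ae nu, forall x, L2part p.1 true x = psi x},
      {ae nu, forall x, L2part p.2 false x = tau phi x} & {ae nu, forall x, L2part p.2 true x = tau psi x}].
Proof.
move=> tp ts.
have [f [f1 f2]] := L2C_parts_exist (test_sqint tp) (test_sqint ts).
have [g [g1 g2]] := L2C_parts_exist (sqint_tau c1 c2 tp) (sqint_tau c1 c2 ts).
exists (f, g) => //; apply/tau2_opP; exists (fun b => if b then psi else phi).
by split; case.
Qed.

Lemma adjointP q : adjoint A q <-> forall b, weak_graph (L2part q.1 b) (L2part q.2 b).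
Proof.
split=> [hq b phi tp|hq p /tau2_opP[phi [tp h1 h2]]].
  (* A real test function suffices: the real and imaginary parts of the complex identity then give
     the two values of b. *)
  have [p Ap [p1 p2 p3 p4]] := tau2_op_exists tp (@test0 R).
  have := hq p Ap; rewrite !L2_dotE.
  have st := sqint_tau c1 c2 tp; have sp := test_sqint tp.
  have s0 : sqint nu (fun=> 0) := sqint0 nu.
  have s := L2part_sqint.
  have p4' : {ae nu, forall x, L2part p.2 true x = (fun=> 0) x}.
    by apply: halfline_ae_imply p4 => x; rewrite tau0.
  have e1 b' : dot nu (L2part p.2 false) (L2part q.1 b') = dot nu (tau phi) (L2part q.1 b').
    by apply: dot_ae => //; exact: nearW.
  have e2 b' : dot nu (L2part p.1 false) (L2part q.2 b') = dot nu phi (L2part q.2 b').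
    by apply: dot_ae => //; exact: nearW.
  have e3 b' : dot nu (L2part p.2 true) (L2part q.1 b') = 0.
    rewrite -(dotr0 nu (L2part q.1 b')) dotC; apply: dot_ae => //; exact: nearW.
  have e4 b' : dot nu (L2part p.1 true) (L2part q.2 b') = 0.
    rewrite -(dotr0 nu (L2part q.2 b')) dotC; apply: dot_ae => //; exact: nearW.
  rewrite !e1 !e2 !e3 !e4 !addr0 !sub0r => -[r1 /oppr_inj r2].
  by case: b.
have s := L2part_sqint.
have e b b' : dot nu (L2part p.2 b) (L2part q.1 b') = dot nu (L2part p.1 b) (L2part q.2 b').
  transitivity (dot nu (tau (phi b)) (L2part q.1 b')).
    by apply: dot_ae => //; [exact: sqint_tau|exact: nearW].
  rewrite (hq b' _ (tp b)); apply/esym/dot_ae => //; [exact: test_sqint|exact: nearW].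
by rewrite !L2_dotE !e.
Qed.

Lemma op_closureP q : op_closure A q <-> forall b, closed_graph (L2part q.1 b) (L2part q.2 b).
Proof.
have s := L2part_sqint.
split=> [hq b e e0|hq e e0].
  have se : 0 < Num.sqrt e by rewrite sqrtr_gt0.
  have [p [/tau2_opP[phi [tp h1 h2]] /(L2_dist_lt _ _ se) d1 /(L2_dist_lt _ _ se) d2]] := hq _ se.
  rewrite sqr_sqrtr ?ltW// in d1; rewrite sqr_sqrtr ?ltW// in d2.
  exists (phi b); split=> //.
  - have sp := test_sqint (tp b).
    have -> : sqnorm nu (fun x => phi b x - L2part q.1 b x) =
        sqnorm nu (fun x => L2part p.1 b x - L2part q.1 b x).
      apply: sqnorm_ae; [exact: sqintB|exact: sqintB|].
      by apply: halfline_ae_imply (h1 b) => x ->.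
    by apply: le_lt_trans d1; case: b {sp}; rewrite /sqdist ?lerDl ?lerDr dot_ge0.
  - have sp := sqint_tau c1 c2 (tp b).
    have -> : sqnorm nu (fun x => tau (phi b) x - L2part q.2 b x) =
        sqnorm nu (fun x => L2part p.2 b x - L2part q.2 b x).
      apply: sqnorm_ae; [exact: sqintB|exact: sqintB|].
      by apply: halfline_ae_imply (h2 b) => x ->.
    by apply: le_lt_trans d2; case: b {sp}; rewrite /sqdist ?lerDl ?lerDr dot_ge0.
have e2 : 0 < e ^+ 2 / 2 by rewrite divr_gt0 ?exprn_gt0.
have [phi [tp p1 p2]] := hq false _ e2; have [psi [ts q1 q2]] := hq true _ e2.
have [p Ap [r1 r2 r3 r4]] := tau2_op_exists tp ts.
have z (w : R -> R) (f : L2C nu) (g : L2C nu) b : sqint nu w -> {ae nu, forall x, L2part f b x = w x} ->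
    sqnorm nu (fun x => L2part f b x - L2part g b x) = sqnorm nu (fun x => w x - L2part g b x).
  move=> sw fw; apply: sqnorm_ae; [exact: sqintB|exact: sqintB|].
  by apply: halfline_ae_imply fw => x ->.
exists p; split=> //; apply/L2_dist_lt => //; rewrite /sqdist.
- rewrite (z _ _ _ _ (test_sqint tp) r1) (z _ _ _ _ (test_sqint ts) r2).
  by rewrite (splitr (e ^+ 2)) ltrD.
- rewrite (z _ _ _ _ (sqint_tau c1 c2 tp) r3) (z _ _ _ _ (sqint_tau c1 c2 ts) r4).
  by rewrite (splitr (e ^+ 2)) ltrD.
Qed.

Lemma sub_op_closure : A `<=` op_closure A.
Proof.
move=> p Ap e e0; exists p; have z (f : L2C nu) : (L2_dist f f < e%:E)%E.
  apply/L2_dist_lt => //; rewrite /sqdist.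
  have E b : sqnorm nu (fun x => L2part f b x - L2part f b x) = 0.
    rewrite -(dotr0 nu (fun x => L2part f b x - L2part f b x)); congr (dot _ _ _).
    by apply/funext => x; rewrite subrr.
  by rewrite !E addr0 exprn_gt0.
by split.
Qed.

Lemma closure_adjoint_dot p q : op_closure A p -> adjoint A q -> L2_dot p.2 q.1 = L2_dot p.1 q.2.
Proof.
move=> /op_closureP hp /adjointP hq; have s := L2part_sqint.
have e b b' : dot nu (L2part p.2 b) (L2part q.1 b') = dot nu (L2part p.1 b) (L2part q.2 b').
  rewrite dotC [RHS]dotC; apply/esym.
  exact: (weak_closed_dot (s _ _ _ _ _ _) (s _ _ _ _ _ _) (s _ _ _ _ _ _) (s _ _ _ _ _ _) (hq b') (hp b)).
by rewrite !L2_dotE !e.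
Qed.

Lemma op_closure_adjoint : op_closure A `<=` adjoint A.
Proof.
move=> q /op_closureP hq; apply/adjointP => b.
by apply: closed_weak => //; exact: L2part_sqint.
Qed.

Lemma tau2_op_dense : densely_defined A.
Proof.
move=> f e e0; have e2 : 0 < e ^+ 2 / 2 by rewrite divr_gt0 ?exprn_gt0.
have s := L2part_sqint.
have [phi tp p1] := test_dense (s _ _ _ _ f false) e2.
have [psi ts p2] := test_dense (s _ _ _ _ f true) e2.
have [p Ap [r1 r2 _ _]] := tau2_op_exists tp ts.
exists p; split=> //; apply/L2_dist_lt => //; rewrite /sqdist (splitr (e ^+ 2)).
have sp := test_sqint tp; have ss := test_sqint ts.
apply: ltrD.
- rewrite (_ : sqnorm _ _ = sqnorm nu (fun x => phi x - L2part f false x))//.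
  apply: sqnorm_ae; [exact: sqintB|exact: sqintB|].
  by apply: halfline_ae_imply r1 => x ->.
- rewrite (_ : sqnorm _ _ = sqnorm nu (fun x => psi x - L2part f true x))//.
  apply: sqnorm_ae; [exact: sqintB|exact: sqintB|].
  by apply: halfline_ae_imply r2 => x ->.
Qed.

(** The closure lies in the adjoint in any case; the condition on the roots gives the reverse
    inclusion through [weak_closed]. *)
Lemma stable_essentially_selfadjoint :
  stable_roots (5 / 4 - c1) (9 / 16 + 3 / 2 * c1 + c2) -> essentially_selfadjoint A.
Proof.
move=> st; split; first exact: tau2_op_dense.
  by move=> p /sub_op_closure/op_closure_adjoint.
split.
  move=> f e e0; have [p [Ap pf]] := tau2_op_dense f e0.
  by exists p; split=> //; exact: sub_op_closure.
apply/seteqP; split=> [q /op_closure_adjoint aq p cp|q aq]; first exact: closure_adjoint_dot.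
apply/op_closureP => b; apply: weak_closed => //; [exact: L2part_sqint|exact: L2part_sqint|].
by move: b; apply/adjointP => p Ap; apply: aq; exact: sub_op_closure.
Qed.

(** A self-adjoint closure would contain the whole adjoint and make it symmetric, against the
    hypothesis on (u, tu) and (v, tv). *)
Lemma not_essentially_selfadjoint u tu v tv :
  sqint nu u -> sqint nu tu -> sqint nu v -> sqint nu tv ->
  weak_graph u tu -> weak_graph v tv -> dot nu tu v <> dot nu u tv ->
  ~ essentially_selfadjoint A.
Proof.
move=> su stu sv stv wu wv ne [_ _ [_ E]]; apply: ne.
have s := L2part_sqint; have s0 : sqint nu (fun=> 0) := sqint0 nu.
have key w tw : sqint nu w -> sqint nu tw -> weak_graph w tw -> exists2 q, adjoint A q &
    [/\ {ae nu, forall x, L2part q.1 false x = w x}, {ae nu, forall x, L2part q.1 true x = (fun=> 0) x},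
      {ae nu, forall x, L2part q.2 false x = tw x} & {ae nu, forall x, L2part q.2 true x = (fun=> 0) x}].
  move=> sw stw ww.
  have [f [f1 f2]] := L2C_parts_exist sw s0.
  have [g [g1 g2]] := L2C_parts_exist stw s0.
  exists (f, g) => //; apply/adjointP => b phi tp /=.
  have sp := test_sqint tp; have st := sqint_tau c1 c2 tp.
  case: b.
    transitivity (dot nu (tau phi) (fun=> 0)); first by apply: dot_ae => //; exact: nearW.
    by rewrite dotr0 -(dotr0 nu phi); apply/esym/dot_ae => //; exact: nearW.
  transitivity (dot nu (tau phi) w); first by apply: dot_ae => //; exact: nearW.
  by rewrite (ww _ tp); apply/esym/dot_ae => //; exact: nearW.
have [p ap [p1 p2 p3 p4]] := key _ _ su stu wu.
have [q aq [q1 q2 q3 q4]] := key _ _ sv stv wv.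
(* The adjoint of A is contained in the adjoint of the closure, which is assumed to be the
   closure. *)
have cp : op_closure A p by rewrite E => r cr; exact: closure_adjoint_dot.
have := closure_adjoint_dot cp aq; rewrite !L2_dotE => -[+ _].
have e1 : dot nu (L2part p.2 false) (L2part q.1 false) = dot nu tu v by exact: dot_ae.
have e2 : dot nu (L2part p.1 false) (L2part q.2 false) = dot nu u tv by exact: dot_ae.
have e3 : dot nu (L2part p.2 true) (L2part q.1 true) = 0.
  by rewrite -(dotr0 nu (fun=> 0)); exact: dot_ae.
have e4 : dot nu (L2part p.1 true) (L2part q.2 true) = 0.
  by rewrite -(dotr0 nu (fun=> 0)); exact: dot_ae.
by rewrite e1 e2 e3 e4 !addr0.
Qed.

End complex_operator.

(** * Necessity of the condition *)

Section logarithmic_square_integrability.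
Context {R : realType}.
Local Notation mu := (@lebesgue_measure R).
Local Notation nu := (halfline_measure R).
Implicit Types (p u f g : R -> R) (a b r t : R).

Lemma contpos_ln g : (forall t, {for t, continuous g}) -> contpos (fun r => g (ln r)).
Proof. by move=> cg r r0; apply: continuous_comp; [exact: continuous_ln|exact: cg]. Qed.

Lemma measurable_comp_ln g : (forall t, {for t, continuous g}) ->
  measurable_fun [set: R] (fun r => g (ln r)).
Proof.
move=> cg; apply: (measurableT_comp (f := g)); last exact: measurable_ln.
by apply: continuous_measurable_fun.
Qed.

Lemma contpos_sqr f : contpos f -> contpos (fun r => f r ^+ 2).
Proof. by move=> cf r r0; exact: (continuous_comp (cf r r0) (@exprn_continuous R 2 (f r))). Qed.

Lemma sqint_of_bounded u K : measurable_fun [set: R] u -> contpos u ->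
  (forall a b, 0 < a -> a <= b -> int_on a b (fun r => u r ^+ 2) <= K) -> sqint nu u.
Proof.
move=> mu_ cu hK; split=> //; apply/halfline_integrable; first exact: measurable_funX.
have mq : measurable_fun [set: R] (fun x => (u x ^+ 2)%:E).
  by apply/measurable_EFinP; exact: measurable_funX.
apply/integrableP; split; first exact: measurable_funTS.
pose F (n : nat) : set R := `[n.+1%:R^-1, n.+1%:R]%classic.
have FD : \bigcup_n F n = `]0, +oo[%classic.
  apply/seteqP; split=> [x [n _]|x]; rewrite /F/= !in_itv/= ?andbT.
    by move=> /andP[h _]; apply: (lt_le_trans _ h); rewrite invr_gt0.
  move=> x0; pose N := (Num.bound x + Num.bound x^-1)%N.
  have h1 : x < N.+1%:R.
    apply: (lt_trans (archi_boundP (ltW x0))); rewrite ltr_nat ltnS; exact: leq_addr.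
  have h2 : x^-1 < N.+1%:R.
    apply: (lt_trans (@archi_boundP _ x^-1 _)); first by rewrite invr_ge0 ltW.
    by rewrite ltr_nat ltnS leq_addl.
  exists N => //=; rewrite /F/= in_itv/= (ltW h1) andbT.
  by rewrite -[leRHS]invrK lef_pV2 ?posrE ?invr_gt0// ltW.
have := @ge0_nondecreasing_set_cvg_integral _ (measurableTypeR R) R F (fun x => (u x ^+ 2)%:E) mu.
rewrite FD => cvgF.
have {}cvgF : (\int[mu]_(x in F i) (u x ^+ 2)%:E)%E @[i --> \oo] -->
    (\int[mu]_(x in `]0%R, +oo[) (u x ^+ 2)%:E)%E.
  apply: cvgF.
  - move=> n k nk; rewrite subsetEset => x; rewrite /F/= !in_itv/= => /andP[h1 h2]; apply/andP; split.
      by apply: le_trans h1; rewrite lef_pV2 ?posrE// ler_nat.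
    by apply: (le_trans h2); rewrite ler_nat.
  - by move=> i; exact: measurable_itv.
  - by move=> i; exact: measurable_funTS.
  - by move=> i x _; rewrite lee_fin sqr_ge0.
have le_K n : (\int[mu]_(x in F n) (u x ^+ 2)%:E <= K%:E)%E.
  have n0 : 0 < n.+1%:R^-1 :> R by rewrite invr_gt0.
  have nn : n.+1%:R^-1 <= n.+1%:R :> R.
    by apply: (@le_trans _ _ 1); [rewrite invf_le1// ler1n|rewrite ler1n].
  have cu2 := contpos_sqr cu.
  have fi := contpos_locint cu2 n.+1%:R n0.
  have := hK _ _ n0 nn; rewrite /int_on /Rintegral -lee_fin fineK//.
  have := fi; rewrite /integrable_on => fi'; exact: integrable_fin_num fi'.
apply: (@le_lt_trans _ _ K%:E); last exact: ltry.
under eq_integral do rewrite /= ger0_norm ?sqr_ge0//.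
rewrite -(cvg_lim _ cvgF)//; apply: lime_le; last by apply: nearW => n; exact: le_K.
by apply/cvg_ex; eexists; exact: cvgF.
Qed.

(** In the variable t = ln r this is the integrability of e^t p^2, which is bounded by C e^(de t) up
    to b. Instead of changing variables, the integrand is dominated by the derivative in r of a
    bounded function. *)
Lemma sqint_ln p de C b : (forall t, {for t, continuous p}) -> 0 < de -> 0 <= C ->
  (forall t, t <= b -> expR t * p t ^+ 2 <= C * expR (de * t)) -> (forall t, b <= t -> p t = 0) ->
  sqint nu (fun r => p (ln r)).
Proof.
move=> cp de0 C0 hp p0.
pose s r := expR (de * ln r).
have ds (r : R) : 0 < r -> is_derive r 1 s (de * r^-1 * s r).
  move=> r0; have dl := is_derive1_ln r0; rewrite /s.
  by is_derive_tac; ring.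
have s0 r : 0 < s r by exact: expR_gt0.
have s10 r : 0 < 1 + s r by rewrite ltr_wpDl// ltW.
(* The function - K / (1 + r^de) is bounded on the whole half-line, unlike r^de; the square
   compensates for the denominator (1 + r^de)^2 of its derivative where ln r <= b. *)
pose K := C / de * (1 + expR (de * b)) ^+ 2.
have K0 : 0 <= K by rewrite mulr_ge0 ?divr_ge0 ?sqr_ge0// ltW.
pose G r := - (K * (1 + s r)^-1).
pose g r := K * (de * r^-1 * s r * (1 + s r)^-1 ^+ 2).
have dG (r : R) : 0 < r -> is_derive r 1 G (g r).
  move=> r0; have dsr := ds r r0; have ne : 1 + s r != 0 by rewrite gt_eqF.
  have di := is_derive1_inv (is_derive1_add (is_derive1_cst 1 r) dsr) ne.
  apply: is_derive_eq (is_derive1_opp (is_derive1_mul (is_derive1_cst K r) di)) _.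
  by rewrite /g -exprVn; ring.
have cs : contpos s by move=> r r0; exact: is_derive1_continuous (ds r r0).
have cg : contpos g.
  have ci : contpos (fun r => (1 + s r)^-1).
    move=> r r0; apply: cvgV; first by rewrite gt_eqF.
    by apply: cvgD; [exact: cvg_cst|exact: cs].
  have ci2 := contpos_sqr ci.
  move=> r r0; apply: cvgM; first exact: cvg_cst.
  apply: cvgM; last exact: (ci2 r r0).
  apply: cvgM; last exact: cs.
  apply: cvgM; first exact: cvg_cst.
  by apply: cvgV; [rewrite gt_eqF|exact: cvg_id].
have cu : contpos (fun r => p (ln r)) := contpos_ln cp.
apply: (@sqint_of_bounded _ K); [exact: measurable_comp_ln|exact: cu|].
move=> a d a0 ad.
have cu2 : contpos (fun r => p (ln r) ^+ 2) := contpos_sqr cu.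
apply: (@le_trans _ _ (int_on a d g)).
  apply: int_on_le; [exact: contpos_locint|exact: contpos_locint|].
  move=> r /andP[ar _]; have r0 := lt_le_trans a0 ar.
  have g0 : 0 <= g r.
    apply: mulr_ge0 => //; apply: mulr_ge0; last exact: sqr_ge0.
    by apply: mulr_ge0; [rewrite mulr_ge0 ?invr_ge0 ?ltW|rewrite ltW].
  have [rb|br] := leP (ln r) b; last by rewrite p0 ?(ltW br)// expr0n/=.
  have h := hp _ rb; rewrite lnK ?posrE// in h.
  have h1 : p (ln r) ^+ 2 <= r^-1 * (C * s r).
    by rewrite mulrC ler_pdivlMr// mulrC.
  apply: (le_trans h1).
  have sb : s r <= expR (de * b) by rewrite ler_expR ler_pM2l.
  have Eg : g r = r^-1 * (C * s r) * ((1 + expR (de * b)) ^+ 2 * (1 + s r)^-1 ^+ 2).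
    by rewrite /g /K; field; rewrite !gt_eqF.
  rewrite Eg ler_peMr//; first by rewrite mulr_ge0 ?invr_ge0 ?(ltW r0)// mulr_ge0 ?(ltW (s0 r)).
  rewrite -exprMn exprn_ege1// ler_pdivlMr// mul1r lerD2l//.
rewrite (fundamental_int_on ad (fun r hr => dG r (lt_le_trans a0 (andP hr).1))); last first.
  by move=> r /andP[ar _]; apply: cg; exact: lt_le_trans ar.
rewrite /G opprK.
have h1 : 0 <= K * (1 + s d)^-1 by rewrite mulr_ge0// invr_ge0 ltW.
have h2 : K * (1 + s a)^-1 <= K by rewrite ler_piMr// invf_le1// lerDl ltW.
by rewrite (le_trans _ h2)// addrC gerBl.
Qed.

End logarithmic_square_integrability.

(** * Smooth cutoff, and transport of functions of t to the half-line *)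

Section cutoff_solutions.
Context {R : realType}.
Local Notation nu := (halfline_measure R).
Implicit Types (f g y z v X phi : R -> R) (a b r t : R) (k : nat).

Lemma smooth_step : exists X a b M, [/\ smooth X, 0 < a < b, forall t, t <= a -> X t = 1,
  forall t, b <= t -> X t = 0 & forall t, `|X t| <= M].
Proof.
have [phi tp p1] := @unit_mass_test R; have [a [b [a0 ab hphi]]] := test_supp tp.
pose X t := 1 - int_on (a / 2) t phi.
have X1 t : t <= a -> X t = 1.
  move=> ta; rewrite /X (@eq_int_on _ _ _ _ (fun=> 0)); last first.
    by move=> s /andP[_ st]; rewrite hphi// (le_trans st).
  by rewrite /int_on Rintegral_cst//= mul0r subr0.
have d t : is_derive t 1 X (- phi t).
  have [ta|at_] := ltP t a.
    rewrite hphi ?(ltW ta)// oppr0; apply: is_derive1_unique_near (is_derive1_cst 1 t).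
    by apply: (gt_near ta) => s /ltW; exact: X1.
  have di : is_derive t 1 (fun s => int_on (a / 2) s phi) (phi t).
    apply: (@int_on_derive _ (a / 2) (t + 1)).
    - by apply: lt_le_trans at_; lra.
    - by rewrite ltrDl.
    - by apply: within_continuous_integrable_on; exact: test_within.
    - exact: test_continuous.
  by apply: is_derive_eq (is_derive1_add (is_derive1_cst 1 t) (is_derive1_opp di)) _; rewrite add0r.
have X0 t : b <= t -> X t = 0.
  move=> bt; have w : vanishes_outside (a / 2) t phi.
    by apply: vanishes_outsideW hphi => //; lra.
  have a20 : 0 < a / 2 by lra.
  rewrite /X (_ : int_on _ _ _ = 1) ?subrr// -[RHS]p1 (pairingE _ a20 w).
  by apply: eq_int_on => s _; rewrite mulr1.
have sX : smooth X by apply: (smoothS d); case: (testN tp).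
have [M M0 hM] := @within_continuous_bounded R a b X
  (within_continuous (fun t _ => is_derive1_continuous (d t))).
exists X, a, b, (M + 1); split=> //; first by rewrite a0.
move=> t; have [ta|/ltW at_] := leP t a; first by rewrite X1// normr1 lerDr.
have [bt|/ltW tb] := leP b t; first by rewrite X0// normr0 addr_ge0.
by rewrite (le_trans (hM t _)) ?at_ ?tb// lerDl.
Qed.

Lemma smooth_derive1n f k : smooth f -> smooth (f^`(k)%classic).
Proof. by move=> sf; elim: k => [//|k IH]; rewrite derive1nS; exact: smooth_derive1. Qed.

Lemma smooth_is_derive1n f k t : smooth f -> is_derive t 1 (f^`(k)%classic) (f^`(k.+1)%classic t).
Proof. by move=> sf; rewrite derive1nS; apply: smooth_is_derive; exact: smooth_derive1n. Qed.

Lemma smooth_continuous f t : smooth f -> {for t, continuous f}.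
Proof. by move=> sf; exact: is_derive1_continuous (smooth_is_derive t sf). Qed.

Lemma derive1n_eq_lt f g a k t : smooth f -> smooth g -> (forall s, s < a -> f s = g s) ->
  t < a -> f^`(k)%classic t = g^`(k)%classic t.
Proof.
move=> sf sg fg; elim: k t => [|k IH] t ta; first exact: fg.
have d := is_derive1_unique_near (gt_near ta IH) (smooth_is_derive1n k t sg).
by rewrite (derive1nS f); exact: is_derive1_derive1 d.
Qed.

Lemma derive1n_eq_gt f g b k t : smooth f -> smooth g -> (forall s, b < s -> f s = g s) ->
  b < t -> f^`(k)%classic t = g^`(k)%classic t.
Proof.
move=> sf sg fg; elim: k t => [|k IH] t bt; first exact: fg.
have d := is_derive1_unique_near (lt_near bt IH) (smooth_is_derive1n k t sg).
by rewrite (derive1nS f); exact: is_derive1_derive1 d.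
Qed.

Lemma derive1n_zero k t : ((fun=> 0 : R)^`(k)%classic) t = 0.
Proof.
elim: k t => [//|k IH] t; rewrite derive1nS.
by rewrite (_ : (fun=> 0 : R)^`(k)%classic = fun=> 0) ?derive1_cst//; apply/funext => s; exact: IH.
Qed.

Variables c1 c2 : R.
Let x := 5 / 4 - c1.
Let m := 9 / 16 + 3 / 2 * c1 + c2.

(* For r > 0, [tau (lift y) r = lift_tau y r]; recall that [ln r = 0] for [r <= 0]. *)
Definition log_tau y t := y^`(4)%classic t - 2 * x * y^`(2)%classic t + m * y t.
Definition lift y r := expR (3 / 2 * ln r) * y (ln r).
Definition lift_tau y r := expR (- (5 / 2) * ln r) * log_tau y (ln r).
Definition concomitant y z t := z t * y^`(3)%classic t - z^`(1)%classic t * y^`(2)%classic t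
  + z^`(2)%classic t * y^`(1)%classic t - z^`(3)%classic t * y t
  - 2 * x * (z t * y^`(1)%classic t - z^`(1)%classic t * y t).

Lemma log_tau_continuous y t : smooth y -> {for t, continuous (log_tau y)}.
Proof.
move=> sy; have c k := smooth_continuous (t := t) (smooth_derive1n k sy).
have c4 := c 4%N; have c2' := c 2%N; have c0 := c 0%N.
apply: cvgD; [apply: cvgB; [exact: c4|]|]; apply: cvgM; [exact: cvg_cst|exact: c2'|exact: cvg_cst|exact: c0].
Qed.

Lemma expR_linear_continuous (s : R) t : {for t, continuous (fun t => expR (s * t))}.
Proof.
have d : is_derive t 1 (fun t => expR (s * t)) (s * expR (s * t)) by is_derive_tac; ring.
exact: is_derive1_continuous d.
Qed.

Lemma lift_tauE y r : 0 < r -> lift_tau y r = expR (3 / 2 * ln r) * r^-1 ^+ 4 * log_tau y (ln r).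
Proof.
move=> r0; rewrite /lift_tau; congr (_ * _).
have -> : r^-1 = expR (- ln r) by rewrite expRN lnK// posrE.
by rewrite -expRM_natl -expRD; congr expR; field.
Qed.

Lemma lift_weak y phi : smooth y -> test phi ->
  pairing (tau c1 c2 phi) (lift y) = pairing phi (lift_tau y).
Proof.
move=> sy tp.
have d k t := smooth_is_derive1n k t sy.
have [d0 d1 d2 d3] := @halfline_transform R c1 c2 y (y^`(1)%classic) (y^`(2)%classic)
  (y^`(3)%classic) (y^`(4)%classic) (d 0%N) (d 1%N) (d 2%N) (d 3%N).
have clt : contpos (fun r => expR (3 / 2 * ln r) * r^-1 ^+ 4 * log_tau y (ln r)).
  move=> r r0; have h1 := contpos_ln (@expR_linear_continuous (3 / 2)) r0.
  have h2 := contpos_ln (fun t => log_tau_continuous (t := t) sy) r0.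
  apply: cvgM; last exact: h2.
  by apply: cvgM; [exact: h1|exact: contpos_invX].
have := @weak_classical R c1 c2 _ _ _ _ _ phi d0 d1 d2 d3 _ tp.
rewrite -/(lift y) => ->; last first.
  move=> r r0; apply: cvgB; first exact: clt.
  have e0 := is_derive1_continuous (d0 r r0); have e1 := is_derive1_continuous (d1 r r0).
  have e2 := is_derive1_continuous (d2 r r0).
  have i k := @contpos_invX R k r r0.
  apply: cvgD; [apply: cvgB|]; (apply: cvgM; [apply: cvgM; [exact: cvg_cst|exact: i]|]).
  - exact: e2.
  - exact: e1.
  - exact: e0.
apply: eq_Rintegral => r; rewrite inE/= in_itv/= andbT => r0.
by rewrite subrK lift_tauE.
Qed.

End cutoff_solutions.

Section defect.
Context {R : realType}.
Local Notation nu := (halfline_measure R).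
Implicit Types (f g y z v X phi : R -> R) (a b r t C M : R) (k : nat).
Variables c1 c2 : R.
Let x := 5 / 4 - c1.
Let m := 9 / 16 + 3 / 2 * c1 + c2.
Local Notation log_tau := (log_tau c1 c2).
Local Notation lift_tau := (lift_tau c1 c2).
Local Notation concomitant := (concomitant c1).

Let concomitant_chain (q p : R) (y0 y1 y2 y3 y4 z0 z1 z2 z3 z4 : R -> R) (t : R) :
  is_derive t 1 y0 (y1 t) -> is_derive t 1 y1 (y2 t) -> is_derive t 1 y2 (y3 t) -> is_derive t 1 y3 (y4 t) ->
  is_derive t 1 z0 (z1 t) -> is_derive t 1 z1 (z2 t) -> is_derive t 1 z2 (z3 t) -> is_derive t 1 z3 (z4 t) ->
  is_derive t 1 (fun t => z0 t * y3 t - z1 t * y2 t + z2 t * y1 t - z3 t * y0 t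
    - 2 * q * (z0 t * y1 t - z1 t * y0 t))
    ((y4 t - 2 * q * y2 t + p * y0 t) * z0 t - (z4 t - 2 * q * z2 t + p * z0 t) * y0 t).
Proof. by move=> d0 d1 d2 d3 e0 e1 e2 e3; is_derive_tac; ring. Qed.

Lemma concomitant_is_derive y z t : smooth y -> smooth z ->
  is_derive t 1 (concomitant y z) (log_tau y t * z t - log_tau z t * y t).
Proof.
move=> sy sz; have d k := smooth_is_derive1n k t sy; have e k := smooth_is_derive1n k t sz.
exact: (@concomitant_chain _ _ y (y^`(1)%classic) (y^`(2)%classic) (y^`(3)%classic) (y^`(4)%classic)
  z (z^`(1)%classic) (z^`(2)%classic) (z^`(3)%classic) (z^`(4)%classic) t
  (d 0%N) (d 1%N) (d 2%N) (d 3%N) (e 0%N) (e 1%N) (e 2%N) (e 3%N)).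
Qed.

Lemma lift_tau_vanishes y b : 0 < b -> (forall t, t <= 0 -> log_tau y t = 0) ->
  (forall t, b <= t -> log_tau y t = 0) -> vanishes_outside 1 (expR b) (lift_tau y).
Proof.
move=> b0 h0 hb r /orP[r1|br]; rewrite /lift_tau.
  by rewrite h0 ?mulr0// ln_le0.
by rewrite hb ?mulr0// -[leLHS]expRK ler_ln ?posrE ?expR_gt0// (lt_le_trans _ br)// expR_gt0.
Qed.

Let chain_algebra (e i l p s : R) : e * i ^+ 4 * l * (e * p) = e ^+ 2 * i ^+ 4 * (l * p).
Proof. by ring. Qed.

(** Green's formula. The powers of r combine to r^3 r^-4 = 1 / r, the derivative of ln r, so the
    difference of the integrands is the derivative of the concomitant at ln r. Only the end point r
    = 1, i.e. t = 0, contributes. *)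
Lemma lift_concomitant y z b : smooth y -> smooth z -> 0 < b ->
  (forall t, t <= 0 -> log_tau y t = 0 /\ log_tau z t = 0) ->
  (forall t, b <= t -> log_tau y t = 0 /\ log_tau z t = 0) -> concomitant y z b = 0 ->
  pairing (lift_tau y) (lift z) - pairing (lift_tau z) (lift y) = - concomitant y z 0.
Proof.
move=> sy sz b0 h0 hb cb.
have b1 : 1 < expR b by rewrite expR_gt1.
have vy := lift_tau_vanishes b0 (fun t ht => (h0 t ht).1) (fun t ht => (hb t ht).1).
have vz := lift_tau_vanishes b0 (fun t ht => (h0 t ht).2) (fun t ht => (hb t ht).2).
rewrite (pairingE _ ltr01 vy) (pairingE _ ltr01 vz).
have cl f : smooth f -> contpos (lift f).
  move=> sf r r0; apply: cvgM; first exact: (contpos_ln (@expR_linear_continuous R (3 / 2)) r0).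
  exact: (contpos_ln (fun t => smooth_continuous (t := t) sf) r0).
have ct f : smooth f -> contpos (lift_tau f).
  move=> sf r r0; apply: cvgM; first exact: (contpos_ln (@expR_linear_continuous R (- (5 / 2))) r0).
  exact: (contpos_ln (fun t => log_tau_continuous (t := t) sf) r0).
have cm f g : smooth f -> smooth g -> contpos (fun r => lift_tau f r * lift g r).
  by move=> sf sg r r0; apply: cvgM; [exact: ct|exact: cl].
have ci f g : smooth f -> smooth g -> integrable_on 1 (expR b) (fun r => lift_tau f r * lift g r).
  by move=> sf sg; apply: (contpos_locint (cm f g sf sg)); exact: ltr01.
rewrite -int_onB; [|exact: ci..].
have dc (r : R) : 1 <= r <= expR b -> is_derive r 1 (fun r => concomitant y z (ln r))
    (lift_tau y r * lift z r - lift_tau z r * lift y r).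
  move=> /andP[r1 _]; have r0 : 0 < r := lt_le_trans ltr01 r1.
  have := is_derive1_compose (is_derive1_ln r0) (concomitant_is_derive (ln r) sy sz).
  move=> h; apply: is_derive_eq h _.
  rewrite !lift_tauE// /lift !chain_algebra// -mulrBr mulrC; congr (_ * _).
  have e : expR (3 / 2 * ln r) ^+ 2 = r ^+ 3.
    rewrite -[r in RHS]lnK ?posrE// -!expRM_natl; congr expR; by field.
  by rewrite e; field; rewrite gt_eqF.
rewrite (fundamental_int_on (ltW b1) dc); last first.
  move=> r /andP[r1 _]; have r0 : 0 < r := lt_le_trans ltr01 r1.
  by apply: cvgB; apply: cm.
by rewrite expRK ln1 cb sub0r.
Qed.

End defect.

Section defect_vectors.
Context {R : realType}.
Local Notation nu := (halfline_measure R).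
Implicit Types (f g y z v X phi : R -> R) (a b r t C M : R) (k : nat).
Variables c1 c2 : R.
Local Notation log_tau := (log_tau c1 c2).
Local Notation lift_tau := (lift_tau c1 c2).
Local Notation concomitant := (concomitant c1).

(** The rate 2 is the borderline for the integrability of e^(4t) f^2 at -oo. The constant may depend
    on b because the functions will be cut off on the right. *)
Definition subcritical f := exists2 ka, ka < 2 & forall b, exists C, forall t, t <= b -> `|f t| <= C * expR (- ka * t).

Lemma sqint_lift f b : smooth f -> subcritical f -> (forall t, b <= t -> f t = 0) -> sqint nu (lift f).
Proof.
move=> sf [ka ka2 /(_ b)[C hC]] f0.
have C0 : 0 <= C.
  have := hC b (lexx b); have e0 := expR_gt0 (- ka * b); have n0 := normr_ge0 (f b).
  by move=> h; rewrite -(pmulr_lge0 _ e0) (le_trans n0).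
apply: (@sqint_ln R (fun t => expR (3 / 2 * t) * f t) (4 - 2 * ka) (C ^+ 2) b).
- move=> t; apply: cvgM; first exact: (@expR_linear_continuous R (3 / 2)).
  exact: smooth_continuous.
- by lra.
- exact: sqr_ge0.
- move=> t tb; have h := hC t tb.
  have h2 : f t ^+ 2 <= C ^+ 2 * expR (- ka * t) ^+ 2.
    rewrite -exprMn -[f t ^+ 2]real_normK ?num_real//.
    by rewrite ler_pXn2r// nnegrE// mulr_ge0// expR_ge0.
  have E : expR t * (expR (3 / 2 * t)) ^+ 2 = expR (4 * t).
    by rewrite -expRM_natl -expRD; congr expR; field.
  rewrite exprMn mulrA E; apply: (le_trans (ler_wpM2l (expR_ge0 _) h2)).
  rewrite mulrCA ler_wpM2l ?sqr_ge0// -expRM_natl -expRD ler_expR; lra.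
- by move=> t /f0 ->; rewrite mulr0.
Qed.

Lemma sqint_lift_tau f b : smooth f -> 0 < b -> (forall t, t <= 0 -> log_tau f t = 0) ->
  (forall t, b <= t -> log_tau f t = 0) -> sqint nu (lift_tau f).
Proof.
move=> sf b0 h0 hb.
pose q t := expR (- (5 / 2) * t) * log_tau f t.
have cq t : {for t, continuous q}.
  apply: cvgM; first exact: (@expR_linear_continuous R (- (5 / 2))).
  exact: log_tau_continuous.
have [M M0 hM] := within_continuous_bounded (@within_continuous R 0 b q (fun t _ => @cq t)).
apply: (@sqint_ln R q 1 (M ^+ 2) b) => //.
- exact: sqr_ge0.
- move=> t tb; rewrite mul1r mulrC ler_wpM2r ?expR_ge0//.
  have [t0|/ltW t0] := leP t 0; first by rewrite /q h0// mulr0 expr0n/= sqr_ge0.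
  by rewrite -[q t ^+ 2]real_normK ?num_real// ler_pXn2r ?nnegrE// hM// t0.
- by move=> t /hb; rewrite /q => ->; rewrite mulr0.
Qed.

Lemma defect_vectors z v : smooth z -> smooth v -> subcritical z -> subcritical v ->
  (forall t, log_tau z t = 0) -> (forall t, log_tau v t = 0) -> concomitant z v 0 != 0 ->
  ~ essentially_selfadjoint (tau2_op c1 c2).
Proof.
move=> sz sv gz gv Dz Dv ne.
(* The step is 1 up to a > 0, hence near t = 0, so the cutoff does not affect the concomitant
   there. *)
have [X [a [b [M [sX /andP[a0 ab] X1 X0 XM]]]]] := @smooth_step R.
pose cut f t := X t * f t.
have scut f : smooth f -> smooth (cut f) by move=> sf; exact: smoothM.
have s0 : smooth (fun=> 0 : R) by exact: smooth_cst.
have lt_a f k t : smooth f -> t < a -> (cut f)^`(k)%classic t = f^`(k)%classic t.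
  move=> sf; apply: derive1n_eq_lt => //; first exact: scut.
  by move=> s /ltW sa; rewrite /cut X1// mul1r.
have gt_b f k t : smooth f -> b < t -> (cut f)^`(k)%classic t = 0.
  move=> sf bt; rewrite -(derive1n_zero k t); apply: derive1n_eq_gt bt => //; first exact: scut.
  by move=> s /ltW bs; rewrite /cut X0// mul0r.
have lt_a0 f t : t < a -> cut f t = f t by move=> /ltW ta; rewrite /cut X1// mul1r.
have gt_b0 f t : b < t -> cut f t = 0 by move=> /ltW bt; rewrite /cut X0// mul0r.
(* The derivatives of the cut-off functions are known to vanish only strictly beyond b, hence the
   margin 1. *)
have b10 : 0 < b + 1 by rewrite addr_gt0// (lt_trans a0).
have T0 f t : smooth f -> (forall t, log_tau f t = 0) -> t <= 0 -> log_tau (cut f) t = 0.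
  move=> sf Df t0; have ta := le_lt_trans t0 a0.
  by rewrite -(Df t) /log_tau !lt_a// lt_a0.
have T1 f t : smooth f -> b + 1 <= t -> log_tau (cut f) t = 0.
  move=> sf bt; have bt' : b < t by rewrite (lt_le_trans _ bt)// ltrDl.
  by rewrite /log_tau !gt_b// gt_b0// !mulr0 subr0 addr0.
have gcut f : subcritical f -> subcritical (cut f).
  move=> [ka ka2 h]; exists ka => // d; have [C hC] := h d; exists (M * C) => t td.
  rewrite normrM -mulrA ler_pM//; exact: hC.
have sU f : smooth f -> subcritical f -> sqint nu (lift (cut f)).
  move=> sf gf; apply: (@sqint_lift _ b); [exact: scut|exact: gcut|].
  by move=> t bt; rewrite /cut X0// mul0r.
have sT f : smooth f -> (forall t, log_tau f t = 0) -> sqint nu (lift_tau (cut f)).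
  move=> sf Df; apply: (@sqint_lift_tau _ (b + 1)) => //; first exact: scut.
    by move=> t; exact: T0.
  by move=> t; exact: T1.
have wU f : smooth f -> subcritical f -> (forall t, log_tau f t = 0) ->
    weak_graph c1 c2 (lift (cut f)) (lift_tau (cut f)).
  move=> sf gf Df phi tp; rewrite !dot_pairing//; [|exact: sT|exact: test_tau|exact: sU].
  by apply: lift_weak => //; exact: scut.
apply: (not_essentially_selfadjoint (sU _ sz gz) (sT _ sz Dz) (sU _ sv gv) (sT _ sv Dv)
  (wU _ sz gz Dz) (wU _ sv gv Dv)).
have dp f g : sqint nu f -> sqint nu g -> dot nu f g = pairing f g.
  by move=> [mf _] [mg _]; rewrite /dot halfline_Rintegral//; exact: measurable_funM.
have L : pairing (lift_tau (cut z)) (lift (cut v)) - pairing (lift_tau (cut v)) (lift (cut z)) =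
    - concomitant (cut z) (cut v) 0.
  apply: (lift_concomitant (scut _ sz) (scut _ sv) b10).
  - by move=> t t0; split; exact: T0.
  - by move=> t t0; split; exact: T1.
  - have bb : b < b + 1 by rewrite ltrDl.
    by rewrite /concomitant !gt_b// !gt_b0//; ring.
have C0 : concomitant (cut z) (cut v) 0 = concomitant z v 0.
  by rewrite /concomitant !lt_a// !lt_a0.
rewrite (dp _ _ (sT _ sz Dz) (sU _ sv gv)) (dotC nu (lift (cut z))) (dp _ _ (sT _ sv Dv) (sU _ sz gz)).
move=> E; move: L; rewrite E subrr C0 => /esym/eqP; rewrite oppr_eq0.
exact/negP.
Qed.

End defect_vectors.

(** * Explicit solutions of the indicial equation *)

Section fundamental_system.
Context {R : realType}.
Implicit Types (f g c S : R -> R) (a b t w ka s : R) (k : nat).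

Definition growth ka f := forall b, exists C, forall t, t <= b -> `|f t| <= C * expR (- ka * t).

Lemma growthD ka f g : growth ka f -> growth ka g -> growth ka (fun t => f t + g t).
Proof.
move=> hf hg b; have [C hC] := hf b; have [D hD] := hg b; exists (C + D) => t tb.
by rewrite (le_trans (ler_normD _ _))// mulrDl lerD ?hC ?hD.
Qed.

Lemma growthM ka kb f g : growth ka f -> growth kb g -> growth (ka + kb) (fun t => f t * g t).
Proof.
move=> hf hg b; have [C hC] := hf b; have [D hD] := hg b; exists (C * D) => t tb.
have -> : expR (- (ka + kb) * t) = expR (- ka * t) * expR (- kb * t).
  by rewrite -expRD; congr expR; ring.
by rewrite normrM mulrACA ler_pM ?hC ?hD.
Qed.

Lemma growth_bounded ka f M : 0 <= ka -> (forall t, `|f t| <= M) -> growth ka f.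
Proof.
move=> ka0 fM b; exists (M * expR (ka * b)) => t tb.
have M0 : 0 <= M by rewrite (le_trans _ (fM 0)).
rewrite (le_trans (fM t))// -mulrA ler_peMr// -expRD -expR0 ler_expR.
have : 0 <= ka * (b - t) by rewrite mulr_ge0// subr_ge0.
lra.
Qed.

Lemma growthZ ka a f : growth ka f -> growth ka (fun t => a * f t).
Proof.
move=> hf; have := growthM (@growth_bounded 0 (fun=> a) `|a| (lexx 0) (fun=> lexx _)) hf.
by rewrite add0r.
Qed.

Lemma growth_expR ka s : 0 <= s + ka -> growth ka (fun t => expR (s * t)).
Proof.
move=> sk b; exists (expR ((s + ka) * b)) => t tb.
rewrite ger0_norm ?expR_ge0// -expRD ler_expR.
have : 0 <= (s + ka) * (b - t) by rewrite mulr_ge0// subr_ge0.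
lra.
Qed.

(** Absorbs the factor t coming from a double root at the price of an arbitrarily small rate. *)
Lemma growth_id ka : 0 < ka -> growth ka (fun t => t).
Proof.
move=> ka0 b; exists (ka^-1 + `|b| * expR (ka * b)) => t tb.
have e0 := expR_gt0 (- ka * t).
have [t0|t0] := leP t 0.
  rewrite ler0_norm// mulrDl ler_wpDr//.
  rewrite mulrC ler_pdivlMr//; have := @expR_ge1Dx R (- ka * t); lra.
rewrite gtr0_norm// mulrDl ler_wpDl ?mulr_ge0 ?invr_ge0 ?expR_ge0 ?(ltW ka0)//.
have b0 : 0 <= b by rewrite (le_trans (ltW t0)).
rewrite -mulrA -expRD (le_trans tb)// ger0_norm// ler_peMr// -expR0 ler_expR.
have : 0 <= ka * (b - t) by rewrite mulr_ge0// ?(ltW ka0)// subr_ge0.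
lra.
Qed.

Lemma smooth_system w c S : (forall t, is_derive t 1 c (w * S t)) ->
  (forall t, is_derive t 1 S (c t)) -> smooth c /\ smooth S.
Proof.
move=> dc dS.
have h n a b : differentiable_n n (fun t => a * c t + b * S t).
  elim: n a b => [//|n IH] a b.
  apply: (@differentiable_nS _ n _ (fun t => b * c t + (a * w) * S t)) (IH _ _) => t.
  have dct := dc t; have dSt := dS t; by is_derive_tac; ring.
split=> n.
  have -> : c = (fun t => 1 * c t + 0 * S t) by apply/funext => t; ring.
  exact: h.
have -> : S = (fun t => 0 * c t + 1 * S t) by apply/funext => t; ring.
exact: h.
Qed.

(** The pair is cosh(sqrt w t) and sinh(sqrt w t) / sqrt w, continued to w <= 0 as trigonometric
    functions or as 1 and t. It solves f'' = w f for either sign of w and spares later case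
    distinctions. *)
Lemma fundamental_system w : exists c S,
  [/\ forall t, is_derive t 1 c (w * S t), forall t, is_derive t 1 S (c t), c 0 = 1, S 0 = 0 &
    forall ka, 0 < ka -> w <= ka ^+ 2 -> growth ka c /\ growth ka S].
Proof.
have [w0|w0|->] := ltgtP w 0.
- pose e := Num.sqrt (- w).
  have e0 : 0 < e by rewrite sqrtr_gt0 oppr_gt0.
  have e2 : e ^+ 2 = - w by rewrite sqr_sqrtr// oppr_ge0 ltW.
  have Ew : w = - e ^+ 2 by rewrite e2 opprK.
  exists (fun t => cos (e * t)), (fun t => e^-1 * sin (e * t)); split.
  + by move=> t; is_derive_tac; rewrite Ew; field; rewrite gt_eqF.
  + by move=> t; is_derive_tac; field; rewrite gt_eqF.
  + by rewrite mulr0 cos0.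
  + by rewrite mulr0 sin0 mulr0.
  + move=> ka ka0 _; split; first exact: growth_bounded (ltW ka0) (fun t => cos_abs_le1 (e * t)).
    by apply: growthZ; exact: growth_bounded (ltW ka0) (fun t => sin_abs_le1 (e * t)).
- pose s := Num.sqrt w.
  have s0 : 0 < s by rewrite sqrtr_gt0.
  have Ew : w = s ^+ 2 by rewrite sqr_sqrtr// ltW.
  exists (fun t => 2^-1 * (expR (s * t) + expR (- s * t))),
    (fun t => (2 * s)^-1 * (expR (s * t) + -1 * expR (- s * t))); split.
  + by move=> t; is_derive_tac; rewrite Ew; field; rewrite gt_eqF.
  + by move=> t; is_derive_tac; field; rewrite gt_eqF.
  + by rewrite !mulr0 expR0; field.
  + by rewrite !mulr0 expR0; ring.
  + move=> ka ka0; rewrite Ew ler_pXn2r ?nnegrE ?(ltW s0) ?(ltW ka0)// => sk.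
    have g1 : growth ka (fun t => expR (s * t)) by apply: growth_expR; lra.
    have g2 : growth ka (fun t => expR (- s * t)) by apply: growth_expR; lra.
    by split; apply: growthZ; apply: growthD => //; exact: growthZ.
- exists (fun=> 1), (fun t => t); split=> //.
  + by move=> t; rewrite mul0r; exact: is_derive1_cst.
  + by move=> t; exact: is_derive1_id.
  + move=> ka ka0 _; split; last exact: growth_id.
    by apply: (@growth_bounded _ _ 1) => [|t]; [exact: ltW|rewrite normr1].
Qed.

Variables c1 c2 : R.
Let x := 5 / 4 - c1.
Let m := 9 / 16 + 3 / 2 * c1 + c2.

Lemma derive1n_chain (f0 f1 f2 f3 f4 : R -> R) :
  (forall t, is_derive t 1 f0 (f1 t)) -> (forall t, is_derive t 1 f1 (f2 t)) ->
  (forall t, is_derive t 1 f2 (f3 t)) -> (forall t, is_derive t 1 f3 (f4 t)) ->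
  [/\ f0^`(1)%classic = f1, f0^`(2)%classic = f2, f0^`(3)%classic = f3 & f0^`(4)%classic = f4].
Proof.
move=> d0 d1 d2 d3.
have e1 : f0^`(1)%classic = f1 by rewrite derive1n1; exact: derive1_ext.
have e2 : f0^`(2)%classic = f2 by rewrite derive1nS e1; exact: derive1_ext.
have e3 : f0^`(3)%classic = f3 by rewrite derive1nS e2; exact: derive1_ext.
by split=> //; rewrite derive1nS e3; exact: derive1_ext.
Qed.

(* The indicial polynomial is quadratic in [s ^+ 2], with discriminant [x ^+ 2 - m]. *)
Lemma unstable_roots :
  (if c1 >= - (11 / 4) then 45 + 12 * c1 + c1 ^+ 2 else - (105 + 152 * c1) / 16) > c2 ->
  (exists d w, [/\ w < 4, w = x - d & d ^+ 2 = x ^+ 2 - m]) \/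
  (exists s e, [/\ 0 < s, s < 2, e != 0, x = s ^+ 2 - e ^+ 2 & m = (s ^+ 2 + e ^+ 2) ^+ 2]).
Proof.
move=> hc; have [D0|D0] := leP 0 (x ^+ 2 - m).
  left; pose d := Num.sqrt (x ^+ 2 - m).
  have d0 : 0 <= d by exact: sqrtr_ge0.
  have dE : d ^+ 2 = x ^+ 2 - m by rewrite sqr_sqrtr.
  exists d, (x - d); split=> //; rewrite ltNge; apply/negP => w4.
  move: hc; apply/negP; rewrite -leNgt.
  have h : d ^+ 2 <= (x - 4) ^+ 2.
    have dx : d <= x - 4 by rewrite lerBrDl -lerBrDr.
    by rewrite ler_pXn2r// nnegrE (le_trans d0).
  rewrite dE in h; have x4 : 4 <= x by lra.
  have c1le : c1 <= - (11 / 4) by rewrite /x in x4; lra.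
  have h' : 0 <= m - 8 * x + 16 by move: h; clear; move: (x) (m) => X M h; nra.
  case: ifP => [c1ge|_]; last by rewrite /m /x in h'; lra.
  have -> : c1 = - (11 / 4) by apply/eqP; rewrite eq_le c1le.
  by rewrite /m /x in h'; lra.
right; pose q := Num.sqrt m.
have m0 : 0 < m by have := sqr_ge0 x; lra.
have q0 : 0 < q by rewrite sqrtr_gt0.
have qE : q ^+ 2 = m by rewrite sqr_sqrtr// ltW.
have xq : `|x| < q.
  by rewrite -(ltr_pXn2r (_ : (0 < 2)%N)) ?nnegrE ?(ltW q0)// real_normK ?num_real// qE; lra.
have [xq1 xq2] : - q < x /\ x < q by apply/andP; rewrite -ltr_norml.
have s20 : 0 < (q + x) / 2 by lra.
have e20 : 0 < (q - x) / 2 by lra.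
exists (Num.sqrt ((q + x) / 2)), (Num.sqrt ((q - x) / 2)).
rewrite !sqr_sqrtr ?ltW//; split.
- by rewrite sqrtr_gt0.
- have two : Num.sqrt (2 ^+ 2) = 2 :> R by rewrite sqrtr_sqr ger0_norm.
  rewrite -[ltRHS]two ltr_sqrt ?exprn_gt0// ltNge; apply/negP => h4.
  have q8 : 8 - x <= q by move: h4; clear; move: (x) (q) => X Q; lra.
  move: hc; apply/negP; rewrite -leNgt; case: ifP => [c1ge|/negbT]; last first.
    rewrite -ltNge => c1lt; have h := sqr_ge0 (x - 4).
    have h2 : x ^+ 2 < m by rewrite -subr_lt0.
    by move: h h2; rewrite sqrrB /x /m; lra.
  have x8 : 0 <= 8 - x by rewrite /x; lra.
  have : (8 - x) ^+ 2 <= q ^+ 2 by rewrite ler_pXn2r// nnegrE ltW.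
  by rewrite qE /x /m; lra.
- by rewrite gt_eqF// sqrtr_gt0.
- by field.
- by rewrite -qE; field.
Qed.

Let charpoly (w d : R) : w = x - d -> d ^+ 2 = x ^+ 2 - m -> w ^+ 2 - 2 * x * w + m = 0.
Proof. by move=> -> E; rewrite (_ : m = x ^+ 2 - d ^+ 2); [ring|rewrite E; ring]. Qed.

Lemma growth_rate w : w < 4 -> exists ka, [/\ 0 < ka, ka < 2 & w <= ka ^+ 2].
Proof.
move=> w4; have [w1|w1] := leP w 1; first by exists 1; split; rewrite ?expr1n//; lra.
have w0 : 0 <= w by lra.
exists (Num.sqrt w); split; [by rewrite sqrtr_gt0; lra| |by rewrite sqr_sqrtr].
have -> : 2 = Num.sqrt (2 ^+ 2) :> R by rewrite sqrtr_sqr ger0_norm.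
by rewrite ltr_sqrt ?exprn_gt0//; lra.
Qed.

(** One value w < 4 of s^2 suffices, and it may be negative. Its solutions c and S have concomitant
    2 d at 0. This vanishes for d = 0, but then w is a double value, t S is a further solution, and
    its concomitant with S is 2. *)
Lemma real_roots_defect d w : w < 4 -> w = x - d -> d ^+ 2 = x ^+ 2 - m ->
  ~ essentially_selfadjoint (tau2_op c1 c2).
Proof.
move=> w4 wd dE; have P0 := charpoly wd dE.
have [c [S [dc dS cz Sz gr]]] := fundamental_system w.
have [sc sS] := smooth_system dc dS.
have [ka [ka0 ka2 wk]] := growth_rate w4; have [gc gS] := gr ka ka0 wk.
have dwc t : is_derive t 1 (fun t => w * c t) (w ^+ 2 * S t).
  by have dct := dc t; is_derive_tac; ring.
have dwS t : is_derive t 1 (fun t => w * S t) (w * c t).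
  by have dSt := dS t; is_derive_tac; ring.
have dwwS t : is_derive t 1 (fun t => w ^+ 2 * S t) (w ^+ 2 * c t).
  by have dSt := dS t; is_derive_tac; ring.
have [S1 S2 S3 S4] := derive1n_chain dS dc dwS dwc.
have TS t : log_tau c1 c2 S t = 0.
  rewrite /log_tau S4 S2 -/x -/m; transitivity ((w ^+ 2 - 2 * x * w + m) * S t); first by ring.
  by rewrite P0 mul0r.
have [d0|d0] := eqVneq d 0.
  have wx : w = x by rewrite wd d0 subr0.
  have dv0 t : is_derive t 1 (fun t => t * S t) (S t + t * c t).
    by have dSt := dS t; is_derive_tac; ring.
  have dv1 t : is_derive t 1 (fun t => S t + t * c t) (2 * c t + w * (t * S t)).
    by have dct := dc t; have dSt := dS t; is_derive_tac; ring.
  have dv2 t : is_derive t 1 (fun t => 2 * c t + w * (t * S t)) (3 * w * S t + w * (t * c t)).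
    by have dct := dc t; have dSt := dS t; is_derive_tac; ring.
  have dv3 t : is_derive t 1 (fun t => 3 * w * S t + w * (t * c t)) (4 * w * c t + w ^+ 2 * (t * S t)).
    by have dct := dc t; have dSt := dS t; is_derive_tac; ring.
  have [v1 v2 v3 v4] := derive1n_chain dv0 dv1 dv2 dv3.
  apply: (@defect_vectors R c1 c2 S (fun t => t * S t)) => //.
  - by apply: smoothM => //; exact: smooth_id.
  - by exists ka.
  - exists ((2 - ka) / 2 + ka); first by lra.
    by apply: growthM gS; apply: growth_id; lra.
  - move=> t; rewrite /log_tau v4 v2 -/x -/m.
    transitivity ((w ^+ 2 - 2 * x * w + m) * (t * S t)); last by rewrite P0 mul0r.
    by rewrite wx; ring.
  - rewrite /concomitant v1 v2 v3 S1 S2 S3 cz Sz -/x.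
    by rewrite (_ : _ - _ = 2)//; ring.
have [C1 C2 C3 C4] := derive1n_chain dc dwS dwc dwwS.
apply: (@defect_vectors R c1 c2 c S) => //.
- by exists ka.
- by exists ka.
- move=> t; rewrite /log_tau C4 C2 -/x -/m.
  transitivity ((w ^+ 2 - 2 * x * w + m) * c t); first by ring.
  by rewrite P0 mul0r.
- rewrite /concomitant C1 C2 C3 S1 S2 S3 cz Sz -/x.
  by rewrite (_ : _ - _ = 2 * d); [rewrite mulf_neq0|rewrite wd; ring].
Qed.

(** The solutions e^(s t) cos(e t) and e^(- s t) cos(e t) grow at -oo at most like e^(- s t), and
    their concomitant at 0 is - 4 s e^2. *)
Lemma complex_roots_defect s e : 0 < s -> s < 2 -> e != 0 -> x = s ^+ 2 - e ^+ 2 ->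
  m = (s ^+ 2 + e ^+ 2) ^+ 2 -> ~ essentially_selfadjoint (tau2_op c1 c2).
Proof.
move=> s0 s2 e0 xE mE; pose w := - e ^+ 2.
have [c [S [dc dS cz Sz gr]]] := fundamental_system w.
have [sc sS] := smooth_system dc dS.
have k0 : 0 < (2 - s) / 2 by lra.
have wk : w <= ((2 - s) / 2) ^+ 2 by rewrite /w (@le_trans _ _ 0) ?sqr_ge0// oppr_le0 sqr_ge0.
have [gc gS] := gr _ k0 wk.
(* The derivatives of e^(p t) c stay in the span of e^(p t) c and e^(p t) w S, so they are computed
   on the coefficients A, B. *)
pose F p A B t := expR (p * t) * (A * c t + B * w * S t).
have dF p A B t : is_derive t 1 (F p A B) (F p (p * A + w * B) (A + p * B) t).
  by have dct := dc t; have dSt := dS t; rewrite /F; is_derive_tac; ring.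
have sE p : smooth (fun t => expR (p * t)).
  have d t : is_derive t 1 (fun t => expR (p * t)) (p * expR (p * t)) by is_derive_tac; ring.
  move=> n; suff h a : differentiable_n n (fun t => a * expR (p * t)).
    by have := h 1; under eq_fun do rewrite mul1r.
  elim: n a => [//|n IH] a.
  apply: (@differentiable_nS _ n _ (fun t => a * p * expR (p * t))) (IH _) => t.
  by have dt := d t; is_derive_tac; ring.
have EF p : F p 1 0 = (fun t => expR (p * t) * c t) by apply/funext => t; rewrite /F; ring.
have sF p : smooth (F p 1 0) by rewrite EF; exact: smoothM.
have gF p : 0 <= p + s -> subcritical (F p 1 0).
  (* The midpoint of s and 2: the factor c is charged with the positive rate (2 - s) / 2, as the
     growth bound of [fundamental_system] asks for a positive one. *)
  move=> ps; rewrite EF; exists (s + (2 - s) / 2); first by lra.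
  by apply: growthM gc; exact: growth_expR.
have ch p := derive1n_chain (dF p 1 0) (dF p _ _) (dF p _ _) (dF p _ _).
have DF p t : p ^+ 2 = s ^+ 2 -> log_tau c1 c2 (F p 1 0) t = 0.
  move=> ps; have [_ f2 _ f4] := ch p.
  rewrite /log_tau f4 f2 -/x -/m /F mE xE -ps /w; ring.
apply: (@defect_vectors R c1 c2 (F s 1 0) (F (- s) 1 0)) => //.
- by apply: gF; lra.
- by apply: gF; lra.
- by move=> t; apply: DF.
- by move=> t; apply: DF; rewrite sqrrN.
have [f1 f2 f3 _] := ch s; have [g1 g2 g3 _] := ch (- s).
rewrite /concomitant f1 f2 f3 g1 g2 g3 -/x /F !mulr0 expR0 cz Sz xE.
rewrite (_ : _ - _ = (- 4) * s * e ^+ 2); last by rewrite /w; ring.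
by rewrite !mulf_neq0 ?expf_neq0// ?oppr_eq0 ?gt_eqF.
Qed.

End fundamental_system.

Theorem theorem2p2 (R : realType) (c1 c2 : R) :
  essentially_selfadjoint (tau2_op c1 c2) <->
  (if c1 >= - (11 / 4) then 45 + 12 * c1 + c1 ^+ 2
   else - (105 + 152 * c1) / 16) <= c2.
Proof.
split=> [esa|/esa_condition_stable_roots]; last exact: stable_essentially_selfadjoint.
rewrite leNgt; apply/negP => /unstable_roots[[d [w [w4 wd dE]]]|[s [e [s0 s2 e0 xE mE]]]].
  exact: (real_roots_defect w4 wd dE esa).
exact: (complex_roots_defect s0 s2 e0 xE mE esa).
Qed.
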